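(* Let $k$ be a positive integer. There is an explicit absolute constant $c>0$ such that for $1 \le H \le X$, as $X \to \infty$, \[ M_k(X,H) = \mu_k \left(A^{\frac12} H^{\frac14}\right)^k + O_k\!\left(H^{\frac{k}{4}-\frac{c}{k}} + H^k X^{-\frac13+o(1)}\right). \]
   Context: A squarefree number is a positive integer not divisible by the square of any prime ($1$ counts as squarefree). Let $N_S(x)$ be the number of squarefree integers $n \le x$, and $N_S(n,H) = N_S(n+H) - N_S(n)$ the number of squarefrees in $(n,n+H]$. Define \[ M_k(X,H) = \frac1X \sum_{n \le X} \left(N_S(n,H) - \frac{H}{\zeta(2)}\right)^k, \qquad A = \frac{\zeta(3/2)}{\pi}\prod_{p \text{ prime}}\left(1 - \frac{3}{p^2} + \frac{2}{p^3}\right). \] Here $\mu_k = 1\cdot 3 \cdots (k-1)$ if $k$ is even and $\mu_k = 0$ if $k$ is odd. *)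

(* Defs.v *)
From mathcomp Require Import all_boot all_order all_algebra.
From mathcomp Require Import all_classical all_reals all_analysis.
Set Implicit Arguments.
Unset Strict Implicit.
Unset Printing Implicit Defensive.
Import Order.TTheory GRing.Theory Num.Theory.
Import numFieldNormedType.Exports.
Local Open Scope classical_set_scope.
Local Open Scope ring_scope.

Definition squarefree (n : nat) : bool :=
  (0 < n)%N && all (fun p => ~~ (p ^ 2 %| n)%N) (primes n).

Lemma squarefreeP (n : nat) :
  reflect ((0 < n)%N /\ forall p, prime p -> ~~ (p ^ 2 %| n)%N) (squarefree n).
Proof.
apply: (iffP andP) => -[n0].
  move=> /allP sqf; split=> // p pp; apply/negP => p2n.
  have /sqf : p \in primes n.
    by rewrite mem_primes pp n0 (dvdn_trans _ p2n)// expnS dvdn_mulr.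
  by rewrite p2n.
move=> sqf; split=> //; apply/allP => p.
by rewrite mem_primes => /and3P[/sqf].
Qed.

Section moments.
Context {R : realType}.
Implicit Types x X H s : R.

Definition NS x : nat :=
  (\sum_(1 <= n < (Num.truncn x).+1 | squarefree n) 1)%N.

Definition NSint (n : nat) H : R := (NS (n%:R + H))%:R - (NS (n%:R : R))%:R.

(* Only meaningful for s > 1, where the series converges. *)
Definition zeta s : R := limn [series (n.+1%:R : R) `^ (- s)]_n.

Definition M (k : nat) X H : R :=
  X^-1 * \sum_(1 <= n < (Num.truncn X).+1) (NSint n H - H / zeta 2) ^+ k.

Definition A : R :=
  zeta (3 / 2) / pi *
  limn (fun N : nat => \prod_(0 <= p < N | prime p)
    (1 - 3 / (p%:R : R) ^+ 2 + 2 / (p%:R : R) ^+ 3)).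

End moments.

Arguments A : clear implicits.

Definition mu (k : nat) : nat :=
  if odd k then 0%N else (\prod_(0 <= i < k./2) i.*2.+1)%N.

(* Main.v *)
Require Import Defs.
From mathcomp Require Import all_boot all_order all_algebra.
From mathcomp Require Import all_classical all_reals all_analysis.
From mathcomp Require Import ring lra zify.
Set Implicit Arguments.
Unset Strict Implicit.
Unset Printing Implicit Defensive.
Import Order.TTheory GRing.Theory Num.Theory.
Import numFieldNormedType.Exports.
From mathcomp.real_closed Require Import complex.
Local Open Scope ring_scope.

(* Let [z] be a large cutoff and replace squarefree numbers by the integers free of squares of
   primes below [z], which are periodic modulo [N], the square of the product of these primes.

   Transfer: inclusion-exclusion up to level [L^(2/3)] (the tail is handled by a greedy choice of
   a divisor of intermediate size) shows that averages over [n <= L] of products of shifts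
   equal the averages over a full period up to [O(L^(-1/3+eps))].

   Moments over a period: expand the counting function in additive characters [a / N].  The k-th
   moment is a sum over tuples [(a_1, ..., a_k)] with [a_1 + ... + a_k = 0] mod [N].  Tuples in which
   [a_1] is cancelled by another [a_j] give [(k - 1) m_2 m_(k-2)].  The others are negligible: with
   [r_i] the radical of the denominator of [a_i / N], a very small or very large [r_i] is excluded
   by Cauchy-Schwarz, a large lcm of the [r_i] by a Finner (Montgomery-Vaughan) inequality, and
   otherwise one counts fractions: the primes lying in [r_1] and exactly one further [r_j] are
   determined by the remaining data, and if they are few then many primes of [r_1] are shared
   by three fractions.

   Variance: the pair correlation of squarefree numbers gives
   [m_2 = W sum_e g(e) phi(h / e^2)] with [phi(x) = {x} (1 - {x})].  Expanding [phi] in a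
   Fourier series and comparing [sum_e sin(pi x / e^2)^2] with an integral, evaluated by the
   Fresnel integral of [sin], yields [m_2 ~ A sqrt h].  The recurrence for the moments
   then produces the Gaussian moments. *)

(** * The Fresnel integral *)

(** All estimates for averages over a period are uniform in the cutoff [z]. So [z] is chosen last,
    in terms of [H] and [X], and as large as desired: being free of squares of primes below [z] is
    then the same as being squarefree on the range that occurs, and the truncated constants are as
    close to their limits as needed.

    The exponent -1/3 balances two errors at level [y]: the truncated sum costs [y / L], and the [n]
    whose bad primes have a subproduct in [[sqrt y, y]] form a proportion about [y^(-1/2)]; hence
    [y = L^(2/3)].

    For unpaired tuples two crude bounds meet exactly at the size of the main term. With [U] the lcm
    of the radicals, counting gives about [U] and Finner about [h^(k/2) / U]; both are [h^(k/4)]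
    when [U = h^(k/4)]. Only radicals near [sqrt h] and [U] near [h^(k/4)] are critical, and there a
    small power of [h] must come from the arithmetic of the fractions. Each of the [k] radicals may
    deviate from [sqrt h] only by a factor [h^(O(1/k))], which is the source of the saving
    [c / k]. *)

Section fresnel.
Local Open Scope classical_set_scope.
Context {R : realType}.
Implicit Types (t x y th : R).
Notation mu := (@lebesgue_measure R).

Definition RI (f : R -> R) : R := \int[mu]_(y in `[0, 1]) f y.

Lemma RI_integrable (f : R -> R) : continuous f -> mu.-integrable `[0, 1] (EFin \o f).
Proof.
move=> cf; apply: continuous_compact_integrable; first exact: segment_compact.
exact: continuous_subspaceT.
Qed.

Lemma RID (f g : R -> R) : continuous f -> continuous g ->
  RI (fun y => f y + g y) = RI f + RI g.
Proof. by move=> cf cg; rewrite /RI RintegralD//; exact: RI_integrable. Qed.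

Lemma RIZ c (f : R -> R) : continuous f -> RI (fun y => c * f y) = c * RI f.
Proof. by move=> cf; rewrite /RI RintegralZl//; exact: RI_integrable. Qed.

Lemma RI_FTC (F f : R -> R) : (forall y, is_derive y 1 F (f y)) -> continuous f ->
  RI f = F 1 - F 0.
Proof.
move=> dF cf; rewrite /RI /Rintegral.
have cF : continuous F.
  by move=> y; apply/differentiable_continuous/derivable1_diffP; apply: ex_derive.
rewrite (@continuous_FTC2 _ f F 0 1)//.
- exact: continuous_subspaceT.
- split.
  + by move=> y _; apply: ex_derive.
  + by apply: cvg_at_right_filter; exact: cF.
  + by apply: cvg_at_left_filter; exact: cF.
- by move=> y _; rewrite derive1E derive_val.
Qed.

Lemma RI_bound (f : R -> R) (M : R) : continuous f ->
  (forall y, 0 <= y <= 1 -> `|f y| <= M) -> `|RI f| <= M.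
Proof.
move=> cf fM; have M0 : 0 <= M by apply: le_trans (fM 0 _) => //; rewrite lexx ler01.
rewrite /RI; apply: le_trans (le_normr_Rintegral _ (RI_integrable cf)) _ => //.
have -> : M = RI (cst M).
  by rewrite /RI Rintegral_cst//= lebesgue_measure_itv//= lte01 oppr0 addr0 mulr1.
have cn : continuous (fun y => `|f y|).
  by move=> y; apply: cvg_norm; exact: cf.
apply: le_Rintegral => //.
- exact: RI_integrable.
- by apply: RI_integrable => y; exact: cvg_cst.
Qed.

Lemma RI_derive (f df : R -> R -> R) t (M : R) :
  (forall x, continuous (f x)) -> (forall x, continuous (df x)) ->
  (forall x y, is_derive x 1 (f ^~ y) (df x y)) ->
  (forall x y, t - 1 < x < t + 1 -> 0 <= y <= 1 -> `|df x y| <= M) ->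
  is_derive t 1 (fun x => RI (f x)) (RI (df t)).
Proof.
move=> cf cdf dfd dM.
have E x y : partial1of2 f x y = df x y.
  by rewrite partial1of2E; apply: derive_val.
have := @cvg_differentiation_under_integral R _ _ mu f `[0, 1] _ t (t - 1) (t + 1)
  _ (fun x _ => RI_integrable (cf x)) _ (cst M) _ _ _.
rewrite (_ : (fun y => partial1of2 f t y) = df t); last by apply/funext => y; rewrite E.
move=> H; have {}H : h^-1 *: (RI (f (h + t)) - RI (f t)) @[h --> 0^'] --> RI (df t).
  apply: H => //.
  - by rewrite /= in_itv/=; apply/andP; split; lra.
  - move=> y; rewrite /cst; apply: le_trans (dM t 0 _ _); rewrite ?normr_ge0//; lra.
  - by apply: RI_integrable => y; exact: cvg_cst.
  - move=> x y; rewrite /= !in_itv/= E => xt y01; exact: dM.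
apply: DeriveDef.
  by apply/cvg_ex; eexists; under eq_fun do rewrite scaler1; exact: H.
by apply/cvg_lim => //; under eq_fun do rewrite scaler1; exact: H.
Qed.

(** Locked, so that it remains an atom in the computations below. *)
Definition ka : R := locked (2 * pi).

Lemma kaE : ka = 2 * pi. Proof. by rewrite /ka -lock. Qed.

Lemma ka_gt0 : 0 < ka. Proof. by rewrite kaE mulr_gt0 ?pi_gt0. Qed.

Lemma ka_ge0 : 0 <= ka. Proof. exact: ltW ka_gt0. Qed.

(* [fr 0] and [fr (- pi/2)] are the Fresnel integrals of cos (2 pi w^2) and
   sin (2 pi w^2) over [0, t], written with w = t * y. *)
Definition fr th t : R := t * RI (fun y => cos (ka * t ^+ 2 * y ^+ 2 + th)).

Lemma continuous_cosq a b : continuous (fun y : R => cos (a * y ^+ 2 + b)).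
Proof.
move=> y; apply: differentiable_continuous; apply/derivable1_diffP.
exact: ex_derive.
Qed.

Lemma is_derive_fr th t : is_derive t 1 (fr th) (cos (ka * t ^+ 2 + th)).
Proof.
pose f x y := cos (ka * x ^+ 2 * y ^+ 2 + th) : R.
pose df x y := - sin (ka * x ^+ 2 * y ^+ 2 + th) * (2 * ka * x * y ^+ 2) : R.
have cdf x : continuous (df x).
  move=> y; apply: differentiable_continuous; apply/derivable1_diffP.
  exact: ex_derive.
have D : is_derive t 1 (fun x => RI (f x)) (RI (df t)).
  apply: (RI_derive (M := 2 * ka * (`|t| + 1))) => //.
  - by move=> x; exact: continuous_cosq.
  - move=> x y; rewrite /f /df; apply: is_derive_eq; rewrite /GRing.scale/=; ring.
  - move=> x y xt y01; rewrite /df normrM normrN.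
    apply: le_trans (_ : 1 * (2 * ka * `|x| * 1) <= _).
      apply: ler_pM => //; first exact: sin_max.
      rewrite normrM normrX normrM (gtr0_norm (_ : 0 < 2 * ka)) ?mulr_gt0 ?ka_gt0 ?ka_gt0//.
      rewrite ler_wpM2l ?mulr_ge0 ?(ltW ka_gt0) ?ka_ge0//.
      by case/andP: y01 => y0 y1; rewrite ger0_norm// expr_le1.
    rewrite mul1r mulr1 ler_wpM2l ?mulr_ge0 ?ka_ge0//.
    by rewrite ler_norml; have := ler_norm t; have := ler_norm (- t); rewrite normrN; lra.
have -> : cos (ka * t ^+ 2 + th) = RI (f t) + t * RI (df t).
  have cf : continuous (f t) by exact: continuous_cosq.
  rewrite -RIZ// -RID//; last first.
    by move=> y; apply: cvgM; [exact: cvg_cst|exact: cdf].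
  have dF y : is_derive y 1 (fun y => y * f t y) (f t y + t * df t y).
    by rewrite /f /df; apply: is_derive_eq; rewrite /GRing.scale/=; ring.
  rewrite (RI_FTC dF).
    by rewrite mul1r mul0r subr0 /f expr1n mulr1.
  move=> y; apply: cvgD; first exact: cf.
  by apply: cvgM; [exact: cvg_cst|exact: cdf].
have -> : fr th = (fun x => x * RI (f x)) by [].
by apply: is_derive_eq; rewrite /GRing.scale/=; ring.
Qed.

Lemma fr_shift th t : fr th t = cos th * fr 0 t + sin th * fr (pi / 2) t.
Proof.
have [-> | t0] := eqVneq t 0; first by rewrite /fr !mul0r !mulr0 addr0.
rewrite /fr !(mulrCA _ t) -mulrDr; congr (_ * _).
rewrite -!RIZ -?RID.
- apply: eq_Rintegral => y _; rewrite addr0 cosDpihalf cosD; ring.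
all: try by exact: continuous_cosq.
all: move=> y; apply: differentiable_continuous; apply/derivable1_diffP; exact: ex_derive.
Qed.

(** The oscillating analogue of the integral of exp(- t^2 (1 + y^2)) / (1 + y^2) over [0, 1] that
    evaluates the Gaussian integral: its derivative splits into a trigonometric factor in [t] times
    Fresnel integrals, hence is the derivative of a quadratic form in them. *)
Definition frC th t : R :=
  RI (fun y => cos (ka * t ^+ 2 * y ^+ 2 + (ka * t ^+ 2 + th)) / (1 + y ^+ 2)).

Lemma onesq_gt0 y : 0 < 1 + y ^+ 2.
Proof. by rewrite ltr_pwDl// sqr_ge0. Qed.

Lemma is_derive_onesqV y : is_derive y 1 (fun y : R => (1 + y ^+ 2)^-1) (- (2 * y) / (1 + y ^+ 2) ^+ 2).
Proof.
have n0 := lt0r_neq0 (onesq_gt0 y).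
have d1 : is_derive y 1 (fun y : R => 1 + y ^+ 2) (2 * y).
  by apply: is_derive_eq; rewrite /GRing.scale/=; ring.
have H := is_deriveV (f := fun y : R => 1 + y ^+ 2) n0 d1; apply: (@is_derive_eq _ _ _ _ _ _ _ _ H); rewrite /GRing.scale/=; field.
exact: lt0r_neq0 (onesq_gt0 y).
Qed.

Lemma continuous_derive (F f : R -> R) : (forall y, is_derive y 1 F (f y)) -> continuous F.
Proof.
by move=> dF y; apply/differentiable_continuous/derivable1_diffP; apply: ex_derive.
Qed.

Lemma continuous_frC_integrand a b :
  continuous (fun y : R => cos (a * y ^+ 2 + b) / (1 + y ^+ 2)).
Proof.
move=> y; apply: cvgM; first exact: continuous_cosq.
exact: (continuous_derive is_derive_onesqV).
Qed.

Lemma is_derive_frC th t : is_derive t 1 (frC th)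
  (- (2 * ka) * (sin (ka * t ^+ 2 + th) * fr 0 t - cos (ka * t ^+ 2 + th) * fr (pi / 2) t)).
Proof.
pose f x y := cos (ka * x ^+ 2 * y ^+ 2 + (ka * x ^+ 2 + th)) / (1 + y ^+ 2) : R.
pose df x y := - (2 * ka * x) * sin (ka * x ^+ 2 * y ^+ 2 + (ka * x ^+ 2 + th)) : R.
have -> : - (2 * ka) * (sin (ka * t ^+ 2 + th) * fr 0 t - cos (ka * t ^+ 2 + th) * fr (pi / 2) t)
     = RI (df t).
  have -> : sin (ka * t ^+ 2 + th) * fr 0 t - cos (ka * t ^+ 2 + th) * fr (pi / 2) t =
      fr (ka * t ^+ 2 + th - pi / 2) t.
    by rewrite [RHS]fr_shift cosBpihalf sinBpihalf mulNr.
  rewrite /fr mulrA.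
  have -> : - (2 * ka) * t = - (2 * ka * t) by ring.
  rewrite -RIZ; last exact: continuous_cosq.
  by apply: eq_Rintegral => y _; rewrite /df -[in RHS]cosBpihalf -[in RHS]addrA.
apply: (RI_derive (f := f) (M := 2 * ka * (`|t| + 1))).
- by move=> x; exact: continuous_frC_integrand.
- move=> x y; apply: differentiable_continuous; apply/derivable1_diffP; exact: ex_derive.
- move=> x y; rewrite /f /df.
  have D : is_derive x 1 (fun x => (1 + y ^+ 2)^-1 * cos (ka * x ^+ 2 * y ^+ 2 + (ka * x ^+ 2 + th)))
     (- (2 * ka * x) * sin (ka * x ^+ 2 * y ^+ 2 + (ka * x ^+ 2 + th))).
    apply: is_derive_eq; rewrite /GRing.scale/=; field.
    exact: lt0r_neq0 (onesq_gt0 y).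
  by under eq_fun do rewrite mulrC.
- move=> x y xt y01; rewrite /df mulNr normrN normrM.
  apply: le_trans (_ : 2 * ka * `|x| * 1 <= _).
    apply: ler_pM => //; last exact: sin_max.
    by rewrite normrM (gtr0_norm (_ : 0 < 2 * ka)) ?mulr_gt0 ?ka_gt0.
  rewrite mulr1 ler_wpM2l ?mulr_ge0 ?ka_ge0//.
  by rewrite ler_norml; have := ler_norm t; have := ler_norm (- t); rewrite normrN; lra.
Qed.

Lemma fr0t th : fr th 0 = 0. Proof. by rewrite /fr mul0r. Qed.

(** The left side has derivative zero; at [t = 0] the Fresnel integrals vanish and [frC] reduces to
    [cos th * atan 1]. The phases [th = 0] and [th = pi / 2] give two equations for the two Fresnel
    integrals. *)
Lemma frC_eq th t :
  frC th t + ka * ((fr 0 t ^+ 2 - fr (pi / 2) t ^+ 2) * sin th - 2 * fr 0 t * fr (pi / 2) t * cos th)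
  = pi / 4 * cos th.
Proof.
pose h t := frC th t + ka *
  ((fr 0 t ^+ 2 - fr (pi / 2) t ^+ 2) * sin th - 2 * fr 0 t * fr (pi / 2) t * cos th).
have -> : pi / 4 * cos th = h 0.
  rewrite /h !fr0t !(expr0n, mulr0, mul0r, subr0, addr0)/= /frC.
  rewrite -[LHS]mulrC -atan1 -[atan 1]subr0 -[X in _ - X]atan0.
  have ca : continuous (fun y : R => (1 + y ^+ 2)^-1) by exact: (continuous_derive is_derive_onesqV).
  rewrite -(@RI_FTC atan (fun y => (1 + y ^+ 2)^-1))//.
  rewrite -RIZ//; apply: eq_Rintegral => y _.
  by rewrite expr0n/= mulr0 mul0r !add0r.
apply: (@is_derive_0_is_cst _ h t 0) => x; rewrite /h.
have H1 := is_derive_frC th x; have H2 := is_derive_fr 0 x; have H3 := is_derive_fr (pi / 2) x.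
apply: is_derive_eq; rewrite /GRing.scale/= addr0 cosDpihalf sinD cosD; ring.
Qed.

Lemma der_nincr (f df : R -> R) a b : a <= b ->
  (forall x, a <= x <= b -> is_derive x 1 f (df x)) ->
  (forall x, a <= x <= b -> df x <= 0) -> f b <= f a.
Proof.
move=> ab fd d0; have [||c] := @MVT_segment R f df a b ab.
- by move=> x; rewrite in_itv/= => /andP[ax xb]; apply: fd; rewrite !ltW.
- apply: derivable_within_continuous => x; rewrite in_itv/= => xab.
  by have H := fd x xab; exact: ex_derive.
rewrite in_itv/= => cab E.
by rewrite -subr_le0 E mulr_le0_ge0 ?d0// subr_ge0.
Qed.

Lemma sin_le_id x : 0 <= x -> sin x <= x.
Proof.
move=> x0; have := @der_nincr (fun y => sin y - y) (fun y => cos y - 1) 0 x x0.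
rewrite sin0 subrr => H; rewrite -subr_le0; apply: H.
by move=> y _; rewrite subr_le0 cos_le1.
Qed.

Lemma norm_sin_le x : `|sin x| <= `|x|.
Proof.
wlog x0 : x / 0 <= x => [H|].
  have [/H//|x0] := leP 0 x.
  by have := H (- x); rewrite sinN !normrN; apply; rewrite oppr_ge0 ltW.
rewrite [leRHS]ger0_norm// ler_norml sin_le_id// andbT.
have [xp|xp] := leP x 1.
  have : 0 <= sin x.
    apply: sin_ge0_pi; rewrite x0/=; apply: le_trans xp _.
    by apply: le_trans (pi_ge2 R); rewrite ler1n.
  lra.
by apply: le_trans (sin_geN1 x); rewrite lerN2 ltW.
Qed.

(** [G] is [fr] minus the boundary term of an integration by parts, so its derivative is
    [sin (...) / (2 * ka * x ^+ 2)]. Adding or subtracting [1 / (2 * ka * x)] therefore makes it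
    monotone on [x >= 1], which bounds it from both sides. *)
Lemma fr_bounded th : exists M : R, forall t, 0 <= t -> `|fr th t| <= M.
Proof.
pose G t := fr th t - sin (ka * t ^+ 2 + th) / (2 * ka * t).
exists (`|G 1| + (1 + ka^-1)) => t t0.
have k0 := ka_gt0; have kV0 : 0 < ka^-1 by rewrite invr_gt0.
have [t1|t1] := leP t 1.
  apply: le_trans (_ : 1 <= _); last by rewrite -[leLHS]add0r lerD// lerDl ltW.
  rewrite /fr normrM -[leRHS]mulr1 ler_pM//; first by rewrite ger0_norm.
  by apply: RI_bound; [exact: continuous_cosq|move=> y _; exact: cos_max].
have dG x (x1 : 1 <= x) s : is_derive x 1 (fun x => G x + s * (2 * ka * x)^-1)
    ((sin (ka * x ^+ 2 + th) - s) * (2 * ka * x ^+ 2)^-1).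
  have x0 : x != 0 by rewrite gt_eqF// (lt_le_trans ltr01).
  have n0 : 2 * ka * x != 0 by rewrite !mulf_neq0// gt_eqF.
  have d1 : is_derive x 1 (fun x : R => 2 * ka * x) (2 * ka).
    by apply: is_derive_eq; rewrite /GRing.scale/=; ring.
  have H1 := is_deriveV (f := fun x : R => 2 * ka * x) n0 d1; have H2 := is_derive_fr th x.
  rewrite /G; apply: is_derive_eq; rewrite /GRing.scale/=; field.
  by rewrite x0 gt_eqF.
have pos x : 1 <= x -> 0 <= (2 * ka * x ^+ 2)^-1 
  by move=> _; rewrite invr_ge0; apply: mulr_ge0; [apply: mulr_ge0 => //; exact: ka_ge0|exact: sqr_ge0].
have U : G t + 1 * (2 * ka * t)^-1 <= G 1 + 1 * (2 * ka * 1)^-1.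
  apply: (der_nincr (ltW t1) (fun x xt => dG x _ 1)) => x; first by case/andP.
  move=> /andP[x1 _]; rewrite mulr_le0_ge0 ?pos// subr_le0; exact: sin_le1.
have L : - (G t + (-1) * (2 * ka * t)^-1) <= - (G 1 + (-1) * (2 * ka * 1)^-1).
  apply: (@der_nincr (fun x => - (G x + (-1) * (2 * ka * x)^-1))
    (fun x => - ((sin (ka * x ^+ 2 + th) - (-1)) * (2 * ka * x ^+ 2)^-1)) _ _ (ltW t1)) => x /andP[x1 _].
    by have H := dG x x1 (-1); exact: is_deriveN.
  rewrite oppr_le0 mulr_ge0 ?pos// opprK; have := sin_geN1 (ka * x ^+ 2 + th); lra.
set e := (2 * ka * t)^-1 in U L; set e1 := (2 * ka * 1)^-1 in U L.
have ge0 : 0 <= e by rewrite invr_ge0 !mulr_ge0 ?ka_ge0.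
have ge1 : e <= ka^-1.
  rewrite /e lef_pV2 ?posrE//; last by rewrite !mulr_gt0// (lt_trans ltr01).
  by rewrite mulrAC ler_peMl ?(ltW k0)//; lra.
have e1E : e1 <= ka^-1.
  by rewrite /e1 mulr1 lef_pV2 ?posrE ?mulr_gt0 ?ka_gt0// ler_peMl ?(ltW k0)//; lra.
have : fr th t = G t + sin (ka * t ^+ 2 + th) * e by rewrite /G subrK.
have : `|sin (ka * t ^+ 2 + th) * e| <= e.
  by rewrite normrM (ger0_norm ge0) -[leRHS]mul1r ler_wpM2r// sin_max.
rewrite ler_norml => /andP[s1 s2] ->; rewrite ler_norml.
have := ler_norm (G 1); have := ler_norm (- G 1); rewrite normrN.
have : e1 - e <= ka^-1 by lra.
lra.
Qed.

(** Integration by parts in [y]: the cosine has the antiderivative [P y = t^-1 * fr ph (t * y)],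
    which is [O(1 / t)] by boundedness of the Fresnel integrals. *)
Lemma frC_bounded th : exists M : R, forall t, 0 < t -> `|frC th t| <= M / t.
Proof.
have [M0 H0] := fr_bounded 0; have [M1 H1] := fr_bounded (pi / 2).
pose M : R := M0 + M1; exists (M * 3) => t t0.
have frM ph u : 0 <= u -> `|fr ph u| <= M.
  move=> u0; rewrite fr_shift; apply: le_trans (ler_normD _ _) _.
  rewrite normrM [X in _ + X]normrM /M -[M0]mul1r -[M1]mul1r.
  by apply: lerD; apply: ler_pM => //; [exact: cos_max|exact: H0|exact: sin_max|exact: H1].
set ph := ka * t ^+ 2 + th.
pose P y := t^-1 * fr ph (t * y).
have tn0 : t != 0 by rewrite gt_eqF.
have dP y : is_derive y 1 P (cos (ka * t ^+ 2 * y ^+ 2 + ph)).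
  have H : is_derive y 1 (fun y => fr ph (t * y)) (t * cos (ka * (t * y) ^+ 2 + ph)).
    have H2 := is_derive_fr ph (t * y).
    apply: (@is_derive_eq _ _ _ _ _ _ _ _ (is_derive1_comp _ _)) => //.
    by rewrite /GRing.scale/=; ring.
  by rewrite /P; apply: is_derive_eq; rewrite /GRing.scale/= (_ : ka * (t * y) ^+ 2 = ka * t ^+ 2 * y ^+ 2); [field|ring].
pose q (y : R) := (1 + y ^+ 2)^-1.
have cq : continuous q by exact: (continuous_derive is_derive_onesqV).
have cP : continuous P by exact: (continuous_derive dP).
have cq' : continuous (fun y : R => - (2 * y) / (1 + y ^+ 2) ^+ 2).
  rewrite (_ : (fun y : R => - (2 * y) / (1 + y ^+ 2) ^+ 2) = (fun y => - (2 * y) * (q y * q y))).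
    move=> y; apply: cvgM; last by apply: cvgM; exact: cq.
    by apply: cvgN; apply: cvgM; [exact: cvg_cst|exact: cvg_id].
  apply/funext => y; rewrite /q; field.
  exact: lt0r_neq0 (onesq_gt0 y).
have dPq y : is_derive y 1 (fun y => P y * q y)
   (cos (ka * t ^+ 2 * y ^+ 2 + ph) / (1 + y ^+ 2) + P y * (- (2 * y) / (1 + y ^+ 2) ^+ 2)).
  have H1' := dP y; have H2 := is_derive_onesqV y.
  by rewrite /q; apply: is_derive_eq; rewrite /GRing.scale/=; ring.
have := RI_FTC dPq; rewrite RID; last 2 first.
- exact: continuous_frC_integrand.
- by move=> y; apply: cvgM; [exact: cP|exact: cq'].
rewrite -/(frC th t) => H.
have {H} : frC th t = P 1 * q 1 - P 0 * q 0 - RI (fun y => P y * (- (2 * y) / (1 + y ^+ 2) ^+ 2)).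
  rewrite -H ?addrK// => y; apply: cvgD; first exact: continuous_frC_integrand.
  by apply: cvgM; [exact: cP|exact: cq'].
rewrite {2}/P mulr0 fr0t mulr0 mul0r subr0 => ->.
have PM y : 0 <= y <= 1 -> `|P y| <= M / t.
  move=> /andP[y0 y1]; rewrite /P normrM [leRHS]mulrC (ger0_norm (_ : 0 <= t^-1)) ?invr_ge0 ?(ltW t0)//.
  by rewrite ler_wpM2l ?invr_ge0 ?(ltW t0)// frM// mulr_ge0// ltW.
apply: le_trans (ler_normB _ _) _.
rewrite [leRHS](_ : _ = M / t * 1 + M / t * 2); last by ring.
apply: lerD.
  rewrite normrM; apply: ler_pM => //; first by rewrite PM// lexx ler01.
  by rewrite /q expr1n (_ : 1 + 1 = 2)// ger0_norm; lra.
apply: RI_bound => [y|y y01]; first by apply: cvgM; [exact: cP|exact: cq'].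
rewrite normrM; apply: ler_pM => //; first exact: PM.
rewrite normrM normrN normfV (ger0_norm (exprn_ge0 _ (ltW (onesq_gt0 y)))).
case/andP: (y01) => y0 y1; rewrite ger0_norm ?mulr_ge0//.
rewrite ler_pdivrMr ?exprn_gt0 ?onesq_gt0//.
apply: le_trans (_ : 2 * 1 <= _); first by rewrite ler_wpM2l.
by rewrite ler_wpM2l// exprn_ege1// lerDl sqr_ge0.
Qed.

Lemma frC_cvg0 th : frC th t @[t --> +oo] --> (0 : R).
Proof.
have [M HM] := frC_bounded th.
have L : M / t @[t --> +oo] --> (0 : R).
  rewrite -[X in _ --> X](mulr0 M); apply: cvgM; first exact: cvg_cst.
  by apply/gtr0_cvgV0; [near=> t; near: t; exact: nbhs_pinfty_gt|exact: cvg_id].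
apply: norm_cvg0.
apply: (@squeeze_cvgr _ _ _ _ (cst 0) (fun t => M / t)) => //; last exact: cvg_cst.
near=> t; rewrite normr_ge0/= HM//; near: t; exact: nbhs_pinfty_gt.
Unshelve. all: end_near. Qed.

(** [frC_eq] only determines squares and products, and this sign selects the root. [J] is the
    integral from 0 of [sin (pi * v ^+ 2) ^+ 2 / v ^+ 2], written through [fr] by an integration by
    parts; it is increasing and its lower bound near 0 tends to 0, so it is nonnegative. *)
Lemma fr_pihalf_le0 t : 0 < t -> fr (pi / 2) t <= 0.
Proof.
move=> t0; rewrite -oppr_ge0.
pose J v := - sin (pi * v ^+ 2) ^+ 2 / v - ka * fr (pi / 2) v.
have dJ x : 0 < x -> is_derive x 1 J (sin (pi * x ^+ 2) ^+ 2 / x ^+ 2).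
  move=> x0; have xn0 : x != 0 by rewrite gt_eqF.
  have d1 : is_derive x 1 (fun x : R => x) 1 by exact: is_derive_id.
  have H1 := is_deriveV xn0 d1; have H2 := is_derive_fr (pi / 2) x.
  rewrite /J; apply: is_derive_eq; rewrite /GRing.scale/= cosDpihalf kaE.
  have -> : 2 * pi * x ^+ 2 = (pi * x ^+ 2) *+ 2 by ring.
  by rewrite sin_mulr2n; field.
have J0 v : 0 < v -> v <= 1 -> - (pi ^+ 2 + ka) * v <= J v.
  move=> v0 v1; rewrite /J mulNr mulrDl opprD.
  rewrite [X in _ <= X + _]mulNr; apply: lerD; rewrite lerN2; last first.
    rewrite ler_pM2l ?ka_gt0//.
    apply: le_trans (ler_norm _) _; rewrite /fr normrM (gtr0_norm v0) -[leRHS]mulr1.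
    rewrite ler_pM2l//; apply: RI_bound; first exact: continuous_cosq.
    by move=> y _; exact: cos_max.
  rewrite ler_pdivrMr//.
  apply: le_trans (_ : (pi * v ^+ 2) ^+ 2 <= _).
    by rewrite -[leLHS]real_normK ?num_real// -[leRHS]real_normK ?num_real// lerXn2r ?nnegrE// norm_sin_le.
  rewrite exprMn -[leRHS]mulrA -expr2 ler_wpM2l ?sqr_ge0// -exprM ler_wiXn2l//.
  exact: ltW.
have Jinc a b : 0 < a -> a <= b -> J a <= J b.
  move=> a0 ab; rewrite -lerN2.
  apply: (@der_nincr (fun x => - J x) (fun x => - (sin (pi * x ^+ 2) ^+ 2 / x ^+ 2)) _ _ ab).
    by move=> x /andP[ax _]; have H := dJ x (lt_le_trans a0 ax); exact: is_deriveN.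
  by move=> x _; rewrite oppr_le0 divr_ge0// sqr_ge0.
have Jt : 0 <= J t.
  apply/ler_addgt0Pr => e e0; pose c := pi ^+ 2 + ka.
  have c0 : 0 < c by rewrite ltr_wpDl ?sqr_ge0 ?ka_gt0.
  pose v := Num.min (Num.min t 1) (e / c).
  have v0 : 0 < v by rewrite !lt_min t0 ltr01 divr_gt0.
  have vt : v <= t by rewrite /v !ge_min lexx.
  have v1 : v <= 1 by rewrite /v !ge_min lexx orbT.
  have ve : c * v <= e by rewrite mulrC -ler_pdivlMr// /v !ge_min lexx orbT.
  have := le_trans (J0 v v0 v1) (Jinc v t v0 vt); rewrite -/c mulNr; lra.
rewrite -(pmulr_rge0 _ ka_gt0) mulrN; apply: le_trans Jt _.
rewrite /J -lerBrDr opprK addNr mulNr oppr_le0 divr_ge0 ?sqr_ge0// ltW//.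
Qed.

(** With [A] and [D] the two Fresnel integrals, [A^2 - D^2] tends to 0 and [2 A D] to -1/8. Then
    [A^2 + D^2], the square root of [(A^2 - D^2)^2 + (2 A D)^2], tends to 1/8, so [D^2] tends to
    1/16, and [- D >= 0]. *)
Lemma fresnel_sin : exists B : R -> R,
  [/\ B 0 = 0, (forall t, is_derive t 1 B (sin (2 * pi * t ^+ 2))) &
      B t @[t --> +oo] --> (1 / 4 : R)].
Proof.
exists (fun t => - fr (pi / 2) t); split.
- by rewrite fr0t oppr0.
- move=> t; have H := is_derive_fr (pi / 2) t.
  by apply: is_derive_eq; rewrite cosDpihalf opprK kaE.
pose A t := fr 0 t; pose D t := fr (pi / 2) t.
have k0 : ka != 0 by rewrite gt_eqF ?ka_gt0.
have L1 : A t ^+ 2 - D t ^+ 2 @[t --> +oo] --> (0 : R).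
  have -> : (fun t => A t ^+ 2 - D t ^+ 2) = (fun t => - ka^-1 * frC (pi / 2) t).
    apply/funext => t; have := frC_eq (pi / 2) t.
    rewrite sin_pihalf cos_pihalf !mulr0 mulr1 subr0 -/(A t) -/(D t) => /eqP.
    by rewrite addr_eq0 => /eqP ->; field.
  rewrite -[X in _ --> X](mulr0 (- ka^-1)).
  by apply: cvgM; [exact: cvg_cst|exact: frC_cvg0].
have L2 : 2 * A t * D t @[t --> +oo] --> (- (1 / 8) : R).
  have -> : (fun t => 2 * A t * D t) = (fun t => ka^-1 * (frC 0 t - pi / 4)).
    apply/funext => t; have := frC_eq 0 t.
    rewrite sin0 cos0 !mulr0 !mulr1 add0r -/(A t) -/(D t) => <-; field.
    exact: k0.
  have -> : - (1 / 8) = ka^-1 * (0 - pi / 4) :> R.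
    rewrite kaE; move: (pi : R) (lt0r_neq0 (pi_gt0 R)) => p p0; field; exact: p0.
  apply: cvgM; first exact: cvg_cst.
  by apply: cvgB; [exact: frC_cvg0|exact: cvg_cst].
have L3 : A t ^+ 2 + D t ^+ 2 @[t --> +oo] --> (1 / 8 : R).
  have -> : (fun t => A t ^+ 2 + D t ^+ 2) =
      (fun t => Num.sqrt ((A t ^+ 2 - D t ^+ 2) ^+ 2 + (2 * A t * D t) ^+ 2)).
    apply/funext => t.
    rewrite [X in Num.sqrt X](_ : _ = (A t ^+ 2 + D t ^+ 2) ^+ 2); last by ring.
    by rewrite sqrtr_sqr ger0_norm// addr_ge0 ?sqr_ge0.
  have -> : 1 / 8 = Num.sqrt (0 ^+ 2 + (- (1 / 8)) ^+ 2) :> R.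
    by rewrite expr0n add0r sqrtr_sqr normrN ger0_norm//; lra.
  apply: (cvg_comp (fun t => (A t ^+ 2 - D t ^+ 2) ^+ 2 + (2 * A t * D t) ^+ 2) Num.sqrt);
    last exact: sqrt_continuous.
  by apply: cvgD; rewrite !expr2; apply: cvgM.
have -> : (fun t => - fr (pi / 2) t) = (fun t => - D t) by [].
have -> : 1 / 4 = Num.sqrt ((1 / 8 - 0) / 2) :> R.
  by rewrite (_ : _ / 2 = (1 / 4) ^+ 2); [rewrite sqrtr_sqr ger0_norm//; lra|field].
have L4 : Num.sqrt (((A t ^+ 2 + D t ^+ 2) - (A t ^+ 2 - D t ^+ 2)) / 2) @[t --> +oo]
    --> Num.sqrt ((1 / 8 - 0) / 2 : R).
  apply: (cvg_comp (fun t => ((A t ^+ 2 + D t ^+ 2) - (A t ^+ 2 - D t ^+ 2)) / 2) Num.sqrt);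
    last exact: sqrt_continuous.
  by apply: cvgM; [exact: cvgB|exact: cvg_cst].
apply: cvg_trans L4; apply: near_eq_cvg; near=> t.
have t0 : 0 < t by near: t; exact: nbhs_pinfty_gt.
rewrite (_ : _ / 2 = (- D t) ^+ 2); last by field.
by rewrite sqrtr_sqr ger0_norm// oppr_ge0 fr_pihalf_le0.
Unshelve. all: end_near. Qed.

End fresnel.

(** * Sums of squared sines and the Fourier series of {x}(1 - {x}) *)

Section sinsums.
Local Open Scope classical_set_scope.
Context {R : realType}.
Implicit Types (x y u : R) (h N B Y e b : nat).

Lemma pi_lt4 : pi < 4 :> R.
Proof. by have := pihalf_lt2 R; lra. Qed.

Lemma sum_inv_sqr_shift (t : R) (n : nat) : 0 < t ->
  \sum_(1 <= j < n.+1) (t + j%:R)^-2 <= t^-1 - (t + n%:R)^-1.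
Proof.
move=> t0; elim: n => [|n IH]; first by rewrite big_geq// addr0 subrr.
rewrite big_nat_recr//=; apply: le_trans (lerD IH (lexx _)) _.
have n0 : 0 < t + n%:R by rewrite ltr_pwDl.
have n1 : 0 < t + n.+1%:R by rewrite ltr_pwDl.
rewrite -addrA lerD2l -subr_ge0.
have -> : - (t + n.+1%:R)^-1 - (- (t + n%:R)^-1 + (t + n.+1%:R)^-2) =
   ((t + n%:R) * (t + n.+1%:R) ^+ 2)^-1.
  rewrite -natr1; field; rewrite -natr1 in n1.
  by rewrite (lt0r_neq0 n1) (lt0r_neq0 n0).
by rewrite invr_ge0 mulr_ge0 ?sqr_ge0// ltW.
Qed.

Lemma sum_inv_sqr (n : nat) : \sum_(1 <= j < n.+1) (j%:R : R)^-2 <= 2.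
Proof.
case: n => [|n]; first by rewrite big_geq.
rewrite big_nat_recl// expr1n invr1.
have -> : \sum_(1 <= i < n.+1) (i.+1%:R : R)^-2 = \sum_(1 <= i < n.+1) (1 + i%:R)^-2.
  by apply: eq_bigr => i _; rewrite -natr1 addrC.
apply: le_trans (lerD (lexx 1) (sum_inv_sqr_shift n ltr01)) _.
have : 0 <= (1 + n%:R : R)^-1 by rewrite invr_ge0 addr_ge0.
by rewrite invr1; lra.
Qed.

Lemma sum_inv_sqr_gt B n : (0 < B)%N -> \sum_(B.+1 <= b < n.+1) (b%:R : R)^-2 <= B%:R^-1.
Proof.
move=> B0; have [nB|Bn] := leqP n.+1 B.+1; first by rewrite big_geq ?invr_ge0.
have -> : \sum_(B.+1 <= b < n.+1) (b%:R : R)^-2 = \sum_(1 <= j < (n - B).+1) (B%:R + j%:R)^-2.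
  rewrite -{1}(add1n B) big_addn subSn; last exact: ltnW.
  by apply: eq_bigr => j _; rewrite addnC natrD.
apply: le_trans (sum_inv_sqr_shift _ _) _; first by rewrite ltr0n.
by rewrite lerBlDr lerDl invr_ge0 addr_ge0.
Qed.

(** The majorant [4 t^2 / (t + j)^2] is valid on both sides of [j = t], and its sum is bounded by
    telescoping. *)
Lemma sum_min_cube (t : R) n : 0 < t ->
  \sum_(1 <= j < n.+1) Num.min 1 ((t / j%:R) ^+ 3) <= 4 * t.
Proof.
move=> t0; apply: le_trans (_ : \sum_(1 <= j < n.+1) 4 * t ^+ 2 * (t + j%:R)^-2 <= _).
  rewrite !big_nat; apply: ler_sum => j /andP[j0 _].
  have j1 : 0 < (j%:R : R) by rewrite ltr0n.
  have tj : 0 < t + j%:R by rewrite addr_gt0.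
  have -> : 4 * t ^+ 2 * (t + j%:R)^-2 = (2 * t / (t + j%:R)) ^+ 2.
    by field; rewrite lt0r_neq0.
  rewrite ge_min; have [tlej|jt] := lerP t j%:R; apply/orP; [right|left].
    apply: le_trans (_ : (t / j%:R) ^+ 2 <= _).
      by rewrite ler_wiXn2l ?divr_ge0 ?(ltW t0) ?(ltW j1)// ler_pdivrMr// mul1r.
    rewrite lerXn2r ?nnegrE ?divr_ge0 ?mulr_ge0 ?(ltW t0) ?(ltW j1) ?(ltW tj)//.
    rewrite ler_pdivrMr// [leRHS]mulrAC ler_pdivlMr//; nra.
  by rewrite exprn_ege1// ler_pdivlMr// mul1r; lra.
rewrite -mulr_sumr; apply: le_trans (ler_wpM2l _ (sum_inv_sqr_shift n t0)) _.
  by rewrite mulr_ge0// sqr_ge0.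
rewrite [leRHS](_ : _ = 4 * t ^+ 2 * t^-1); last by field; rewrite gt_eqF.
apply: ler_wpM2l; first by rewrite mulr_ge0// sqr_ge0.
by rewrite lerBlDr lerDl invr_ge0 addr_ge0// ltW.
Qed.

Lemma sqr_sin_le1 x : sin x ^+ 2 <= 1.
Proof. by have := cos2Dsin2 x; have := sqr_ge0 (cos x); lra. Qed.

Lemma sqr_sin_le x : 0 <= x -> sin x ^+ 2 <= x.
Proof.
move=> x0; rewrite -real_normK ?num_real// expr2 -[leRHS]mul1r.
by apply: ler_pM => //; [exact: sin_max|rewrite -{2}(ger0_norm x0) norm_sin_le].
Qed.

Section kfun.
Local Open Scope classical_set_scope.
Variable Bf : R -> R.
Hypotheses (B0 : Bf 0 = 0) (dB : forall t : R, is_derive t 1 Bf (sin (2 * pi * t ^+ 2)))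
  (Blim : Bf t @[t --> +oo] --> (1 / 4 : R)).

(** The integral of [sin (pi / v ^+ 2) ^+ 2] over [v] from 0 to [u], in closed form through the
    Fresnel integral [Bf]. The limit 1/4 of [Bf] makes it vanish at 0+, and it tends to [pi / 2] at
    infinity: this is the constant in front of the square root in [Ssum_asymp]. *)
Definition kfun u := pi / 2 + u * sin (pi / u ^+ 2) ^+ 2 - 2 * pi * Bf u^-1.

Lemma is_derive_invsq u : 0 < u -> is_derive u 1 (fun u => pi / u ^+ 2) (- 2 * pi / u ^+ 3).
Proof.
move=> u0; have un0 : u != 0 by rewrite gt_eqF.
have d1 : is_derive u 1 (fun u : R => u ^+ 2) (2 * u).
  by apply: is_derive_eq; rewrite /GRing.scale/=; ring.
have H := is_deriveV (f := fun u : R => u ^+ 2) (expf_neq0 2 un0) d1.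
by apply: is_derive_eq; rewrite /GRing.scale/=; field.
Qed.

Lemma is_derive_kfun u : 0 < u -> is_derive u 1 kfun (sin (pi / u ^+ 2) ^+ 2).
Proof.
move=> u0; have un0 : u != 0 by rewrite gt_eqF.
have H1 := is_derive_invsq u0.
have d1 : is_derive u 1 (fun u : R => u) 1 by exact: is_derive_id.
have H2 := is_deriveV un0 d1.
have H3 : is_derive u 1 (fun u => sin (pi / u ^+ 2)) (- 2 * pi / u ^+ 3 * cos (pi / u ^+ 2)).
  apply: (@is_derive_eq _ _ _ _ _ _ _ _ (is_derive1_comp _ _)).
  by rewrite /GRing.scale/= mulrC.
have H4 : is_derive u 1 (fun u => Bf u^-1) (- u ^- 2 * sin (2 * pi * u^-1 ^+ 2)).
  apply: (@is_derive_eq _ _ _ _ _ _ _ _ (is_derive1_comp (dB u^-1) H2)).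
  by rewrite /GRing.scale/=; ring.
rewrite /kfun; apply: is_derive_eq; rewrite /GRing.scale/=.
have -> : 2 * pi * u^-1 ^+ 2 = (pi / u ^+ 2) *+ 2 by rewrite exprVn; ring.
rewrite sin_mulr2n; move: (pi : R) => p; field.
exact: un0.
Qed.

Lemma kfun_lip (a b : R) : 0 < a -> a <= b ->
  exists2 c, a <= c <= b & kfun b - kfun a = sin (pi / c ^+ 2) ^+ 2 * (b - a).
Proof.
move=> a0 ab; have [||c] := @MVT_segment R kfun (fun u => sin (pi / u ^+ 2) ^+ 2) a b ab.
- by move=> x; rewrite in_itv/= => /andP[ax _]; apply: is_derive_kfun; exact: lt_trans ax.
- apply: derivable_within_continuous => x; rewrite in_itv/= => /andP[ax _].
  by have H := is_derive_kfun (lt_le_trans a0 ax); exact: ex_derive.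
by rewrite in_itv/= => cab E; exists c.
Qed.

Lemma kfun_le u : 0 < u -> `|kfun u| <= u.
Proof.
move=> u0; apply/ler_addgt0Pr => e e0.
have [v [v0 vu Kv]] : exists v, [/\ 0 < v, v <= u & `|kfun v| <= e].
  have p0 := pi_gt0 R.
  have /cvgrPdist_le/(_ (e / (4 * pi))) := Blim.
  rewrite divr_gt0 ?mulr_gt0// => /(_ isT) H.
  have /filter_ex[t [Ht]] : \forall t \near +oo,
      `|1 / 4 - Bf t| <= e / (4 * pi) /\ Num.max (u^-1) (2 / e) < t.
    by apply: filterI; [exact: H|apply: nbhs_pinfty_gt; rewrite num_real].
  rewrite gt_max => /andP[tu te].
  have t0 : 0 < t by rewrite (lt_trans _ tu)// invr_gt0.
  exists t^-1; rewrite invr_gt0 t0; split => //.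
    by rewrite -[u]invrK lef_pV2 ?posrE ?invr_gt0// ltW.
  rewrite /kfun invrK.
  have -> : pi / 2 + t^-1 * sin (pi / t^-1 ^+ 2) ^+ 2 - 2 * pi * Bf t =
    t^-1 * sin (pi / t^-1 ^+ 2) ^+ 2 + 2 * pi * (1 / 4 - Bf t).
    by move: (sin (pi / t^-1 ^+ 2)) (pi : R) => q p; field; rewrite gt_eqF.
  apply: le_trans (ler_normD _ _) _; rewrite [e]splitr lerD//.
    rewrite normrM [`|t^-1|]ger0_norm ?invr_ge0 ?(ltW t0)//.
    rewrite ger0_norm ?sqr_ge0//; apply: le_trans (_ : t^-1 * 1 <= _).
      by rewrite ler_wpM2l ?invr_ge0 ?(ltW t0)// sqr_sin_le1.
    by rewrite mulr1 -[e / 2]invrK lef_pV2 ?posrE// ?invf_div ?divr_gt0// ltW.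
  rewrite normrM (ger0_norm (_ : 0 <= 2 * pi)) ?mulr_ge0 ?pi_ge0//.
  apply: le_trans (ler_wpM2l _ Ht) _; first by rewrite mulr_ge0 ?pi_ge0.
  move: (pi : R) p0 => p p0; rewrite [leLHS](_ : _ = e / 2)//; field.
  exact: lt0r_neq0.
have [c cuv E] := kfun_lip v0 vu.
have -> : kfun u = kfun v + sin (pi / c ^+ 2) ^+ 2 * (u - v) by rewrite -E subrKC.
apply: le_trans (ler_normD _ _) _; rewrite addrC lerD// normrM.
rewrite ger0_norm ?sqr_ge0// ger0_norm ?subr_ge0// -[leRHS]mul1r ler_pM ?sqr_ge0 ?sqr_sin_le1 ?subr_ge0//.
by rewrite lerBlDr lerDl ltW.
Unshelve. all: end_near. Qed.

Lemma Bf_le t : 0 <= t -> `|Bf t| <= t.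
Proof.
move=> t0; have [|c _] := @MVT_segment R Bf (fun u => sin (2 * pi * u ^+ 2)) 0 t t0.
  by apply: derivable_within_continuous => x _; have H := dB x; exact: ex_derive.
rewrite B0 !subr0 => ->; rewrite normrM (ger0_norm t0) -[leRHS]mul1r ler_wpM2r// sin_max//.
Qed.

Lemma kfun_large u : 0 < u -> `|kfun u - pi / 2| <= 3 * pi / u.
Proof.
move=> u0; rewrite /kfun.
have -> : pi / 2 + u * sin (pi / u ^+ 2) ^+ 2 - 2 * pi * Bf u^-1 - pi / 2 =
  u * sin (pi / u ^+ 2) ^+ 2 - 2 * pi * Bf u^-1 by ring.
have p0 := pi_ge0 R.
have H1 : u * sin (pi / u ^+ 2) ^+ 2 <= pi / u.
  rewrite [leRHS](_ : _ = u * (pi / u ^+ 2)); last by field; rewrite gt_eqF.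
  by rewrite ler_wpM2l ?(ltW u0)// sqr_sin_le// divr_ge0// sqr_ge0.
have H2 : `|2 * pi * Bf u^-1| <= 2 * pi / u.
  rewrite normrM (ger0_norm (_ : 0 <= 2 * pi)) ?mulr_ge0//.
  by rewrite ler_wpM2l ?mulr_ge0// Bf_le// invr_ge0 ltW.
apply: le_trans (ler_normB _ _) _.
rewrite ger0_norm; last by rewrite mulr_ge0 ?sqr_ge0 ?(ltW u0).
apply: le_trans (lerD H1 H2) _.
by rewrite -mulrDl; have -> : pi + 2 * pi = 3 * pi :> R by ring.
Qed.

Lemma sqsin_lip (a b : R) : 0 < a -> a <= b ->
  `|sin (pi / b ^+ 2) ^+ 2 - sin (pi / a ^+ 2) ^+ 2| <= 2 * pi / a ^+ 3 * (b - a).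
Proof.
move=> a0 ab.
pose df u := - (2 * pi / u ^+ 3) * sin ((pi / u ^+ 2) *+ 2).
have d x : 0 < x -> is_derive x 1 (fun u => sin (pi / u ^+ 2) ^+ 2) (df x).
  move=> x0; have xn0 : x != 0 by rewrite gt_eqF.
  have H1 := is_derive_invsq x0.
  have H3 : is_derive x 1 (fun u => sin (pi / u ^+ 2)) (- 2 * pi / x ^+ 3 * cos (pi / x ^+ 2)).
    apply: (@is_derive_eq _ _ _ _ _ _ _ _ (is_derive1_comp _ _)).
    by rewrite /GRing.scale/= mulrC.
  by apply: is_derive_eq; rewrite /GRing.scale/= /df sin_mulr2n; ring.
have [||c] := @MVT_segment R (fun u => sin (pi / u ^+ 2) ^+ 2) df a b ab.
- by move=> x; rewrite in_itv/= => /andP[ax _]; apply: d; exact: lt_trans ax.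
- apply: derivable_within_continuous => x; rewrite in_itv/= => /andP[ax _].
  by have H := d x (lt_le_trans a0 ax); exact: ex_derive.
rewrite in_itv/= => /andP[ac cb] ->; have c0 : 0 < c by exact: lt_le_trans ac.
rewrite normrM (ger0_norm (_ : 0 <= b - a)) ?subr_ge0// ler_wpM2r ?subr_ge0//.
rewrite /df normrM normrN.
have p0 : 0 <= 2 * pi :> R by rewrite mulr_ge0 ?pi_ge0.
have pc : 0 <= 2 * pi / c ^+ 3 by rewrite divr_ge0// exprn_ge0// ltW.
rewrite (ger0_norm pc); apply: le_trans (_ : 2 * pi / c ^+ 3 * 1 <= _).
  by rewrite ler_wpM2l// sin_max.
rewrite mulr1 ler_wpM2l// lef_pV2 ?posrE ?exprn_gt0// lerXn2r ?nnegrE// ltW//.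
Qed.

End kfun.

Definition Ssum (x : R) (Y : nat) := \sum_(1 <= e < Y.+1) sin (pi * x / e%:R ^+ 2) ^+ 2.

Lemma Ssum_ge0 x Y : 0 <= Ssum x Y.
Proof. by apply: sumr_ge0 => e _; rewrite sqr_ge0. Qed.

Lemma Ssum_small x Y : 0 <= x -> Ssum x Y <= 2 * pi * x.
Proof.
move=> x0; apply: le_trans (_ : \sum_(1 <= e < Y.+1) pi * x * (e%:R : R)^-2 <= _).
  apply: ler_sum => e _; apply: sqr_sin_le.
  by rewrite divr_ge0 ?sqr_ge0// mulr_ge0 ?pi_ge0.
rewrite -mulr_sumr; apply: le_trans (ler_wpM2l _ (sum_inv_sqr Y)) _.
  by rewrite mulr_ge0 ?pi_ge0.
by rewrite mulrC mulrA.
Qed.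

(** Comparison of a Riemann sum of step [s^-1], [s = sqrt (t^3)], with [kfun]. Cell [j] has error at
    most a constant times [min 1 ((t / j)^3)], from the trivial bound and from the mean value
    theorem, and these sum to [O(t)]. The term with [Y] is the part of the integral beyond the last
    cell. Writing the argument as a cube keeps the exponent 1/3 polynomial. *)
Lemma Ssum_asymp_cube (t : R) Y : 1 <= t ->
  `|Ssum (t ^+ 3) Y - pi / 2 * Num.sqrt (t ^+ 3)| <= 100 * (t + t ^+ 3 / Y.+1%:R).
Proof.
move=> t1; have [Bf [Bf0 dB Blim]] := @fresnel_sin R.
have t0 : 0 < t by exact: lt_le_trans ltr01 t1.
have x0 : 0 < t ^+ 3 by rewrite exprn_gt0.
set s := Num.sqrt (t ^+ 3).
have s0 : 0 < s by rewrite sqrtr_gt0.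
have sn0 : s != 0 by rewrite gt_eqF.
have s2 : s ^+ 2 = t ^+ 3 by rewrite sqr_sqrtr// ltW.
have p4 := pi_lt4; have p0 := pi_ge0 R.
case: Y => [|Y].
  rewrite /Ssum big_geq// sub0r normrN ger0_norm ?mulr_ge0 ?divr_ge0 ?(ltW s0)// divr1.
  have s1 : 1 <= s by rewrite -sqrtr1 ler_wsqrtr// exprn_ege1.
  have : s <= t ^+ 3 by rewrite -s2 expr2 ler_peMl// ltW.
  nra.
pose F (e : nat) := sin (pi * t ^+ 3 / e%:R ^+ 2) ^+ 2.
pose K := kfun Bf.
have FE e : F e = sin (pi / (e%:R / s) ^+ 2) ^+ 2.
  by rewrite /F expr_div_n invf_div s2 -mulrA.
have cell j : (0 < j)%N -> `|s * (K (j.+1%:R / s) - K (j%:R / s)) - F j.+1| <=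
    8 * Num.min 1 ((t / j%:R) ^+ 3).
  move=> j0; have j1 : 0 < (j%:R : R) by rewrite ltr0n.
  have a0 : 0 < j%:R / s by rewrite divr_gt0.
  have ab : j%:R / s <= j.+1%:R / s by rewrite ler_pM2r ?invr_gt0// ler_nat.
  have [c /andP[c1 c2] ->] := kfun_lip dB a0 ab.
  have -> : j.+1%:R / s - j%:R / s = s^-1 by rewrite -mulrBl -natr1 [_ + 1]addrC addrK mul1r.
  rewrite mulrCA divff// mulr1 FE.
  have c0 : 0 < c by exact: lt_le_trans c1.
  have H1 : `|sin (pi / c ^+ 2) ^+ 2 - sin (pi / (j.+1%:R / s) ^+ 2) ^+ 2| <= 1.
    have := sqr_sin_le1 (pi / c ^+ 2); have := sqr_sin_le1 (pi / (j.+1%:R / s) ^+ 2).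
    have := sqr_ge0 (sin (pi / c ^+ 2)); have := sqr_ge0 (sin (pi / (j.+1%:R / s) ^+ 2)).
    by rewrite ler_norml; lra.
  have H2 : `|sin (pi / c ^+ 2) ^+ 2 - sin (pi / (j.+1%:R / s) ^+ 2) ^+ 2| <= 8 * (t / j%:R) ^+ 3.
    rewrite distrC; apply: le_trans (sqsin_lip c0 c2) _.
    apply: le_trans (_ : 2 * pi / (j%:R / s) ^+ 3 * s^-1 <= _).
      apply: ler_pM; rewrite ?divr_ge0 ?mulr_ge0 ?exprn_ge0 ?subr_ge0 ?(ltW c0)//.
        rewrite ler_wpM2l ?mulr_ge0// lef_pV2 ?posrE ?exprn_gt0//.
        by rewrite lerXn2r ?nnegrE ?(ltW a0) ?(ltW c0).
      rewrite lerBlDr; apply: le_trans (_ : s^-1 + j%:R / s <= _); last by rewrite lerD2l.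
      by rewrite -natr1 mulrDl mul1r addrC.
    rewrite [leLHS](_ : _ = 2 * pi * (s ^+ 2 / j%:R ^+ 3)); last by field; rewrite sn0 gt_eqF.
    rewrite s2 expr_div_n ler_wpM2r ?divr_ge0 ?exprn_ge0 ?(ltW t0)//; lra.
  by rewrite minr_pMr// mulr1 le_min H2 andbT (le_trans H1)//; lra.
have tel : s * (K (Y.+1%:R / s) - K (1%:R / s)) =
    \sum_(1 <= j < Y.+1) s * (K (j.+1%:R / s) - K (j%:R / s)).
  by rewrite -mulr_sumr telescope_sumr.
have SE : Ssum (t ^+ 3) Y.+1 = F 1%N + \sum_(1 <= j < Y.+1) F j.+1.
  by rewrite /Ssum big_nat_recl.
have D : `|s * (K (Y.+1%:R / s) - K (1%:R / s)) - \sum_(1 <= j < Y.+1) F j.+1| <= 32 * t.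
  rewrite tel -sumrB; apply: le_trans (ler_norm_sum _ _ _) _.
  apply: le_trans (_ : \sum_(1 <= j < Y.+1) 8 * Num.min 1 ((t / j%:R) ^+ 3) <= _).
    by rewrite !big_nat; apply: ler_sum => j /andP[j0 _]; exact: cell.
  rewrite -mulr_sumr; apply: le_trans (ler_wpM2l _ (sum_min_cube Y t0)) _ => //; lra.
have KY : `|s * (K (Y.+1%:R / s) - pi / 2)| <= 12 * (t ^+ 3 / Y.+1%:R).
  rewrite normrM (gtr0_norm s0); apply: le_trans (ler_wpM2l (ltW s0) (kfun_large Bf0 dB _)) _.
    by rewrite divr_gt0.
  rewrite [leLHS](_ : _ = 3 * pi * (s ^+ 2 / Y.+1%:R)).
    by rewrite s2 ler_wpM2r ?divr_ge0 ?(ltW x0)//; lra.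
  have v0 : (Y.+1%:R : R) != 0 by rewrite pnatr_eq0.
  by move: (pi : R) (Y.+1%:R : R) v0 => p v v0; field; rewrite sn0 v0.
have K1 : `|s * K (1%:R / s)| <= 1.
  rewrite normrM (gtr0_norm s0); apply: le_trans (ler_wpM2l (ltW s0) (kfun_le dB Blim _)) _.
    by rewrite divr_gt0.
  by rewrite mulrC divfK.
have F1 : `|F 1%N| <= 1 by rewrite ger0_norm ?sqr_ge0// sqr_sin_le1.
have Y2 : t ^+ 3 / Y.+1%:R <= 2 * (t ^+ 3 / Y.+2%:R).
  rewrite mulrCA ler_pM2l// ler_pdivlMr// mulrC ler_pdivrMr//.
  by rewrite -natrM ler_nat; clear; lia.
rewrite SE; move: D KY K1 F1 Y2; rewrite !ler_norml.
set S := \sum_(_ <= _ < _) _; set q := _ / Y.+1%:R; set q2 := _ / Y.+2%:R.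
move: (K _) (K _) (F _) => a b f.
have -> : pi / 2 * s = s * (pi / 2) by rewrite mulrC.
rewrite !mulrBr; lra.
Qed.

Lemma Ssum_asymp (x : R) Y : 0 < x ->
  `|Ssum x Y - pi / 2 * Num.sqrt x| <= 100 * (x `^ (1 / 3) + x / Y.+1%:R).
Proof.
move=> x0; have p4 := pi_lt4; have p0 := pi_ge0 R.
have q0 : 0 <= x / Y.+1%:R by rewrite divr_ge0// ltW.
have [x1|x1] := leP 1 x.
  have E : (x `^ (1 / 3)) ^+ 3 = x.
    by rewrite -powR_mulrn ?powR_ge0// -powRrM mul1r mulVf ?powRr1// ltW.
  rewrite -{1 2 4}E; apply: Ssum_asymp_cube.
  by rewrite -[leLHS](powRr0 x) ler_powR//; lra.
have H1 : x <= x `^ (1 / 3).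
  rewrite -{1}[x]powRr1 ?(ltW x0)// ger_powR ?x0 ?(ltW x1)//; lra.
have H2 : Num.sqrt x <= x `^ (1 / 3).
  rewrite -powR12_sqrt ?(ltW x0)// ger_powR ?x0 ?(ltW x1)//; lra.
have := Ssum_small Y (ltW x0); have := Ssum_ge0 x Y; have s0 := sqrtr_ge0 x.
move: H1 H2 s0 q0; set s := Num.sqrt x; set c := x `^ _; set q := _ / Y.+1%:R; set S := Ssum _ _.
move: (pi : R) p4 p0 => p p4 p0 H1 H2 s0 q0 S0 Sx.
have A1 : p * x <= 4 * x by rewrite ler_pM2r// ltW.
have A2 : p * s <= 4 * s by rewrite ler_wpM2r// ltW.
have A3 : 0 <= p * s by rewrite mulr_ge0.
rewrite ler_norml [p / 2 * s]mulrAC; lra.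
Qed.

Lemma cos_ge_quad x : 0 <= x -> 1 - x ^+ 2 / 2 <= cos x.
Proof.
move=> x0; have := @der_nincr R (fun y => 1 - y ^+ 2 / 2 - cos y) (fun y => - y + sin y) 0 x x0.
rewrite cos0 expr0n/= mul0r subr0 subrr => H; rewrite -subr_le0; apply: H => y.
  by move=> _; apply: is_derive_eq; rewrite /GRing.scale/=; field.
by move=> /andP[y0 _]; have := sin_le_id y0; lra.
Qed.

Lemma sin_ge_cubic x : 0 <= x -> x - x ^+ 3 / 6 <= sin x.
Proof.
move=> x0; have := @der_nincr R (fun y => y - y ^+ 3 / 6 - sin y) (fun y => 1 - y ^+ 2 / 2 - cos y) 0 x x0.
rewrite sin0 expr0n/= mul0r !subr0 => H; rewrite -subr_le0; apply: H => y.
  by move=> _; apply: is_derive_eq; rewrite /GRing.scale/=; field.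
by move=> /andP[y0 _]; have := cos_ge_quad y0; lra.
Qed.

Lemma sin_ge_third x : 0 <= x <= pi / 2 -> x / 3 <= sin x.
Proof.
move=> /andP[x0 xp]; have x2 : x <= 2 by have := pi_lt4; lra.
apply: le_trans (sin_ge_cubic x0); have : x ^+ 3 <= 4 * x.
  rewrite exprS mulrC ler_wpM2r//; nra.
lra.
Qed.

Lemma inv_sqr_sin_le x : 0 < x <= pi / 2 -> (sin x ^+ 2)^-1 <= 9 * (x ^+ 2)^-1.
Proof.
move=> /andP[x0 xp]; have := @sin_ge_third x; rewrite xp (ltW x0) => /(_ isT) H.
have s0 : 0 < x / 3 by rewrite divr_gt0.
rewrite [leRHS](_ : _ = ((x / 3) ^+ 2)^-1); last by field; rewrite gt_eqF.
rewrite lef_pV2 ?posrE ?exprn_gt0//; last exact: lt_le_trans H.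
by rewrite lerXn2r// ?nnegrE ?(ltW s0)// (le_trans _ H)// ltW.
Qed.

Lemma inv_sqr_sin_sub x : 0 < x <= pi / 2 -> `|(sin x ^+ 2)^-1 - (x ^+ 2)^-1| <= 3.
Proof.
move=> /andP[x0 xp]; have := @sin_ge_third x; rewrite xp (ltW x0) => /(_ isT) H.
have s0 : 0 < sin x by apply: lt_le_trans H; rewrite divr_gt0.
have s1 := sin_le_id (ltW x0).
have -> : (sin x ^+ 2)^-1 - (x ^+ 2)^-1 = (x ^+ 2 - sin x ^+ 2) / (x ^+ 2 * sin x ^+ 2).
  by move: (sin x) s0 => s s0; field; rewrite !gt_eqF.
have d0 : 0 < x ^+ 2 * sin x ^+ 2 by rewrite mulr_gt0// exprn_gt0.
rewrite ger0_norm; last by rewrite divr_ge0 ?(ltW d0)// subr_ge0 lerXn2r// nnegrE ltW.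
rewrite ler_pdivrMr//.
have H2 := sin_ge_cubic (ltW x0).
have H3 : x ^+ 2 - sin x ^+ 2 <= x ^+ 4 / 3.
  rewrite subr_sqr; apply: le_trans (_ : x ^+ 3 / 6 * (2 * x) <= _).
    apply: ler_pM; rewrite ?subr_ge0// ?addr_ge0 ?(ltW s0) ?(ltW x0)//; lra.
  by rewrite [leRHS](_ : _ = x ^+ 3 / 6 * (2 * x))//; field.
apply: (le_trans H3).
apply: le_trans (_ : 3 * (x ^+ 2 * (x / 3) ^+ 2) <= _).
  by rewrite [leRHS](_ : _ = x ^+ 4 / 3)//; field.
have x3 : 0 <= x / 3 by rewrite divr_ge0// ltW.
by rewrite ler_pM2l// ler_pM2l ?exprn_gt0// lerXn2r ?nnegrE// ltW.
Qed.

Lemma sum_cos_roots (N h : nat) : (0 < h < N)%N ->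
  \sum_(0 <= b < N) cos (2 * pi * h%:R * b%:R / N%:R) = 0 :> R.
Proof.
move=> /andP[h0 hN]; have N0 : 0 < (N%:R : R) by rewrite ltr0n; lia.
have Nn0 : (N%:R : R) != 0 by rewrite gt_eqF.
pose y : R := pi * h%:R / N%:R.
have sy : sin y != 0.
  have y0 : 0 < y by rewrite divr_gt0// mulr_gt0 ?pi_gt0 ?ltr0n.
  by rewrite gt_eqF// sin_gt0_pi// y0/= /y ltr_pdivrMr// ltr_pM2l ?pi_gt0// ltr_nat.
apply: (mulfI (mulf_neq0 (_ : 2 != 0) sy)) => //; rewrite mulr0 mulr_sumr.
pose G b := sin ((2 * b%:R - 1) * y).
have -> : \sum_(0 <= b < N) 2 * sin y * cos (2 * pi * h%:R * b%:R / N%:R) =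
    \sum_(0 <= b < N) (G b.+1 - G b).
  apply: eq_bigr => b _; rewrite /G -[b.+1%:R]natr1.
  have -> : (2 * (b%:R + 1) - 1) * y = 2 * b%:R * y + y by ring.
  have -> : (2 * b%:R - 1) * y = 2 * b%:R * y - y by ring.
  have -> : 2 * pi * h%:R * b%:R / N%:R = 2 * b%:R * y :> R.
    by rewrite /y; move: (pi : R) => p; field.
  by rewrite sinD sinB; ring.
rewrite telescope_sumr// /G mulr0 sub0r mulN1r sinN opprK.
have -> : (2 * N%:R - 1) * y = - y + (pi *+ 2) *+ h.
  by rewrite /y; move: (pi : R) => p; rewrite -[(p *+ 2) *+ h]mulr_natr; field.
by rewrite (periodicn (@sinD2pi R)) sinN addNr.
Qed.

End sinsums.

(** * The Fourier series of {x}(1 - {x}) at rational points *)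

Section frac_parts.
Local Open Scope classical_set_scope.
Context {R : realType}.
Implicit Types (x y u : R) (h N B Y e b : nat).

(** Both sides have second difference -2 in [h]. On the left the second difference of the numerators
    is [2 * cos (2 a) * sin y ^+ 2], so the denominators cancel, and the cosines at the nonzero [b]
    sum to -1. *)
Lemma sum_sin_ratio (N h : nat) : (0 < N)%N -> (h <= N)%N ->
  \sum_(1 <= b < N) sin (pi * h%:R * b%:R / N%:R) ^+ 2 / sin (pi * b%:R / N%:R) ^+ 2
  = (h%:R * (N%:R - h%:R) : R).
Proof.
move=> N0; have Nr0 : 0 < (N%:R : R) by rewrite ltr0n.
have Nn0 : (N%:R : R) != 0 by rewrite gt_eqF.
pose f h := \sum_(1 <= b < N) sin (pi * h%:R * b%:R / N%:R) ^+ 2 / sin (pi * b%:R / N%:R) ^+ 2 : R.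
have sb b : (0 < b < N)%N -> sin (pi * b%:R / N%:R) != 0 :> R.
  move=> /andP[b0 bN]; have y0 : 0 < pi * b%:R / N%:R :> R.
    by rewrite divr_gt0// mulr_gt0 ?pi_gt0 ?ltr0n.
  by rewrite gt_eqF// sin_gt0_pi// y0/= ltr_pdivrMr// ltr_pM2l ?pi_gt0// ltr_nat.
rewrite -/(f h); suff H : forall k, (k < N)%N -> f k = k%:R * (N%:R - k%:R) /\
    f k.+1 = k.+1%:R * (N%:R - k.+1%:R).
  case: h => [|h] hN; first by have [] := H 0%N N0.
  by have [] := H h hN.
elim=> [|k IH] kN.
  split.
    by rewrite mul0r /f big1// => b _; rewrite mulr0 !mul0r sin0 expr0n/= mul0r.
  rewrite mul1r /f (eq_big_nat _ _ (F2 := fun _ => 1)) => [|b bN].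
    by rewrite sumr_const_nat natrB.
  by rewrite mulr1 divff// expf_neq0// sb.
have [IH1 IH2] := IH (ltnW kN).
split => //.
have : f k.+2 - 2 * f k.+1 + f k = -2.
  rewrite mulr_sumr -sumrB -big_split/=.
  rewrite (eq_big_nat _ _ (F2 := fun b => 2 * cos (2 * pi * k.+1%:R * b%:R / N%:R))) => [|b bN].
    rewrite -mulr_sumr; have := @sum_cos_roots R N k.+1; rewrite kN => /(_ isT).
    rewrite big_ltn// mulr0 mul0r cos0 => /eqP; rewrite addrC addr_eq0 => /eqP ->.
    by rewrite mulrN mulr1.
  have := sb b bN; set y := pi * b%:R / N%:R => sy.
  have -> : pi * k.+2%:R * b%:R / N%:R = k.+1%:R * y + y.
    by rewrite /y -!natr1; move: (pi : R) => p; field.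
  have -> : pi * k%:R * b%:R / N%:R = k.+1%:R * y - y.
    by rewrite /y -!natr1; move: (pi : R) => p; field.
  have -> : pi * k.+1%:R * b%:R / N%:R = k.+1%:R * y.
    by rewrite /y; move: (pi : R) => p; field.
  have -> : 2 * pi * k.+1%:R * b%:R / N%:R = (k.+1%:R * y) *+ 2.
    by rewrite /y -[_ *+ 2]mulr_natr; move: (pi : R) => p; field.
  set a := k.+1%:R * y; rewrite sinD sinB cos_mulr2n.
  have E1 := cos2Dsin2 a; have E2 := cos2Dsin2 y.
  have {}E1 : cos a ^+ 2 = 1 - sin a ^+ 2 by rewrite -E1 addrK.
  have {}E2 : cos y ^+ 2 = 1 - sin y ^+ 2 by rewrite -E2 addrK.
  have -> : (sin a * cos y + cos a * sin y) ^+ 2 / sin y ^+ 2 -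
    2 * (sin a ^+ 2 / sin y ^+ 2) + (sin a * cos y - cos a * sin y) ^+ 2 / sin y ^+ 2 =
    (2 * sin a ^+ 2 * cos y ^+ 2 + 2 * cos a ^+ 2 * sin y ^+ 2 - 2 * sin a ^+ 2) / sin y ^+ 2.
    by field.
  by rewrite E1 E2; field.
rewrite IH1 IH2 -[k.+2%:R]natr1 -[k.+1%:R]natr1 => E.
have -> : f k.+2 = f k.+2 - 2 * ((k%:R + 1) * (N%:R - (k%:R + 1))) + k%:R * (N%:R - k%:R)
   + 2 * ((k%:R + 1) * (N%:R - (k%:R + 1))) - k%:R * (N%:R - k%:R) by ring.
by rewrite E; ring.
Qed.

Definition frp (h N : nat) : R := (h %% N)%:R / N%:R * (1 - (h %% N)%:R / N%:R).

Lemma sin2_periodic (x : R) k : sin (x + pi *+ k) ^+ 2 = sin x ^+ 2.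
Proof.
elim: k x => [|k IH] x; first by rewrite mulr0n addr0.
by rewrite mulrS [pi + _]addrC addrA sinDpi sqrrN IH.
Qed.

(** The finite identity [sum_sin_ratio], applied to the same fraction with a large denominator,
    turns into the Fourier series once the inverse square of each sine is replaced by that of its
    argument. The error does not depend on [h] and [N]. *)
Lemma frp_fourier (h N B : nat) : (0 < N)%N -> (0 < B)%N ->
  `|frp h N - 2 / pi ^+ 2 * \sum_(1 <= b < B.+1) sin (pi * (h%:R * b%:R) / N%:R) ^+ 2 / b%:R ^+ 2|
  <= 12 / B%:R.
Proof.
move=> N0 B0.
have Nr0 : 0 < (N%:R : R) by rewrite ltr0n.
have Nn0 : (N%:R : R) != 0 by rewrite gt_eqF.
wlog hN : h / (h <= N)%N => [H|].
  have := H (h %% N)%N (ltnW (ltn_pmod h N0)); rewrite /frp modn_mod.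
  have -> // : \sum_(1 <= b < B.+1) sin (pi * ((h %% N)%:R * b%:R) / N%:R) ^+ 2 / b%:R ^+ 2 =
     \sum_(1 <= b < B.+1) sin (pi * (h%:R * b%:R) / N%:R) ^+ 2 / b%:R ^+ 2 :> R.
  apply: eq_bigr => b _; congr (_ / _).
  rewrite -(sin2_periodic _ (h %/ N * b)); congr (sin _ ^+ 2).
  have hE : (h%:R : R) = (h %/ N)%:R * N%:R + (h %% N)%:R by rewrite -natrM -natrD -divn_eq.
  rewrite hE -[pi *+ _]mulr_natr natrM.
  by move: (pi : R) => p; field.
(* [h' / N'] is [h / N] again. The even denominator [N' = 2 * m] lets the sum fold under
   [b -> N' - b] around [m], and [N' >= 2 * (2 * B + 1)] makes the total cost [3 * B / N' ^ 2] of
   replacing sines for [b <= B] at most [1 / B]. *)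
pose m := (N * (2 * B + 1))%N; pose N' := (2 * m)%N; pose h' := (h * (2 * (2 * B + 1)))%N.
have m0 : (0 < m)%N by rewrite muln_gt0 N0; lia.
have Bm : (2 * B + 1 <= m)%N by rewrite leq_pmull.
have N'0 : (0 < N')%N by rewrite muln_gt0.
have N'r : 0 < (N'%:R : R) by rewrite ltr0n.
have N'n : (N'%:R : R) != 0 by rewrite gt_eqF.
have h'N : (h' <= N')%N by rewrite /N' /m /h'; nia.
have hh : h'%:R / N'%:R = h%:R / N%:R :> R.
  have B1 : ((2 * B + 1)%:R : R) != 0 by rewrite pnatr_eq0; lia.
  rewrite /h' /N' /m; move: (2 * B + 1)%N B1 => c B1.
  by rewrite !natrM; field; rewrite ?Nn0 ?B1.
have E := sum_sin_ratio N'0 h'N.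
pose s b := sin (pi * (h%:R * b%:R) / N%:R) ^+ 2 : R.
pose g b := (sin (pi * b%:R / N'%:R) ^+ 2)^-1 : R.
have sE b : sin (pi * h'%:R * b%:R / N'%:R) ^+ 2 = s b.
  rewrite /s; congr (sin _ ^+ 2).
  by rewrite (_ : pi * h'%:R * b%:R / N'%:R = pi * b%:R * (h'%:R / N'%:R)); [rewrite hh|]; ring.
have s01 b : 0 <= s b <= 1 by rewrite sqr_ge0 sqr_sin_le1.
have symm b : (b <= N')%N -> s (N' - b)%N * g (N' - b)%N = s b * g b.
  move=> bN; rewrite -!sE /g natrB//.
  have -> : pi * h'%:R * (N'%:R - b%:R) / N'%:R = - (pi * h'%:R * b%:R / N'%:R) + pi *+ h' :> R.
    by rewrite -mulr_natr; move: (pi : R) => p; field.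
  have -> : pi * (N'%:R - b%:R) / N'%:R = - (pi * b%:R / N'%:R) + pi *+ 1 :> R.
    by rewrite mulr1n; move: (pi : R) => p; field.
  by rewrite !sin2_periodic !sinN !sqrrN.
have P : h'%:R * (N'%:R - h'%:R) = 2 * (\sum_(1 <= b < m) s b * g b) + s m * g m.
  rewrite -E (eq_bigr (fun b => s b * g b)) => [|b _]; last by rewrite sE.
  rewrite (big_cat_nat (n := m.+1))//=; last by rewrite /N'; lia.
  rewrite big_nat_recr//= [X in _ + X]big_nat_rev/=.
  have -> : N' = (m + m)%N by rewrite /N'; lia.
  have bigE F : \sum_(m.+1 <= i < m + m) F i = \sum_(1 <= i < m) F (i + m)%N :> R.
    by rewrite -(add1n m) big_addn addnK.
  rewrite bigE.
  rewrite [X in _ + X](eq_big_nat _ _ (F2 := fun b => s b * g b)) => [|b bm]; first by ring.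
  have -> : ((m.+1 + (m + m) - (b + m).+1) = N' - b)%N by rewrite /N'; lia.
  by rewrite symm// /N'; lia.
have fE : frp h N = N'%:R^-2 * (2 * (\sum_(1 <= b < m) s b * g b) + s m * g m).
  rewrite -P; have [hlt|hge] := ltnP h N.
    rewrite /frp modn_small// -hh; by field.
  have hNE : h = N by lia.
  rewrite hNE.
  rewrite /frp modnn !mul0r; have -> : h' = N' by rewrite /h' /N' /m hNE mulnCA.
  by rewrite subrr !mulr0.
rewrite fE.
pose y b := pi * b%:R / N'%:R : R.
have y0 b : (0 < b <= m)%N -> 0 < y b <= pi / 2.
  move=> /andP[b0 bm]; rewrite divr_gt0 ?mulr_gt0 ?pi_gt0 ?ltr0n//=.
  rewrite ler_pdivrMr// mulrAC ler_pdivlMr// -mulrA ler_pM2l ?pi_gt0//.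
  by rewrite -natrM ler_nat /N'; lia.
have pn : pi != 0 :> R by rewrite gt_eqF// pi_gt0.
have C1 b : (0 < b <= m)%N -> `|N'%:R^-2 * g b - (pi ^+ 2 * b%:R ^+ 2)^-1| <= 3 * N'%:R^-2.
  move=> bm; have := inv_sqr_sin_sub (y0 b bm).
  have b0 : (b%:R : R) != 0 by rewrite pnatr_eq0; lia.
  have -> : (pi ^+ 2 * b%:R ^+ 2)^-1 = N'%:R^-2 * (y b ^+ 2)^-1.
    by rewrite /y; move: (pi : R) pn => p pn; field; rewrite ?b0 ?N'n ?pn.
  rewrite -mulrBr normrM ger0_norm ?invr_ge0 ?sqr_ge0// mulrC => H.
  by rewrite ler_wpM2r ?invr_ge0 ?sqr_ge0.
have C2 b : (0 < b <= m)%N -> `|N'%:R^-2 * g b| <= 3 * b%:R^-2.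
  move=> bm; have b0 : (b%:R : R) != 0 by rewrite pnatr_eq0; lia.
  rewrite ger0_norm; last by rewrite mulr_ge0 ?invr_ge0 ?sqr_ge0.
  apply: le_trans (ler_wpM2l _ (inv_sqr_sin_le (y0 b bm))) _; first by rewrite invr_ge0 sqr_ge0.
  rewrite [leLHS](_ : _ = 9 / pi ^+ 2 * b%:R^-2); last first.
    by rewrite /y; move: (pi : R) pn => p pn; field; rewrite ?b0 ?N'n ?pn.
  rewrite ler_wpM2r ?invr_ge0 ?sqr_ge0// ler_pdivrMr ?exprn_gt0 ?pi_gt0//.
  by have := pi_ge2 R; nra.
have split : \sum_(1 <= b < m) s b * g b =
    \sum_(1 <= b < B.+1) s b * g b + \sum_(B.+1 <= b < m) s b * g b.
  by rewrite -big_cat_nat//; lia.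
rewrite split.
set S1 := \sum_(1 <= b < B.+1) s b * g b; set S2 := \sum_(B.+1 <= b < m) s b * g b.
set S3 := \sum_(1 <= b < B.+1) _.
have -> : N'%:R^-2 * (2 * (S1 + S2) + s m * g m) - 2 / pi ^+ 2 * S3 =
   2 * (N'%:R^-2 * S1 - S3 / pi ^+ 2) + 2 * (N'%:R^-2 * S2) + s m * (N'%:R^-2 * g m) by ring.
have Bi : 0 <= (B%:R : R)^-1 by rewrite invr_ge0.
have D1 : `|N'%:R^-2 * S1 - S3 / pi ^+ 2| <= B%:R^-1.
  rewrite mulr_sumr mulr_suml -sumrB; apply: le_trans (ler_norm_sum _ _ _) _.
  apply: le_trans (_ : \sum_(1 <= b < B.+1) 3 * N'%:R^-2 <= _).
    rewrite !big_nat; apply: ler_sum => b bB.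
    have b0 : (b%:R : R) != 0 by rewrite pnatr_eq0; lia.
    have -> : N'%:R^-2 * (s b * g b) - s b / b%:R ^+ 2 / pi ^+ 2 =
      s b * (N'%:R^-2 * g b - (pi ^+ 2 * b%:R ^+ 2)^-1).
      move: (s b) (g b) => sb gb; move: (pi : R) pn => p pn; field.
      by rewrite ?b0 ?N'n ?pn.
    rewrite normrM -[leRHS]mul1r ler_pM//; last by apply: C1; lia.
    by have /andP[h1 h2] := s01 b; rewrite ger0_norm.
  rewrite sumr_const_nat subn1/= -mulr_natr [leLHS](_ : _ = (3 * B)%:R / N'%:R ^+ 2); last first.
    by rewrite natrM; ring.
  rewrite ler_pdivrMr ?exprn_gt0// mulrC ler_pdivlMr ?ltr0n// -natrX -natrM ler_nat.
  suff NB n : (2 * (2 * B + 1) <= n -> 3 * B * B <= n ^ 2)%N by apply: NB; rewrite leq_pmul2l.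
  by clear; nia.
have D2 : `|N'%:R^-2 * S2| <= 3 * B%:R^-1.
  rewrite mulr_sumr; apply: le_trans (ler_norm_sum _ _ _) _.
  apply: le_trans (_ : \sum_(B.+1 <= b < m) 3 * b%:R^-2 <= _).
    rewrite !big_nat; apply: ler_sum => b bB.
    rewrite mulrCA normrM -[leRHS]mul1r ler_pM//; last by apply: C2; lia.
    by have /andP[h1 h2] := s01 b; rewrite ger0_norm.
  rewrite -mulr_sumr ler_wpM2l//; case: (m) m0 => // m' _; exact: sum_inv_sqr_gt.
have D3 : `|s m * (N'%:R^-2 * g m)| <= 3 * B%:R^-1.
  rewrite normrM -[leRHS]mul1r ler_pM//; first by have /andP[h1 h2] := s01 m; rewrite ger0_norm.
  apply: le_trans (C2 m _) _; first by rewrite m0/=.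
  rewrite ler_pM2l// lef_pV2 ?posrE ?exprn_gt0 ?ltr0n// -natrX ler_nat.
  suff NB n : (2 * B + 1 <= n -> B <= n ^ 2)%N by exact: NB.
  by clear; nia.
move: D1 D2 D3 Bi; rewrite !ler_norml; clear.
move: (B%:R^-1) (_ - S3 / _) (_ * S2) (s m * _) => u v w t; lra.
Qed.

End frac_parts.

Import boot.fintype boot.finset.

(** * Sets of primes *)

(** A squarefree integer with all primes below [z] is represented by its set of primes, and [np]
    recovers the integer: divisibility becomes inclusion, lcm becomes union, and sums over such
    integers are finite sums over sets. *)
Definition pr (z : nat) : {set 'I_z} := [set p : 'I_z | prime p].

Definition np z (S : {set 'I_z}) : nat := (\prod_(p in S) p)%N.

Section prime_sets.
Variable z : nat.
Implicit Types (S T : {set 'I_z}) (p : 'I_z).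

Lemma prP p : (p \in pr z) = prime p. Proof. by rewrite inE. Qed.

Lemma pr_prime S p : S \subset pr z -> p \in S -> prime p.
Proof. by move=> /subsetP sS /sS; rewrite prP. Qed.

Lemma np0 : np (set0 : {set 'I_z}) = 1%N. Proof. by rewrite /np big_set0. Qed.

Lemma np1 p : np [set p] = p. Proof. by rewrite /np big_set1. Qed.

Lemma np_gt0 S : S \subset pr z -> (0 < np S)%N.
Proof.
by move=> sS; rewrite prodn_cond_gt0// => p pS; rewrite prime_gt0// (pr_prime sS).
Qed.

Lemma npID S T : np S = (np (S :&: T) * np (S :\: T))%N.
Proof. by rewrite /np (big_setID T). Qed.

Lemma npU1 p S : p \notin S -> np (p |: S) = (p * np S)%N.
Proof. by move=> pS; rewrite /np big_setU1. Qed.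

Lemma npD1 p S : p \in S -> np S = (p * np (S :\ p))%N.
Proof. by move=> pS; rewrite /np (big_setD1 p). Qed.

Lemma np_sub S T : S \subset T -> (np S %| np T)%N.
Proof. by move=> sST; rewrite (npID T S) (setIidPr sST) dvdn_mulr. Qed.

Lemma np_le S T : T \subset pr z -> S \subset T -> (np S <= np T)%N.
Proof. by move=> sT sST; apply: dvdn_leq; [exact: np_gt0|exact: np_sub]. Qed.

Lemma coprime_np p S : S \subset pr z -> prime p -> p \notin S -> coprime p (np S).
Proof.
move=> sS pp pS; rewrite /np; elim/big_ind: _ => [|m n|q qS].
- exact: coprimen1.
- by rewrite coprimeMr => -> ->.
rewrite prime_coprime// dvdn_prime2// ?(pr_prime sS)//.
by apply: contraNneq pS => pq; rewrite (_ : p = q)//; apply: val_inj.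
Qed.

Lemma dvdn_np p S : S \subset pr z -> prime p -> (p %| np S)%N = (p \in S).
Proof.
move=> sS pp; apply/idP/idP => [|pS]; last by rewrite (npD1 pS) dvdn_mulr.
by apply: contraTT => pS; rewrite -prime_coprime// coprime_np.
Qed.

Lemma np_inj S T : S \subset pr z -> T \subset pr z -> np S = np T -> S = T.
Proof.
move=> sS sT E; apply/setP => p; have [pp|np_] := boolP (prime p).
  by rewrite -dvdn_np// E dvdn_np.
have F (U : {set 'I_z}) : U \subset pr z -> (p \in U) = false.
  by move=> sU; apply: contraNF np_ => /(pr_prime sU).
by rewrite !F.
Qed.

Lemma np_dvdn_exp S k n : S \subset pr z ->
  (np S ^ k %| n)%N = [forall p in S, (p ^ k %| n)%N].
Proof.
move=> sS; apply/idP/'forall_implyP => [H p pS|].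
  by apply: dvdn_trans H; rewrite dvdn_exp2r// (npD1 pS) dvdn_mulr.
move: sS; move: {2}#|S| (erefl #|S|) => m.
elim: m S => [|m IH] S cS sS H.
  by move/eqP: cS; rewrite cards_eq0 => /eqP ->; rewrite np0 exp1n dvd1n.
have /card_gt0P[p pS] : (0 < #|S|)%N by rewrite cS.
rewrite (npD1 pS) expnMn Gauss_dvd; last first.
  rewrite coprimeXl ?coprimeXr// coprime_np ?setD11 ?(pr_prime sS)//.
  by rewrite (subset_trans _ sS) ?subD1set.
rewrite H// IH//.
- by have := cardsD1 p S; rewrite cS pS add1n => -[].
- by rewrite (subset_trans _ sS) ?subD1set.
by move=> q; rewrite inE => /andP[_]; exact: H.
Qed.

Lemma np_lt_bound (S : {set 'I_z}) : S \subset pr z -> (np S < (np (pr z)).+1)%N.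
Proof. by move=> sS; rewrite ltnS np_le. Qed.

End prime_sets.

Section prime_set_sums.
Variable R : realType.

Lemma sum_np_le z (P : pred nat) (f : nat -> R) (M : nat) :
  (forall n, 0 <= f n) ->
  (forall S : {set 'I_z}, S \subset pr z -> P (np S) -> (np S < M)%N) ->
  \sum_(S : {set 'I_z} | (S \subset pr z) && P (np S)) f (np S) <=
  \sum_(1 <= n < M | P n) f n.
Proof.
move=> f0 SM; case: M SM => [|M] SM.
  rewrite big_pred0 ?big_geq// => S; apply/negP => /andP[sS PS].
  by have := SM S sS PS.
rewrite [leRHS]big_nat_cond.
have -> : \sum_(1 <= n < M.+1 | (1 <= n < M.+1)%N && P n) f n =
    \sum_(n < M.+1 | (0 < n)%N && P n) f n.
  rewrite -(big_mkord (fun n => (0 < n)%N && P n) f) [RHS]big_ltn_cond//=.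
  by rewrite [RHS]big_nat_cond; apply: eq_bigl => -[|n].
rewrite (partition_big (fun S : {set 'I_z} => inord (np S) : 'I_M.+1)
  (fun n => (0 < n) && P n)%N)/=; last first.
  by move=> S /andP[sS PS]; rewrite inordK ?SM// np_gt0.
apply: ler_sum => n _.
have [S0 /andP[/andP[sS0 PS0] /eqP nE]|H] := pickP
  (fun S : {set 'I_z} => (S \subset pr z) && P (np S) && (inord (np S) == n :> 'I_M.+1)).
  rewrite (big_pred1 S0) => [|S]; first by rewrite -nE inordK// SM.
  apply/andP/eqP => [[/andP[sS PS] /eqP nE']|->]; last by rewrite sS0 PS0 nE.
  apply: np_inj => //; have := congr1 val (etrans nE' (esym nE)).
  by rewrite /= !inordK// SM.
by rewrite big_pred0.
Qed.

(** A prime with [p ^ eps >= K] contributes at most its share of the right side, and at most [p0]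
    primes are smaller; this makes [C] independent of [z]. [K1] covers [K = 0]. *)
Lemma divisor_bound (K : nat) (eps : R) : 0 < eps ->
  exists2 C : R, 1 <= C & forall z (S : {set 'I_z}), S \subset pr z ->
    (K ^ #|S|)%:R <= C * (np S)%:R `^ eps.
Proof.
move=> e0; pose K1 := maxn K 1.
have [p0 Hp0] : exists p0 : nat, forall p : nat, (p0 <= p)%N -> (K1%:R : R) <= p%:R `^ eps.
  pose x := (K1%:R : R) `^ (eps^-1).
  exists (Num.truncn x).+1 => p pp.
  have -> : (K1%:R : R) = x `^ eps.
    by rewrite /x -powRrM mulVf ?gt_eqF// powRr1// ler0n.
  apply: ge0_ler_powR; rewrite ?nnegrE ?powR_ge0 ?(ltW e0)//.
  apply: le_trans (ltW (truncnS_gt x)) _; by rewrite ler_nat.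
exists ((K1 ^ p0)%:R); first by rewrite ler1n expn_gt0 leq_maxr.
move=> z S sS.
apply: le_trans (_ : \prod_(p in S) ((if (p < p0)%N then K1%:R else 1) * (p%:R : R) `^ eps) <= _).
  rewrite natrX -prodr_const; apply: ler_prod => p pS; rewrite ler0n/=.
  have pp := pr_prime sS pS.
  have p1 : 1 <= (p%:R : R) `^ eps.
    by rewrite -[leLHS](powRr0 (p%:R : R)) ler_powR ?ler1n ?prime_gt0// ltW.
  have KK : (K%:R : R) <= K1%:R by rewrite ler_nat leq_maxl.
  case: ltnP => [_|Hp]; last by rewrite mul1r (le_trans KK)// Hp0.
  by apply: le_trans KK _; rewrite ler_peMr.
rewrite big_split/=; apply: ler_pM.
- by apply: prodr_ge0 => p _; case: ifP.
- by apply: prodr_ge0 => p _; rewrite powR_ge0.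
- rewrite -big_mkcondr/= prodr_const -natrX ler_nat leq_pexp2l ?leq_maxr//.
  rewrite -[leqRHS](card_ord p0); case: p0 {Hp0} => [|p0].
    by rewrite eq_card0// => p; apply/negP => /andP[].
  have inj : {in [pred p in S | (p < p0.+1)%N] &, injective (fun p : 'I_z => inord p : 'I_p0.+1)}.
    move=> p q; rewrite !inE => /andP[_ pp] /andP[_ qq] E; apply: val_inj.
    by have := congr1 val E; rewrite /= !inordK.
  by rewrite -(card_in_image inj) max_card.
- rewrite /np; elim/big_rec2: _ => [|p y x pS]; first by rewrite powR1.
  by move=> H; rewrite natrM powRM// ler_wpM2l ?powR_ge0.
Qed.

Lemma zeta_partial_bound (eta : R) (M : nat) : 0 < eta ->
  \sum_(1 <= n < M) (n%:R : R) `^ (- 1 - eta) <= 1 + eta^-1.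
Proof.
move=> e0; have eV0 : 0 < eta^-1 by rewrite invr_gt0.
suff H m : \sum_(1 <= n < m.+2) (n%:R : R) `^ (- 1 - eta) <=
    1 + eta^-1 * (1 - (m.+1%:R) `^ (- eta)).
  have p0 : 0 <= 1 + eta^-1 by rewrite addr_ge0// ltW.
  case: M => [|[|m]]; [by rewrite big_geq|by rewrite big_geq|].
  apply: le_trans (H m) _; rewrite lerD2l; apply: ler_piMr; first exact: ltW.
  by rewrite lerBlDr lerDl powR_ge0.
elim: m => [|m IH].
  by rewrite big_nat1 !powR1 subrr mulr0 addr0.
rewrite big_nat_recr//=; apply: le_trans (lerD IH (lexx _)) _.
rewrite -addrA lerD2l mulrBr mulrBr -addrA lerD2l.
suff : m.+2%:R `^ (- 1 - eta) <= eta^-1 * (m.+1%:R `^ (- eta) - m.+2%:R `^ (- eta)).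
  by rewrite mulrBr; lra.
rewrite ler_pdivlMl//.
set a : R := m.+1%:R; set b : R := m.+2%:R.
have a0 : 0 < a by rewrite ltr0n.
have b0 : 0 < b by rewrite ltr0n.
have bE : b = a + 1 by rewrite /b /a natr1.
rewrite powRD; last by rewrite (gt_eqF b0) implybT.
rewrite powR_inv1 ?(ltW b0)// mulrA.
have -> : a `^ (- eta) = b `^ (- eta) * expR (eta * - ln (a / b)).
  rewrite /powR !gt_eqF// -expRD lnM ?posrE ?invr_gt0// lnV ?posrE//; congr expR; ring.
rewrite -[X in _ <= _ - X]mulr1 -mulrBr mulrC ler_wpM2l ?powR_ge0//.
rewrite lerBrDr addrC; apply: le_trans (expR_ge1Dx _); rewrite lerD2l ler_pM2l//.
rewrite lerNr.
have -> : a / b = 1 + - b^-1.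
  by rewrite (_ : a = b - 1); [field; rewrite gt_eqF|rewrite bE addrK].
by apply: le_ln1Dx; rewrite ltrN2 invf_lt1// bE ltrDr.
Qed.

(** Rankin's trick: the power [- 1 + 2 * eps] of [np S] is traded for that of [T], and the remaining
    sum of [n ^ (- 1 - eps)] is bounded uniformly in [z]. *)
Lemma sum_np_tail z (eps : R) (T : R) : 0 < eps -> eps <= 1 / 2 -> 0 < T ->
  \sum_(S : {set 'I_z} | (S \subset pr z) && (T < (np S)%:R)) (np S)%:R `^ (- 2 + eps)
  <= T `^ (- 1 + 2 * eps) * (1 + eps^-1).
Proof.
move=> e0 e1 T0.
pose P n := T < (n%:R : R).
apply: le_trans (_ : \sum_(S : {set 'I_z} | (S \subset pr z) && P (np S))
   T `^ (- 1 + 2 * eps) * (np S)%:R `^ (- 1 - eps) <= _).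
  apply: ler_sum => S /andP[sS TS].
  have n0 : 0 < ((np S)%:R : R) by rewrite ltr0n np_gt0.
  have -> : - 2 + eps = (- 1 + 2 * eps) + (- 1 - eps) by ring.
  rewrite powRD; last by rewrite (gt_eqF n0) implybT.
  rewrite ler_wpM2r ?powR_ge0//.
  have -> : -1 + 2 * eps = - (1 - 2 * eps) by ring.
  rewrite !powRN lef_pV2 ?posrE ?powR_gt0//.
  apply: ge0_ler_powR; rewrite ?nnegrE ?(ltW T0) ?(ltW n0) ?(ltW TS)//; lra.
rewrite -mulr_sumr ler_wpM2l ?powR_ge0//.
apply: le_trans (zeta_partial_bound (np (pr z)).+1 e0).
apply: le_trans (sum_np_le (f := fun n => n%:R `^ (- 1 - eps)) (M := (np (pr z)).+1) _ _) _.
- by move=> n; exact: powR_ge0.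
- by move=> S sS _; exact: np_lt_bound.
by rewrite big_mkcond ler_sum// => n _; case: ifP => // _; exact: powR_ge0.
Qed.

Lemma card_np_le z (T : R) : 0 <= T ->
  \sum_(S : {set 'I_z} | (S \subset pr z) && ((np S)%:R <= T)) 1 <= T.
Proof.
move=> T0; pose P n := (n%:R : R) <= T.
apply: le_trans (_ : \sum_(1 <= n < (Num.truncn T).+1 | P n) 1 <= _).
  apply: (sum_np_le (f := fun _ => 1)) => // S sS PS.
  by rewrite ltnS -ltnS -(ltr_nat R) (le_lt_trans PS)// truncnS_gt.
apply: le_trans (_ : \sum_(1 <= n < (Num.truncn T).+1) 1 <= _).
  by rewrite big_mkcond ler_sum// => n _; case: ifP.
by rewrite sumr_const_nat subn1/= truncn_le.
Qed.

End prime_set_sums.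

(** * Averages over a period *)

Section periodic_sums.
Variable V : comPzSemiRingType.
Implicit Types (F G : nat -> V) (D : nat).

Definition per (T : Type) D (F : nat -> T) := forall n m, n = m %[mod D] -> F n = F m.

Lemma per_mod (T : Type) D (F : nat -> T) n : per D F -> F (n %% D)%N = F n.
Proof. by apply; rewrite modn_mod. Qed.

Lemma per_dvd (T : Type) D E (F : nat -> T) : (D %| E)%N -> per D F -> per E F.
Proof.
move=> dE pF n m nm; apply: pF.
by rewrite -(modn_dvdm n dE) nm (modn_dvdm m dE).
Qed.

Lemma sum_crt (a b : nat) (F : nat -> nat -> V) : (0 < a)%N -> (0 < b)%N -> coprime a b ->
  \sum_(0 <= n < a * b) F (n %% a)%N (n %% b)%N =
  \sum_(0 <= x < a) \sum_(0 <= y < b) F x y.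
Proof.
case: a => // a; case: b => // b _ _ ab.
rewrite !big_mkord; under [RHS]eq_bigr do rewrite big_mkord.
rewrite pair_big /=.
pose h (n : 'I_(a.+1 * b.+1)) : 'I_a.+1 * 'I_b.+1 := (inord (n %% a.+1), inord (n %% b.+1)).
have hi : injective h.
  move=> n m [] /(congr1 val) /= E1 /(congr1 val) /= E2.
  rewrite !inordK ?ltn_pmod// in E1; rewrite !inordK ?ltn_pmod// in E2.
  apply: val_inj => /=; rewrite -(modn_small (ltn_ord n)) -(modn_small (ltn_ord m)).
  by apply/eqP; rewrite chinese_remainder// E1 E2 !eqxx.
have hb : bijective h.
  by apply: inj_card_bij => //; rewrite card_prod !card_ord.
rewrite (reindex h); last by apply: onW_bij.
by apply: eq_bigr => n _ /=; rewrite !inordK ?ltn_pmod.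
Qed.

Lemma sum_crt_mul (a b : nat) F G : (0 < a)%N -> (0 < b)%N -> coprime a b ->
  per a F -> per b G ->
  \sum_(0 <= n < a * b) F n * G n = (\sum_(0 <= n < a) F n) * (\sum_(0 <= n < b) G n).
Proof.
move=> a0 b0 ab pF pG; rewrite mulr_suml.
under [RHS]eq_bigr do rewrite mulr_sumr.
rewrite -(sum_crt (fun x y => F x * G y))//.
by apply: eq_bigr => n _; rewrite !per_mod.
Qed.

Lemma sum_np_prod z (S : {set 'I_z}) (F : 'I_z -> nat -> V) : S \subset pr z ->
  (forall p, p \in S -> per (p ^ 2) (F p)) ->
  \sum_(0 <= n < np S ^ 2) \prod_(p in S) F p n =
  \prod_(p in S) \sum_(0 <= n < p ^ 2) F p n.
Proof.
move: {2}#|S| (erefl #|S|) => m.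
elim: m S => [|m IH] S cS sS pF.
  move/eqP: cS; rewrite cards_eq0 => /eqP ->.
  by rewrite np0 exp1n big_nat1 !big_set0.
have /card_gt0P[p pS] : (0 < #|S|)%N by rewrite cS.
have sS' : S :\ p \subset pr z by rewrite (subset_trans _ sS) ?subD1set.
have pp := pr_prime sS pS.
have pF' q : q \in S :\ p -> per (q ^ 2) (F q).
  by rewrite inE => /andP[_]; exact: pF.
rewrite [RHS](big_setD1 p)//= -IH//; last first.
  by have := cardsD1 p S; rewrite cS pS add1n => -[].
rewrite (npD1 pS) expnMn.
under eq_bigr do rewrite (big_setD1 p)//=.
apply: (@sum_crt_mul (p ^ 2) (np (S :\ p) ^ 2) (F p) (fun n => \prod_(q in S :\ p) F q n)).
- by rewrite expn_gt0 prime_gt0.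
- by rewrite expn_gt0 np_gt0.
- by rewrite coprimeXl ?coprimeXr// coprime_np// setD11.
- exact: pF.
move=> n m' nm; apply: eq_bigr => q qS; apply: (per_dvd _ (pF' q qS)) nm.
by rewrite dvdn_exp2r// (npD1 qS) dvdn_mulr.
Qed.

Lemma sum_per_shift D F c : (0 < D)%N -> per D F ->
  \sum_(0 <= n < D) F (n + c)%N = \sum_(0 <= n < D) F n.
Proof.
move=> D0 pF; elim: c => [|c <-]; first by apply: eq_bigr => n _; rewrite addn0.
case: D D0 pF => // D _ pF.
rewrite big_nat_recr//= [RHS]big_ltn// addrC; congr (_ + _).
  by apply: pF; rewrite addnS -addSn add0n modnDl.
rewrite big_add1/=; apply: eq_bigr => n _; by rewrite addnS.
Qed.

Lemma sum_per_mul D F q : (0 < D)%N -> per D F ->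
  \sum_(0 <= n < q * D) F n = (\sum_(0 <= n < D) F n) *+ q.
Proof.
move=> D0 pF; elim: q => [|q IH]; first by rewrite mul0n big_geq// mulr0n.
rewrite mulSn (big_cat_nat (n := D))//=; last exact: leq_addr.
rewrite mulrS -IH; congr (_ + _).
rewrite -{1}[D]add0n big_addn addKn; apply: eq_bigr => n _.
by apply: pF; rewrite modnDr.
Qed.

End periodic_sums.

Section averages.
Variable R : realType.
Implicit Types (F G : nat -> R).

Definition pavg z F : R := (\sum_(0 <= n < np (pr z) ^ 2) F n) / (np (pr z) ^ 2)%:R.

Lemma prz_gt0 z : (0 < np (pr z) ^ 2)%N.
Proof. by rewrite expn_gt0 np_gt0. Qed.

Lemma pavg_ge0 z F : (forall n, 0 <= F n) -> 0 <= pavg z F.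
Proof. by move=> F0; rewrite divr_ge0// sumr_ge0. Qed.

Lemma pavg_le z F G : (forall n, F n <= G n) -> pavg z F <= pavg z G.
Proof. by move=> FG; rewrite ler_wpM2r ?invr_ge0// ler_sum. Qed.

Lemma pavgD z F G : pavg z (fun n => F n + G n) = pavg z F + pavg z G.
Proof. by rewrite /pavg big_split/= mulrDl. Qed.

Lemma pavgZ z c F : pavg z (fun n => c * F n) = c * pavg z F.
Proof. by rewrite /pavg -mulr_sumr mulrA. Qed.

Lemma pavg_cst z c : pavg z (fun=> c) = c.
Proof.
rewrite /pavg sumr_const_nat subn0 -[_ *+ _]mulr_natr mulfK// pnatr_eq0 -lt0n.
exact: prz_gt0.
Qed.

Lemma pavg_sum z (I : Type) (r : seq I) (P : pred I) (F : I -> nat -> R) :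
  pavg z (fun n => \sum_(i <- r | P i) F i n) = \sum_(i <- r | P i) pavg z (F i).
Proof. by rewrite /pavg exchange_big/= mulr_suml. Qed.

Lemma pavg_norm z F : `|pavg z F| <= pavg z (fun n => `|F n|).
Proof.
rewrite /pavg normrM [`|_^-1|]ger0_norm ?invr_ge0// ler_wpM2r ?invr_ge0//.
exact: ler_norm_sum.
Qed.

Lemma pavg_shift z F c : per (np (pr z) ^ 2) F -> pavg z (fun n => F (n + c)%N) = pavg z F.
Proof. by move=> pF; rewrite /pavg sum_per_shift// prz_gt0. Qed.

Lemma pavg_sub z (S : {set 'I_z}) F : S \subset pr z -> per (np S ^ 2) F ->
  pavg z F = (\sum_(0 <= n < np S ^ 2) F n) / (np S ^ 2)%:R.
Proof.
move=> sS pF; have S0 : (0 < np S ^ 2)%N by rewrite expn_gt0 np_gt0.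
rewrite /pavg (npID _ S) (setIidPr sS) mulnC expnMn sum_per_mul//.
have Q0 : (0 < np (pr z :\: S) ^ 2)%N.
  by rewrite expn_gt0 np_gt0// subsetDl.
set c := \sum_(_ <= _ < _) _; rewrite -[c *+ _]mulr_natr natrM.
move: (np S ^ 2)%N (np (pr z :\: S) ^ 2)%N S0 Q0 c => s q s0 q0 c.
by field; rewrite !pnatr_eq0 -!lt0n s0 q0.
Qed.

Lemma pavg_prod z (S : {set 'I_z}) (F : 'I_z -> nat -> R) : S \subset pr z ->
  (forall p, p \in S -> per (p ^ 2) (F p)) ->
  pavg z (fun n => \prod_(p in S) F p n) =
  \prod_(p in S) ((\sum_(0 <= n < p ^ 2) F p n) / (p ^ 2)%:R).
Proof.
move=> sS pF; rewrite (pavg_sub sS); last first.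
  move=> n m nm; apply: eq_bigr => q qS; apply: (per_dvd _ (pF q qS)) nm.
  by rewrite dvdn_exp2r// (npD1 qS) dvdn_mulr.
rewrite sum_np_prod// big_split/=; congr (_ * _).
by under eq_bigr do rewrite natrX; rewrite prodfV prodrXl natrX /np natr_prod.
Qed.

(** For nonnegative [F] the error is the sum over one period, not the length of the period. For
    [sub_bad] this is decisive: the sum is at most [k ^ #|S|] while the period is [np S ^ 2]. *)
Lemma sum_interval_per D F L : (0 < D)%N -> per D F -> (forall n, 0 <= F n) ->
  `|\sum_(1 <= n < L.+1) F n - L%:R * (\sum_(0 <= n < D) F n) / D%:R| <= \sum_(0 <= n < D) F n.
Proof.
move=> D0 pF F0; set c := \sum_(0 <= n < D) F n.
have Dr : 0 < (D%:R : R) by rewrite ltr0n.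
have c0 : 0 <= c by exact: sumr_ge0.
pose G n := F n.+1.
have pG : per D G by move=> n m nm; apply: pF; rewrite -(addn1 n) -(addn1 m) -modnDml nm modnDml.
have cG : \sum_(0 <= n < D) G n = c.
  by rewrite /c -(sum_per_shift 1 D0 pF); apply: eq_bigr => n _; rewrite addn1.
have -> : \sum_(1 <= n < L.+1) F n = \sum_(0 <= n < L) G n by rewrite big_add1.
have mono a b : (a <= b)%N -> \sum_(0 <= n < a) G n <= \sum_(0 <= n < b) G n.
  move=> ab; rewrite (big_cat_nat (n := a) (p := b))//= lerDl sumr_ge0// => n _; exact: F0.
have lo : c * (L %/ D)%:R <= \sum_(0 <= n < L) G n.
  apply: le_trans (mono _ _ (leq_divM L D)).
  by rewrite sum_per_mul// cG mulr_natr.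
have hi : \sum_(0 <= n < L) G n <= c * (L %/ D).+1%:R.
  apply: le_trans (mono _ ((L %/ D).+1 * D)%N _) _; first by rewrite ltnW// ltn_ceil.
  by rewrite sum_per_mul// cG mulr_natr.
have q1 : (L %/ D)%:R <= (L%:R / D%:R : R).
  by rewrite ler_pdivlMr// -natrM ler_nat leq_divM.
have q2 : (L%:R / D%:R : R) <= (L %/ D).+1%:R.
  by rewrite ler_pdivrMr// -natrM ler_nat ltnW// ltn_ceil.
have -> : L%:R * c / D%:R = c * (L%:R / D%:R) by ring.
have h1 := ler_wpM2l c0 q1; have h2 := ler_wpM2l c0 q2.
move: lo hi h1 h2; rewrite -natr1 mulrDr mulr1 ler_norml.
move: (c * _) (c * _) (\sum_(0 <= n < L) G n) => u v w; lra.
Qed.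

End averages.

(** * Transfer from a period to an interval *)

Section inclusion_exclusion.
Variable R : realType.

Lemma sum_sign_subsets (T : finType) (B : {set T}) :
  \sum_(S : {set T} | S \subset B) (-1) ^+ #|S| = (B == set0)%:R :> R.
Proof.
pose F i : R := if i \in B then - 1 else 0.
transitivity (\prod_(i : T) (F i + 1)).
  rewrite bigA_distr big_mkcond; apply: eq_bigr => S _.
  case: ifPn => [sSB|/subsetPn[i iS iB]]; last first.
    by rewrite (bigD1 i)//= iS /F (negbTE iB) mul0r.
  rewrite -prodr_const big_mkcond; apply: eq_bigr => i _.
  by case: ifP => // iS; rewrite /F (subsetP sSB).
have [B0|/set0Pn[i iB]] := eqVneq B set0.
  by rewrite big1// => i _; rewrite /F B0 inE add0r.
by rewrite (bigD1 i)//= /F iB addNr mul0r.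
Qed.

Lemma card_subsets_le (T : finType) (B : {set T}) :
  \sum_(S : {set T} | S \subset B) (1 : R) = (2 ^ #|B|)%:R.
Proof.
rewrite sumr_const; congr (_%:R); rewrite -card_powerset; apply: eq_card => S.
by rewrite powersetE.
Qed.

End inclusion_exclusion.

Section bad_primes.
Variables (R : realType) (z k : nat) (hs : 'I_k -> nat).
Implicit Types (S : {set 'I_z}) (p : 'I_z) (n : nat).

(** It is empty exactly when all [k] shifts of [n] are free of squares of primes below [z], so a
    product over shifts needs only one inclusion-exclusion. *)
Definition bad n : {set 'I_z} :=
  [set p in pr z | [exists i, (p ^ 2 %| n + hs i)%N]].

Lemma bad_pr n : bad n \subset pr z.
Proof. by apply/subsetP => p; rewrite inE => /andP[]. Qed.

Lemma per_bad p : per (p ^ 2) (fun n => p \in bad n).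
Proof.
move=> n m nm; rewrite !inE; congr (_ && _); apply: eq_existsb => i.
by rewrite /dvdn -modnDml nm modnDml.
Qed.

Definition sub_bad S n : R := (S \subset bad n)%:R.

Lemma sub_badE S n : S \subset pr z -> sub_bad S n = \prod_(p in S) (p \in bad n)%:R.
Proof.
move=> sS; rewrite /sub_bad; case: subsetP => [sB|/subsetP/subsetPn[p pS pB]].
  by rewrite big1// => p /sB ->.
by rewrite (bigD1 p)//= (negbTE pB) mul0r.
Qed.

Lemma per_sub_bad S : S \subset pr z -> per (np S ^ 2) (sub_bad S).
Proof.
move=> sS n m nm; rewrite !sub_badE//; apply: eq_bigr => p pS; congr (_%:R).
congr (nat_of_bool _); apply: (per_dvd _ (@per_bad p)) nm.
by rewrite dvdn_exp2r// (npD1 pS) dvdn_mulr.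
Qed.

Lemma sub_bad_ge0 S n : 0 <= sub_bad S n. Proof. exact: ler0n. Qed.

Lemma sum_dvd_shift (D h : nat) : (0 < D)%N ->
  \sum_(0 <= n < D) (D %| n + h)%:R = 1 :> R.
Proof.
move=> D0; rewrite (@sum_per_shift R D (fun n => (D %| n)%:R) h D0); last first.
  by move=> n m nm; rewrite /dvdn nm.
rewrite big_ltn// dvdn0 big_nat big1 ?addr0// => n /andP[n0 nD].
by rewrite gtnNdvd.
Qed.

Definition rho S : R := \sum_(0 <= n < np S ^ 2) sub_bad S n.

Lemma rho_ge0 S : 0 <= rho S. Proof. by apply: sumr_ge0 => n _; exact: sub_bad_ge0. Qed.

Lemma rho_le S : S \subset pr z -> rho S <= (k ^ #|S|)%:R.
Proof.
move=> sS; rewrite /rho.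
have -> : \sum_(0 <= n < np S ^ 2) sub_bad S n =
    \sum_(0 <= n < np S ^ 2) \prod_(p in S) (p \in bad n)%:R.
  by apply: eq_bigr => n _; rewrite sub_badE.
rewrite (sum_np_prod (F := fun p n => (p \in bad n)%:R : R))//; last first.
  by move=> p _ n m nm; rewrite (per_bad nm).
rewrite natrX -prodr_const; apply: ler_prod => p pS; rewrite sumr_ge0//=.
have p0 : (0 < p ^ 2)%N by rewrite expn_gt0 prime_gt0// (pr_prime sS).
apply: le_trans (_ : \sum_(0 <= n < p ^ 2) \sum_(i < k) (p ^ 2 %| n + hs i)%:R <= _).
  apply: ler_sum => n _; rewrite inE; case: andP => [[_ /existsP[i pi]]|_].
    by rewrite (bigD1 i)//= pi lerDl sumr_ge0.
  by rewrite sumr_ge0.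
rewrite exchange_big/=; under eq_bigr do rewrite sum_dvd_shift//.
by rewrite sumr_const card_ord.
Qed.

Lemma pavg_sub_bad S : S \subset pr z -> pavg z (sub_bad S) = rho S / (np S ^ 2)%:R.
Proof. by move=> sS; rewrite (pavg_sub sS)//; exact: per_sub_bad. Qed.

Lemma sum_sub_bad L S : S \subset pr z ->
  `|\sum_(1 <= n < L.+1) sub_bad S n - L%:R * pavg z (sub_bad S)| <= rho S.
Proof.
move=> sS; rewrite pavg_sub_bad// mulrA.
apply: sum_interval_per; [by rewrite expn_gt0 np_gt0|exact: per_sub_bad|exact: sub_bad_ge0].
Qed.

Definition free n : R := (bad n == set0)%:R.

Definition freeT (y : R) n : R :=
  \sum_(S : {set 'I_z} | (S \subset pr z) && ((np S)%:R <= y)) (-1) ^+ #|S| * sub_bad S n.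

Lemma freeE n : free n = \sum_(S : {set 'I_z} | S \subset pr z) (-1) ^+ #|S| * sub_bad S n.
Proof.
rewrite /free -sum_sign_subsets big_mkcond [RHS]big_mkcond; apply: eq_bigr => S _.
rewrite /sub_bad; case: ifPn => [sB|_].
  by rewrite (subset_trans sB (bad_pr n)) mulr1.
by rewrite mulr0 if_same.
Qed.

Lemma free_freeT (y : R) n : free n - freeT y n =
  \sum_(S : {set 'I_z} | (S \subset pr z) && (y < (np S)%:R)) (-1) ^+ #|S| * sub_bad S n.
Proof.
rewrite freeE (bigID (fun S => (np S)%:R <= y))/= /freeT addrAC subrr add0r.
by apply: eq_bigl => S; rewrite -ltNge.
Qed.

Lemma norm_free_freeT (y : R) n : `|free n - freeT y n| <=
  \sum_(S : {set 'I_z} | (S \subset pr z) && (y < (np S)%:R)) sub_bad S n.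
Proof.
rewrite free_freeT; apply: le_trans (ler_norm_sum _ _ _) _.
by apply: ler_sum => S _; rewrite normrM normrX normrN1 expr1n mul1r ger0_norm ?sub_bad_ge0.
Qed.

Lemma free_freeT_card (y : R) n : `|free n - freeT y n| <=
  (y < (np (bad n))%:R)%R%:R * (2 ^ #|bad n|)%:R.
Proof.
apply: le_trans (norm_free_freeT y n) _.
case: ltP => [_|le].
  apply: (@le_trans _ _ (\sum_(S : {set 'I_z} | S \subset bad n) 1)); last first.
    by rewrite card_subsets_le mul1r.
  rewrite [leRHS]big_mkcond [leLHS]big_mkcond; apply: ler_sum => S _.
  rewrite /sub_bad; case: (S \subset bad n); last by rewrite if_same.
  by case: ifP.
rewrite mul0r big1// => S /andP[sS yS]; rewrite /sub_bad.
case: (boolP (S \subset bad n)) => [sB|_//].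
have : ((np S)%:R : R) <= (np (bad n))%:R by rewrite ler_nat np_le// bad_pr.
by move=> h1; have := le_lt_trans (le_trans h1 le) yS; rewrite ltxx.
Qed.

(** [bad n] is the union over [i] of sets whose product squared divides [n + hs i]. The bound makes
    the number [2 ^ #|bad n|] of its subsets a small power of [M]. *)
Lemma bad_np_le n M : (0 < n)%N -> (forall i, n + hs i <= M)%N -> (np (bad n) <= M ^ k)%N.
Proof.
move=> n0 hM.
pose B i : {set 'I_z} := [set p in pr z | (p ^ 2 %| n + hs i)%N].
have sB i : B i \subset pr z by apply/subsetP => p; rewrite inE => /andP[].
have -> : bad n = \bigcup_(i < k) B i.
  apply/setP => p; rewrite inE; apply/andP/bigcupP => [[pp /existsP[i pi]]|[i _]].
    by exists i => //; rewrite inE pp.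
  by rewrite inE => /andP[-> pi]; split => //; apply/existsP; exists i.
have Bi i : (np (B i) <= M)%N.
  apply: leq_trans (hM i); apply: dvdn_leq; first by rewrite addn_gt0 n0.
  have : (np (B i) ^ 2 %| n + hs i)%N.
    by rewrite np_dvdn_exp//; apply/'forall_implyP => p; rewrite inE => /andP[].
  by apply: dvdn_trans; rewrite expnS dvdn_mulr.
rewrite -[X in (_ <= _ ^ X)%N](card_ord k) -prod_nat_const.
suff : (np (\bigcup_(i < k) B i) <= \prod_(i < k) M)%N /\ \bigcup_(i < k) B i \subset pr z by case.
elim/big_rec2: _ => [|i m A _ [IH sA]]; first by rewrite np0 sub0set.
split; last by rewrite subUset sB.
apply: leq_trans (_ : np (B i) * np A <= _)%N; last exact: leq_mul.
rewrite (npID _ (B i)) setUK setDUl setDv set0U leq_mul2l; apply/orP; right.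
by rewrite np_le// subsetDl.
Qed.

Lemma bad_prime_le n M p : (0 < n)%N -> (forall i, n + hs i <= M)%N -> p \in bad n -> (p ^ 2 <= M)%N.
Proof.
move=> n0 hM; rewrite inE => /andP[_ /existsP[i pi]].
by apply: leq_trans (hM i); apply: dvdn_leq pi; rewrite addn_gt0 n0.
Qed.

End bad_primes.

(** Take [S] with [np S] maximal among products at most [y]. A prime [p] of [B] outside [S]
    satisfies [p <= np S], by maximality against [[set p]], and [p * np S > y], by maximality
    against [p |: S]; hence [np S ^ 2 > y]. *)
Lemma greedy_subset (R : realType) z (B : {set 'I_z}) (y : R) : B \subset pr z -> 1 <= y ->
  y < (np B)%:R -> (forall p : 'I_z, p \in B -> p%:R <= y) ->
  exists S : {set 'I_z}, [/\ S \subset B, (np S)%:R <= y & y <= (np S)%:R ^+ 2].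
Proof.
move=> sB y1 yB py.
pose P (S : {set 'I_z}) := (S \subset B) && ((np S)%:R <= y).
have P0 : P set0 by rewrite /P sub0set np0.
have [S /andP[sS Sy] Smax] := @arg_maxnP _ (set0 : {set 'I_z}) P (@np z) P0.
exists S; split => //; rewrite leNgt; apply/negP => lt.
have SB : S != B by apply: contraTneq Sy => ->; rewrite -ltNge.
have /subsetPn[p pB pS] : ~~ (B \subset S).
  by apply: contra SB => BS; rewrite eqEsubset sS.
have p0 : (0 < p)%N by rewrite prime_gt0// (pr_prime sB).
have : ~~ P (p |: S).
  apply/negP => /Smax; rewrite npU1// /geq/= leqNgt; case/negP.
  by rewrite ltn_Pmull ?np_gt0 ?(subset_trans sS)// prime_gt1// (pr_prime sB).
rewrite /P subUset sub1set pB sS/= npU1// natrM -ltNge => lt2.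
have /Smax : P [set p] by rewrite /P sub1set pB np1 py.
rewrite np1 /geq/= -(ler_nat R) => le.
have : ((p%:R : R) * (np S)%:R <= (np S)%:R ^+ 2) by rewrite expr2 ler_wpM2r.
by move=> /(lt_le_trans lt2)/(lt_trans lt); rewrite ltxx.
Qed.

Section transfer.
Variable R : realType.

Lemma sum_np_range z (y : R) (C1 e1 : R) (k L : nat) (hs : 'I_k -> nat) :
  0 < e1 -> e1 <= 1 / 2 -> 1 <= y -> 0 <= C1 ->
  (forall S : {set 'I_z}, S \subset pr z -> (k ^ #|S|)%:R <= C1 * (np S)%:R `^ e1) ->
  \sum_(S : {set 'I_z} | [&& S \subset pr z, (np S)%:R <= y & y <= (np S)%:R ^+ 2])
     (\sum_(1 <= n < L.+1) sub_bad R hs S n)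
  <= C1 * y `^ e1 * (L%:R * ((y `^ (1 / 2) / 2) `^ (- 1 + 2 * e1) * (1 + e1^-1)) + y).
Proof.
move=> e0 e12 y1 C0 HC.
have y0 : 0 < y by exact: lt_le_trans ltr01 y1.
(* The tail bound requires a strict inequality below [np S], whereas [np S] may equal [sqrt y];
   hence the half. *)
have yh0 : 0 < y `^ (1 / 2) / 2 by rewrite divr_gt0 ?powR_gt0.
apply: le_trans (_ : \sum_(S : {set 'I_z} | [&& S \subset pr z, (np S)%:R <= y & y <= (np S)%:R ^+ 2])
   (C1 * y `^ e1) * (L%:R * (np S)%:R `^ (- 2 + e1) + 1) <= _).
  apply: ler_sum => S /and3P[sS Sy yS].
  have n1 : 1 <= ((np S)%:R : R) by rewrite ler1n np_gt0.
  have n0 : 0 < ((np S)%:R : R) by exact: lt_le_trans n1.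
  have := sum_sub_bad R hs L sS; rewrite pavg_sub_bad//.
  have r1 : rho R hs S <= C1 * y `^ e1.
    apply: le_trans (rho_le R hs sS) _; apply: le_trans (HC S sS) _.
    by rewrite ler_wpM2l// ge0_ler_powR// ?nnegrE ltW.
  have r0 := rho_ge0 R hs S.
  rewrite ler_norml => /andP[_]; rewrite lerBlDr => /le_trans; apply.
  rewrite mulrDr mulr1 [leRHS]addrC lerD// [leRHS]mulrCA ler_wpM2l//.
  apply: ler_pM => //.
  rewrite natrX -powR_mulrn ?(ltW n0)// -powRN ler_powR//; lra.
rewrite -mulr_sumr ler_wpM2l ?mulr_ge0 ?powR_ge0// big_split/= -mulr_sumr lerD//.
  rewrite ler_wpM2l//; apply: le_trans (sum_np_tail z e0 e12 yh0).
  rewrite [leRHS]big_mkcond [leLHS]big_mkcond; apply: ler_sum => S _.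
  case: (boolP (S \subset pr z)) => //= sS.
  have n0 : 0 < ((np S)%:R : R) by rewrite ltr0n np_gt0.
  case: andP => [[_ yS]|_]; last by case: ifP => //; rewrite powR_ge0.
  rewrite ifT// (lt_le_trans (_ : _ < y `^ (1 / 2)))//.
    by rewrite ltr_pdivrMr// ltr_pMr ?powR_gt0//; lra.
  have -> : (np S)%:R = ((np S)%:R ^+ 2) `^ (1 / 2) :> R.
    by rewrite -powR_mulrn ?(ltW n0)// -powRrM (_ : 2%:R * (1 / 2) = 1) ?powRr1 ?(ltW n0)//; field.
  apply: ge0_ler_powR; rewrite ?nnegrE ?(ltW y0) ?exprn_ge0 ?(ltW n0)//; lra.
apply: le_trans (card_np_le z (ltW y0)).
rewrite [leRHS]big_mkcond [leLHS]big_mkcond; apply: ler_sum => S _.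
by case: (S \subset pr z) => //=; case: (_ <= y) => //=; case: ifP.
Qed.

Lemma powR_le_max (a b c : R) : 1 <= a -> b <= c -> a `^ b <= a `^ c.
Proof. by move=> a1 bc; rewrite ler_powR. Qed.

Lemma transfer_free (k : nat) (eps : R) : 0 < eps ->
  exists2 C : R, 0 < C & forall z L (hs : 'I_k -> nat), (0 < L)%N ->
    (forall i, hs i <= L)%N ->
    `|(\sum_(1 <= n < L.+1) free R z hs n) / L%:R - pavg z (free R z hs)|
      <= C * L%:R `^ (- (1 / 3) + eps).
Proof.
move=> eps0.
pose e1 : R := Num.min (eps / 4) (1 / 4).
have e10 : 0 < e1 by rewrite lt_min !divr_gt0.
have e14 : e1 <= 1 / 4 by rewrite ge_min lexx orbT.
have e1e : e1 <= eps / 4 by rewrite ge_min lexx.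
(* The product of the bad primes is only bounded by [(2 * L) ^ k], so the divisor bound must afford
   the exponent [k * e2]. *)
pose e2 : R := eps / (2 * k.+1%:R).
have e20 : 0 < e2 by rewrite divr_gt0// mulr_gt0.
have e2k : k%:R * e2 <= eps / 2.
  rewrite /e2 mulrA ler_pdivrMr ?mulr_gt0// [leRHS](_ : _ = k.+1%:R * eps); last by field.
  by rewrite ler_wpM2r ?(ltW eps0)// ler_nat.
have [C1 C11 HC1] := divisor_bound k e10.
have [C2 C21 HC2] := divisor_bound 2 e20.
have C10 : 0 <= C1 by exact: le_trans ler01 C11.
have C20 : 0 <= C2 by exact: le_trans ler01 C21.
pose E := 1 + e1^-1.
have E0 : 0 <= E by rewrite addr_ge0// invr_ge0 ltW.
pose K2 := (2 ^ k)%:R `^ e2 : R.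
have K20 : 0 <= K2 by exact: powR_ge0.
pose C := C1 * 4 + C1 * E + C2 * K2 * (C1 * 2 * (4 * E + 2)).
have C0 : 0 <= C by rewrite !addr_ge0 ?mulr_ge0// addr_ge0// mulr_ge0.
exists (C + 1); first by rewrite ltr_wpDl.
move=> z L hs L0 hsL.
set l : R := L%:R.
have l1 : 1 <= l by rewrite ler1n.
have l0 : 0 < l by exact: lt_le_trans l1.
have ln0 : l != 0 by rewrite gt_eqF.
(* The factor 2 ensures, for every [L], that a prime with [p ^ 2 <= 2 * L] is at most [y], as the
   greedy choice demands. *)
pose y : R := 2 * l `^ (2 / 3).
have y1 : 1 <= y.
  have : 1 <= l `^ (2 / 3) by rewrite -[leLHS](powRr0 l) powR_le_max//; lra.
  by rewrite /y; lra.
have y0 : 0 < y by exact: lt_le_trans ltr01 y1.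
have two_le (x : R) : 0 <= x -> x <= 1 -> 2 `^ x <= 2 :> R.
  by move=> x0 x1; rewrite -[leRHS](@powRr1 R 2)// ler_powR//; lra.
have ye1 : y `^ e1 <= 2 * l `^ (eps / 6).
  rewrite powRM ?powR_ge0// -powRrM; apply: ler_pM; rewrite ?powR_ge0//.
    by apply: two_le; lra.
  by rewrite powR_le_max//; lra.
set T := l `^ (- (1 / 3) + eps).
have T0 : 0 <= T by exact: powR_ge0.
pose A F := (\sum_(1 <= n < L.+1) F n) / l : R.
have AB F G : A (fun n => F n - G n) = A F - A G by rewrite /A sumrB mulrBl.
set f := free R z hs; set g := freeT z hs y.
(* Three errors. The truncated sums agree term by term up to [rho], with at most [y] terms. The tail
   over a period is a convergent sum. The tail over the interval involves sets with [np S] far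
   beyond [L]; there each [n] with large [np (bad n)] is charged to a greedy subset with product in
   [[sqrt y, y]]. *)
have split : A f - pavg z f = (A g - pavg z g) + (A (fun n => f n - g n)) - pavg z (fun n => f n - g n).
  rewrite AB (_ : pavg z (fun n => f n - g n) = pavg z f - pavg z g); first by ring.
  by rewrite /pavg sumrB mulrBl.
have P1 : `|A g - pavg z g| <= C1 * 4 * T.
  rewrite /A /g /freeT exchange_big/= mulr_suml pavg_sum -sumrB.
  apply: le_trans (ler_norm_sum _ _ _) _.
  apply: le_trans (_ : \sum_(S : {set 'I_z} | (S \subset pr z) && ((np S)%:R <= y))
     C1 * y `^ e1 / l * 1 <= _).
    apply: ler_sum => S /andP[sS Sy].
    rewrite pavgZ -mulr_sumr -[_ / l]mulrA -mulrBr normrM normrX normrN1 expr1n mul1r mulr1.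
    rewrite (_ : _ / l - _ = (\sum_(1 <= n < L.+1) sub_bad R hs S n - l * pavg z (sub_bad R hs S)) / l); last by field.
    rewrite normrM [`|l^-1|]ger0_norm ?invr_ge0 ?(ltW l0)// ler_wpM2r ?invr_ge0 ?(ltW l0)//.
    apply: le_trans (sum_sub_bad R hs L sS) _.
    apply: le_trans (rho_le R hs sS) _; apply: le_trans (HC1 z S sS) _.
    by rewrite ler_wpM2l// ge0_ler_powR ?nnegrE ?(ltW e10) ?(ltW y0).
  rewrite -mulr_sumr; apply: le_trans (ler_wpM2l _ (card_np_le z (ltW y0))) _.
    by rewrite !mulr_ge0 ?invr_ge0 ?powR_ge0// ltW.
  apply: le_trans (_ : C1 * (2 * l `^ (eps / 6)) / l * y <= _).
    rewrite ler_wpM2r ?(ltW y0)// ler_wpM2r ?invr_ge0 ?(ltW l0)// ler_wpM2l//.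
  rewrite [leLHS](_ : _ = C1 * 4 * (l `^ (eps / 6) * l `^ (2 / 3) * l `^ (- 1))); last first.
    by rewrite /y powR_inv1 ?(ltW l0)//; ring.
  rewrite -!powRD; try by rewrite ln0 implybT.
  by rewrite ler_wpM2l ?mulr_ge0// powR_le_max//; lra.
have P2 : `|pavg z (fun n => f n - g n)| <= C1 * E * T.
  apply: le_trans (pavg_norm _ _) _.
  apply: le_trans (pavg_le z (@norm_free_freeT R z k hs y)) _.
  rewrite pavg_sum.
  apply: le_trans (_ : \sum_(S : {set 'I_z} | (S \subset pr z) && (y < (np S)%:R))
     C1 * (np S)%:R `^ (- 2 + e1) <= _).
    apply: ler_sum => S /andP[sS Sy].
    have n0 : 0 < ((np S)%:R : R) by rewrite ltr0n np_gt0.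
    rewrite pavg_sub_bad// powRD; last by rewrite (gt_eqF n0) implybT.
    rewrite mulrCA mulrC powRN powR_mulrn ?(ltW n0)// -natrX.
    rewrite ler_wpM2l ?invr_ge0//.
    by apply: le_trans (rho_le R hs sS) _; exact: HC1.
  rewrite -mulr_sumr -mulrA ler_wpM2l//.
  apply: le_trans (sum_np_tail z e10 _ y0) _; first by lra.
  rewrite mulrC ler_wpM2l//.
  apply: le_trans (_ : (l `^ (2 / 3)) `^ (- 1 + 2 * e1) <= _).
    have -> : - 1 + 2 * e1 = - (1 - 2 * e1) by ring.
    rewrite !powRN lef_pV2 ?posrE ?powR_gt0//.
    apply: ge0_ler_powR; rewrite ?nnegrE ?powR_ge0 ?(ltW y0)//; first by lra.
    by rewrite /y ler_peMl ?powR_ge0//; lra.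
  by rewrite -powRrM powR_le_max//; lra.
have P3 : `|A (fun n => f n - g n)| <= C2 * K2 * (C1 * 2 * (4 * E + 2)) * T.
  rewrite /A normrM [`|l^-1|]ger0_norm ?invr_ge0 ?(ltW l0)//.
  rewrite ler_pdivrMr//.
  have nb n : (0 < n < L.+1)%N -> `|f n - g n| <= C2 * (K2 * l `^ (eps / 2)) *
     \sum_(S : {set 'I_z} | [&& S \subset pr z, (np S)%:R <= y & y <= (np S)%:R ^+ 2]) sub_bad R hs S n.
    move=> /andP[n0 nL].
    have hM i : (n + hs i <= 2 * L)%N by move: (hsL i) nL; clear; lia.
    apply: le_trans (@free_freeT_card R z k hs y n) _.
    case: ltP => [lt|_]; last first.
      by rewrite mul0r !mulr_ge0 ?powR_ge0// sumr_ge0// => S _; exact: sub_bad_ge0.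
    rewrite mul1r -[leLHS]mulr1; apply: ler_pM => //.
      apply: le_trans (HC2 z _ (@bad_pr z k hs n)) _; rewrite ler_wpM2l//.
      apply: le_trans (_ : ((2 * L) ^ k)%:R `^ e2 <= _).
        by apply: ge0_ler_powR; rewrite ?nnegrE ?(ltW e20)// ler_nat bad_np_le.
      rewrite expnMn natrM powRM// ler_wpM2l// natrX -powR_mulrn ?(ltW l0)// -powRrM.
      by rewrite powR_le_max.
    have [S [sS Sy yS]] : exists S : {set 'I_z}, [/\ S \subset bad z hs n, (np S)%:R <= y & y <= (np S)%:R ^+ 2].
      apply: greedy_subset => //; first exact: bad_pr.
      move=> p pB; have p2 := bad_prime_le n0 hM pB.
      rewrite -(ler_pXn2r (ltn0Sn 1)) ?nnegrE ?(ltW y0)//.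
      apply: le_trans (_ : 2 * l <= _); first by rewrite -natrX -natrM ler_nat.
      rewrite /y exprMn -[(l `^ _) ^+ 2]powR_mulrn ?powR_ge0// -powRrM.
      have : l <= l `^ (2 / 3 * 2%:R) by rewrite -{1}(powRr1 (ltW l0)) powR_le_max//; lra.
      lra.
    rewrite (bigD1 S)/=; last by rewrite (subset_trans sS (@bad_pr z k hs n)) Sy yS.
    by rewrite /sub_bad sS lerDl sumr_ge0.
  apply: le_trans (ler_norm_sum _ _ _) _.
  apply: le_trans (_ : \sum_(1 <= n < L.+1) C2 * (K2 * l `^ (eps / 2)) *
     \sum_(S : {set 'I_z} | [&& S \subset pr z, (np S)%:R <= y & y <= (np S)%:R ^+ 2]) sub_bad R hs S n <= _).
    by rewrite !big_nat; apply: ler_sum => n nL; exact: nb.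
  rewrite -mulr_sumr exchange_big/=.
  have cK : 0 <= C2 * (K2 * l `^ (eps / 2)) by rewrite !mulr_ge0 ?powR_ge0.
  apply: le_trans (ler_wpM2l cK (sum_np_range L hs e10 _ y1 C10 (HC1 z))) _; first by lra.
  have r1 : (y `^ (1 / 2) / 2) `^ (- 1 + 2 * e1) <= 4 * l `^ (- (1 / 3) + eps / 6).
    have yh : l `^ (1 / 3) / 2 <= y `^ (1 / 2) / 2.
      rewrite ler_pM2r ?invr_gt0// /y powRM ?powR_ge0// -powRrM.
      have -> : 2 / 3 * (1 / 2) = 1 / 3 :> R by field.
      rewrite ler_peMl ?powR_ge0// -[leLHS](powRr0 (2 : R)) ler_powR//; lra.
    apply: le_trans (_ : (l `^ (1 / 3) / 2) `^ (- 1 + 2 * e1) <= _).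
      have -> : - 1 + 2 * e1 = - (1 - 2 * e1) by ring.
      rewrite !powRN lef_pV2 ?posrE ?powR_gt0 ?divr_gt0 ?powR_gt0//.
      apply: ge0_ler_powR; rewrite ?nnegrE ?divr_ge0 ?powR_ge0//; lra.
    rewrite powRM ?invr_ge0 ?powR_ge0// mulrC -powRrM; apply: ler_pM; rewrite ?powR_ge0//.
      rewrite -powR_inv1// -powRrM.
      have -> : (-1) * (-1 + 2 * e1) = 1 - 2 * e1 by ring.
      by apply: le_trans (two_le _ _ _) _; lra.
    by rewrite powR_le_max//; lra.
  apply: le_trans (_ : C2 * (K2 * l `^ (eps / 2)) * (C1 * (2 * l `^ (eps / 6)) *
     (l * (4 * l `^ (- (1 / 3) + eps / 6) * E) + 2 * l `^ (2 / 3))) <= _).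
    rewrite ler_wpM2l//; apply: ler_pM.
    - by rewrite mulr_ge0 ?powR_ge0.
    - by rewrite addr_ge0 ?(ltW y0)// !mulr_ge0 ?powR_ge0 ?(ltW l0).
    - by rewrite ler_wpM2l.
    - by rewrite lerD2r ler_wpM2l ?(ltW l0)// ler_wpM2r.
  have lE a b : l `^ a * l `^ b = l `^ (a + b) by rewrite powRD// ln0 implybT.
  have l1E : l = l `^ 1 by rewrite powRr1// ltW.
  have -> : l * (4 * l `^ (- (1 / 3) + eps / 6) * E) + 2 * l `^ (2 / 3) =
    4 * E * l `^ (1 + (- (1 / 3) + eps / 6)) + 2 * l `^ (2 / 3).
    by rewrite -(lE 1) powRr1 ?(ltW l0)//; ring.
  apply: le_trans (_ : C2 * (K2 * l `^ (eps / 2)) * (C1 * (2 * l `^ (eps / 6)) *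
     ((4 * E + 2) * l `^ (2 / 3 + eps / 6))) <= _).
    apply: ler_wpM2l => //; apply: ler_wpM2l; first by rewrite !mulr_ge0 ?powR_ge0.
    rewrite [leRHS]mulrDl; apply: lerD; apply: ler_wpM2l; rewrite ?mulr_ge0//.
      by rewrite powR_le_max//; lra.
    by rewrite powR_le_max//; lra.
  rewrite [leLHS](_ : _ = C2 * K2 * (C1 * 2 * (4 * E + 2)) *
     (l `^ (eps / 2) * l `^ (eps / 6) * l `^ (2 / 3 + eps / 6))); last by ring.
  rewrite -[leRHS]mulrA ler_wpM2l ?mulr_ge0// ?addr_ge0// ?mulr_ge0//.
  by rewrite /T -[X in _ <= _ * X](powRr1 (ltW l0)) !lE powR_le_max//; lra.
rewrite -/(A f) split; apply: le_trans (ler_normB _ _) _.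
apply: le_trans (lerD (ler_normD _ _) (lexx _)) _.
apply: le_trans (lerD (lerD P1 P3) P2) _.
rewrite [leRHS](_ : _ = C1 * 4 * T + C2 * K2 * (C1 * 2 * (4 * E + 2)) * T + C1 * E * T + T).
  by rewrite lerDl.
by rewrite /C; ring.
Qed.

End transfer.

(** * Moments of trigonometric polynomials *)

Lemma sum_inj_le (C : numDomainType) (I J : finType) (P : pred I) (Q : pred J)
    (h : I -> J) (F : J -> C) :
  {in P &, injective h} -> (forall i, P i -> Q (h i)) -> (forall j, Q j -> 0 <= F j) ->
  \sum_(i | P i) F (h i) <= \sum_(j | Q j) F j.
Proof.
move=> hi hQ F0; rewrite (partition_big h Q)//=; apply: ler_sum => j Qj.
have [i0 /andP[Pi0 /eqP hj]|H] := pickP (fun i => P i && (h i == j)).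
  rewrite (big_pred1 i0) ?hj// => i /=; apply/andP/eqP => [[Pi /eqP hij]|->]; last by rewrite Pi0 hj.
  by apply: hi; rewrite ?hj.
by rewrite big_pred0// F0.
Qed.

Section fourier.
Variables (C : numFieldType) (N : nat) (w : C).
Hypotheses (N0 : (0 < N)%N) (wN : w ^+ N = 1) (w1 : forall a, ~~ (N %| a)%N -> w ^+ a != 1).
Implicit Types (f : 'I_N -> C) (a n : nat).

Let Nn0 : (N%:R : C) != 0. Proof. by rewrite pnatr_eq0 -lt0n. Qed.

Lemma expw_mod a : w ^+ (a %% N) = w ^+ a.
Proof. by rewrite [in RHS](divn_eq a N) exprD mulnC exprM wN expr1n mul1r. Qed.

Lemma sum_expw a : N%:R^-1 * \sum_(n < N) w ^+ (a * n) = (N %| a)%:R :> C.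
Proof.
case: (boolP (N %| a)%N) => [/dvdnP[q ->]|Na].
  rewrite (eq_bigr (fun _ => 1)) => [|n _].
    by rewrite sumr_const card_ord mulVf.
  by rewrite mulnAC mulnC exprM wN expr1n.
have := subrX1 (w ^+ a) N; rewrite -exprM mulnC exprM wN expr1n subrr => /esym/eqP.
rewrite mulf_eq0 subr_eq0 (negbTE (w1 Na))/= => /eqP E.
by under eq_bigr do rewrite exprM; rewrite E mulr0.
Qed.

Definition ft f n : C := \sum_(a < N) f a * w ^+ (a * n).

Lemma ft_tuple2 k (c : pred 'I_k) (f : 'I_k -> 'I_N -> C) :
  \sum_(a : {ffun 'I_k -> 'I_N} | (N %| \sum_(i | c i) a i)%N && (N %| \sum_(i | ~~ c i) a i)%N)
     \prod_i f i (a i) =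
  (N%:R^-1 * \sum_(n < N) \prod_(i | c i) ft (f i) n) *
  (N%:R^-1 * \sum_(n < N) \prod_(i | ~~ c i) ft (f i) n).
Proof.
transitivity (\sum_(a : {ffun 'I_k -> 'I_N}) (N%:R^-1 * \sum_(n < N) w ^+ ((\sum_(i | c i) a i) * n)) *
  (N%:R^-1 * \sum_(m < N) w ^+ ((\sum_(i | ~~ c i) a i) * m)) * \prod_i f i (a i)).
  rewrite big_mkcond; apply: eq_bigr => a _; rewrite !sum_expw.
  by do 2 case: (N %| _)%N; rewrite ?mul1r ?mul0r ?mulr0.
transitivity (N%:R^-1 * N%:R^-1 * \sum_(n < N) \sum_(m < N)
   \prod_i ft (f i) (if c i then n else m)).
  transitivity (N%:R^-1 * N%:R^-1 * \sum_(a : {ffun 'I_k -> 'I_N}) \sum_(n < N) \sum_(m < N)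
     \prod_i (f i (a i) * w ^+ (a i * (if c i then n else m)))).
    rewrite mulr_sumr; apply: eq_bigr => a _.
    rewrite mulrACA -!mulrA; congr (_ * (_ * _)).
    rewrite mulr_suml mulr_suml; apply: eq_bigr => n _.
    rewrite mulr_sumr; apply: eq_bigr => m _.
    rewrite big_split/= mulrA mulrC; congr (_ * _).
    rewrite [RHS](bigID c)/= !big_distrl/= !expr_sum; congr (_ * _).
      by apply: eq_bigr => i ->.
    by apply: eq_bigr => i /negbTE ->.
  congr (_ * _); rewrite exchange_big/=; apply: eq_bigr => n _.
  rewrite exchange_big/=; apply: eq_bigr => m _.
  by rewrite /ft bigA_distr_bigA.
rewrite mulrACA; congr (_ * _); rewrite big_distrl/=; apply: eq_bigr => n _.
rewrite big_distrr/=; apply: eq_bigr => m _.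
rewrite (bigID c)/=; congr (_ * _); first by apply: eq_bigr => i ->.
by apply: eq_bigr => i /negbTE ->.
Qed.

Lemma ft_tuple k (f : 'I_k -> 'I_N -> C) :
  \sum_(a : {ffun 'I_k -> 'I_N} | (N %| \sum_i a i)%N) \prod_i f i (a i) =
  N%:R^-1 * \sum_(n < N) \prod_i ft (f i) n.
Proof.
have := ft_tuple2 xpredT f; rewrite [X in _ = _ * X](_ : _ = 1); last first.
  by under eq_bigr do rewrite big_pred0_eq; rewrite sumr_const card_ord mulVf.
rewrite mulr1 => <-; apply: eq_bigl => a; by rewrite [X in _ = _ && (_ %| X)%N]big_pred0// dvdn0 andbT.
Qed.

Section moment_recurrence.
Variables (al wt : 'I_N -> C) (W : C).
Hypotheses (alw : forall a : 'I_N, `|al a| <= wt a) (wtW : forall a : 'I_N, wt a <= W).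

Definition ftmoment k : C := N%:R^-1 * \sum_(n < N) ft al n ^+ k.

Definition tupS k : C :=
  \sum_(a : {ffun 'I_k -> 'I_N} | (N %| \sum_i a i)%N) \prod_i wt (a i).

Definition tupU k : C :=
  \sum_(a : {ffun 'I_k.+1 -> 'I_N} | (N %| \sum_i a i)%N &&
     [forall j : 'I_k, ~~ (N %| a ord0 + a (lift ord0 j))%N]) \prod_i wt (a i).

Let wt0 (a : 'I_N) : 0 <= wt a. Proof. exact: le_trans (alw a). Qed.

Let pair0 k (a : {ffun 'I_k.+2 -> 'I_N}) (j : 'I_k.+1) := (N %| a ord0 + a (lift ord0 j))%N.

Lemma pair_moment k (j : 'I_k.+1) :
  \sum_(a : {ffun 'I_k.+2 -> 'I_N} | (N %| \sum_i a i)%N && pair0 a j) \prod_i al (a i) =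
  ftmoment 2 * ftmoment k.
Proof.
pose c : pred 'I_k.+2 := pred2 ord0 (lift ord0 j).
have csum (V : nmodType) (F : 'I_k.+2 -> V) : \sum_(i | c i) F i = F ord0 + F (lift ord0 j).
  rewrite (bigD1 ord0)//=.
  congr (_ + _); rewrite (big_pred1 (lift ord0 j)) => // i.
  by rewrite /c /=; case: (eqVneq i ord0) => [->|_]; rewrite ?andbT ?andbF.
have ccard : #|[pred i | c i]| = 2%N.
  by rewrite -sum1_card; exact: (csum nat (fun=> 1%N)).
have ccard' : #|[pred i | ~~ c i]| = k.
  have := cardC [pred i | c i]; rewrite ccard card_ord add2n => -[] //.
have := ft_tuple2 c (fun=> al).
under [X in _ = _ * X * _]eq_bigr do rewrite prodr_const ccard.
under [X in _ = _ * (_ * X)]eq_bigr do rewrite prodr_const ccard'.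
move=> <-; apply: eq_bigl => a.
have E : (\sum_(i | c i) a i = a ord0 + a (lift ord0 j))%N := csum nat (fun i => a i : nat).
have -> : (\sum_i a i = \sum_(i | c i) a i + \sum_(i | ~~ c i) a i)%N by rewrite (bigID c).
rewrite andbC /pair0 -E; case: (boolP (N %| \sum_(i | c i) a i)%N) => //= H.
by rewrite dvdn_addr.
Qed.

(** If both [a j] and [a l] cancel [a ord0], dropping [a ord0] and [a j] leaves a [k]-tuple of zero
    sum that still contains [a l], hence determines the two dropped entries; these contribute at
    most [W ^+ 2]. *)
Lemma pair2_bound k (j l : 'I_k.+1) : l != j ->
  \sum_(a : {ffun 'I_k.+2 -> 'I_N} | [&& (N %| \sum_i a i)%N, pair0 a j & pair0 a l])
     \prod_i wt (a i) <= W ^+ 2 * tupS k.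
Proof.
move=> lj; have [l' lE] : exists l', l = lift j l' by move: (lj); rewrite eq_sym => /unlift_some[l' -> _]; exists l'.
have W0 : 0 <= W by apply: le_trans (wt0 (Ordinal N0)) (wtW _).
pose h (a : {ffun 'I_k.+2 -> 'I_N}) : {ffun 'I_k -> 'I_N} := [ffun i => a (lift ord0 (lift j i))].
apply: le_trans (_ : \sum_(a : {ffun 'I_k.+2 -> 'I_N} | [&& (N %| \sum_i a i)%N, pair0 a j & pair0 a l])
     W ^+ 2 * \prod_i wt (h a i) <= _).
  apply: ler_sum => a _; rewrite big_ord_recl (bigD1_ord j)//= expr2 mulrA.
  under [X in _ <= _ * X]eq_bigr do rewrite ffunE.
  apply: ler_pM; rewrite ?mulr_ge0 ?prodr_ge0//; first by apply: ler_pM.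
rewrite -mulr_sumr ler_wpM2l ?exprn_ge0//.
apply: (sum_inj_le (F := fun b : {ffun 'I_k -> 'I_N} => \prod_i wt (b i))); last first.
- by move=> b _; apply: prodr_ge0.
- move=> a /and3P[Na aj al']; rewrite (_ : \sum_i h a i = \sum_i a (lift ord0 (lift j i)))%N; last first.
    by apply: eq_bigr => i _; rewrite ffunE.
  move: Na; rewrite big_ord_recl (bigD1_ord j)//= addnA dvdn_addr//.
move=> a b; rewrite !unfold_in => /and3P[_ aj al'] /and3P[_ bj bl] E.
have Eh i : a (lift ord0 (lift j i)) = b (lift ord0 (lift j i)).
  by have := congr1 (fun g : {ffun 'I_k -> 'I_N} => g i) E; rewrite !ffunE.
have cancel (x y u v : 'I_N) : (N %| x + u)%N -> (N %| y + v)%N -> u = v -> x = y.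
  move=> xu yv uv; rewrite uv in xu; apply: val_inj => /=.
  have H : (x + v = y + v %[mod N])%N by rewrite (eqP xu) (eqP yv).
  by move/eqP: H; rewrite eqn_modDr !modn_small// => /eqP.
have E0 : a ord0 = b ord0.
  by apply: (cancel _ _ _ _ al' bl); rewrite lE Eh.
apply/ffunP => i; case: (unliftP ord0 i) => [i' ->|-> //].
case: (unliftP j i') => [i'' ->|->]; first exact: Eh.
by apply: (cancel _ _ (a ord0) (b ord0)); rewrite // addnC.
Qed.

Lemma moment_recurrence k :
  `|ftmoment k.+2 - k.+1%:R * ftmoment 2 * ftmoment k| <=
  tupU k.+1 + (k.+1 ^ 2)%:R * W ^+ 2 * tupS k.
Proof.
(* [cnt a] is the number of entries cancelling [a ord0]. Weighting by [cnt] produces the main term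
   exactly, and [|1 - cnt| <= [cnt = 0] + cnt * (cnt - 1)] leaves the unpaired tuples and those with
   two cancelling entries. *)
pose cnt (a : {ffun 'I_k.+2 -> 'I_N}) : C := \sum_(j < k.+1) (pair0 a j)%:R.
have E1 : ftmoment k.+2 = \sum_(a : {ffun 'I_k.+2 -> 'I_N} | (N %| \sum_i a i)%N) \prod_i al (a i).
  rewrite (ft_tuple (fun=> al)); congr (_ * _); apply: eq_bigr => n _.
  by rewrite prodr_const card_ord.
have E2 : k.+1%:R * ftmoment 2 * ftmoment k =
    \sum_(a : {ffun 'I_k.+2 -> 'I_N} | (N %| \sum_i a i)%N) cnt a * \prod_i al (a i).
  under eq_bigr do rewrite mulr_suml.
  rewrite exchange_big/= -mulrA mulr_natl -[in LHS](card_ord k.+1) -sumr_const.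
  apply: eq_bigr => j _; rewrite -(pair_moment j) big_mkcondr/=; apply: eq_bigr => a _.
  by case: (pair0 a j); rewrite ?mul1r ?mul0r.
rewrite E1 E2 -sumrB; apply: le_trans (ler_norm_sum _ _ _) _.
apply: le_trans (_ : \sum_(a : {ffun 'I_k.+2 -> 'I_N} | (N %| \sum_i a i)%N)
  (([forall j : 'I_k.+1, ~~ (N %| a ord0 + a (lift ord0 j))%N])%:R +
   \sum_(j < k.+1) \sum_(l < k.+1 | l != j) (pair0 a j && pair0 a l)%:R) * \prod_i wt (a i) <= _).
  apply: ler_sum => a _; rewrite -[X in X - _]mul1r -mulrBl normrM.
  apply: ler_pM => //; last first.
    by rewrite normr_prod; apply: ler_prod => i _; rewrite normr_ge0 alw.
  pose s := [set j | pair0 a j].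
  have cE : cnt a = #|s|%:R.
    rewrite /cnt -sumr_const [RHS]big_mkcond; apply: eq_bigr => j _; rewrite inE.
    by case: (pair0 a j).
  have -> : [forall j : 'I_k.+1, ~~ (N %| a ord0 + a (lift ord0 j))%N] = (#|s| == 0)%N.
    rewrite cards_eq0; apply/forallP/eqP => [H|H j].
      by apply/setP => j; rewrite !inE; exact: negbTE (H j).
    by have := in_set0 j; rewrite -H inE /pair0 => ->.
  have -> : \sum_(j < k.+1) \sum_(l < k.+1 | l != j) (pair0 a j && pair0 a l)%:R =
      (#|s| * #|s|.-1)%:R :> C.
    transitivity (\sum_(j in s) #|s|.-1%:R : C); last by rewrite sumr_const -mulrnA mulnC.
    rewrite [RHS]big_mkcond; apply: eq_bigr => j _; rewrite inE.
    case: (boolP (pair0 a j)) => [pj|_]; last by rewrite big1.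
    have js : j \in s by rewrite inE.
    rewrite (cardsD1 j s) js/= add0n -sumr_const big_mkcond [RHS]big_mkcond.
    by apply: eq_bigr => l _; rewrite !inE; case: (l == j) => //=; case: (pair0 a l).
  rewrite cE; case: #|s| => [|[|m]]; rewrite ?subr0 ?normr1 ?mul0n ?addr0// ?subrr ?normr0//.
  rewrite add0r distrC -[X in _ - X]/(1%:R) -natrB// subn1/= normr_nat ler_nat.
  by rewrite leq_pmull.
under eq_bigr do rewrite mulrDl.
rewrite big_split/=; apply: lerD.
  rewrite /tupU big_mkcondr/=; apply: ler_sum => a _.
  by case: ifP; rewrite ?mul1r ?mul0r.
under eq_bigr do rewrite mulr_suml.
rewrite exchange_big/=.
apply: le_trans (_ : \sum_(j < k.+1) \sum_(l < k.+1) W ^+ 2 * tupS k <= _); last first.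
  by rewrite !sumr_const card_ord -mulrnA -[_ *+ _]mulr_natl mulrA mulnn.
have WS : 0 <= W ^+ 2 * tupS k.
  rewrite mulr_ge0 ?exprn_ge0 ?sumr_ge0//; first by apply: le_trans (wt0 (Ordinal N0)) (wtW _).
  by move=> a _; apply: prodr_ge0.
apply: ler_sum => j _; under eq_bigr do rewrite mulr_suml.
rewrite exchange_big/= big_mkcond; apply: ler_sum => l _; case: ifP => [lj|//].
apply: le_trans (pair2_bound lj).
rewrite [leRHS]big_mkcondr/=; apply: ler_sum => a _.
by case: ifP; rewrite ?mul1r ?mul0r.
Qed.

End moment_recurrence.

End fourier.

(** * Fourier expansion of squarefree counts *)

Section root_of_unity.
Variables (R : realType) (N : nat).
Hypothesis N0 : (0 < N)%N.

Let Nr0 : 0 < (N%:R : R). Proof. by rewrite ltr0n. Qed.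
Let Nn0 : (N%:R : R) != 0. Proof. by rewrite gt_eqF. Qed.

Definition ang (a : nat) : R := 2 * pi * a%:R / N%:R.
Definition om : R[i] := (cos (ang 1) +i* sin (ang 1))%C.

Lemma om_exp a : om ^+ a = (cos (ang a) +i* sin (ang a))%C.
Proof.
elim: a => [|a IH]; first by rewrite expr0 /ang mulr0 mul0r cos0 sin0.
rewrite exprS IH /om; have -> : ang a.+1 = ang 1 + ang a.
  by rewrite /ang -[a.+1%:R]natr1; ring.
by rewrite cosD sinD; apply/eqP; rewrite eq_complex /=; apply/andP; split; apply/eqP; ring.
Qed.

Lemma om_N : om ^+ N = 1.
Proof.
rewrite om_exp /ang; have -> : 2 * pi * N%:R / N%:R = pi *+ 2 :> R.
  by rewrite -[RHS]mulr_natl mulfK.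
by rewrite cos2pi sin2pi.
Qed.

Lemma om_neq1 a : ~~ (N %| a)%N -> om ^+ a != 1.
Proof.
move=> Na; rewrite -(expw_mod om_N); set r := (a %% N)%N.
have r0 : (0 < r < N)%N by rewrite ltn_pmod// andbT lt0n.
apply/eqP => E; have := @sum_cos_roots R _ _ r0.
rewrite (eq_bigr (fun _ => 1)) => [|b _].
  by rewrite sumr_const_nat subn0 => /eqP; rewrite pnatr_eq0 => /eqP E0; move: N0; rewrite E0.
have : om ^+ (r * b) = 1 by rewrite exprM E expr1n.
rewrite om_exp => /(congr1 (@Re R)) /=; rewrite /ang natrM => E1.
by rewrite -[RHS]E1; congr cos; ring.
Qed.

Lemma om_dvd a : (N %| a)%N -> om ^+ a = 1.
Proof. by move=> /eqP E; rewrite -(expw_mod om_N) E. Qed.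

Lemma norm_om_exp a : `|om ^+ a| = 1.
Proof. by rewrite om_exp normc_def /= cos2Dsin2 sqrtr1. Qed.

Definition dist0 (a : 'I_N) : nat := minn a (N - a).

Lemma dist0_gt0 (a : 'I_N) : (0 < a)%N -> (0 < dist0 a)%N.
Proof. by move=> a0; rewrite leq_min a0 subn_gt0 ltn_ord. Qed.

Lemma norm_om_sub1 (a : 'I_N) : (4 / 3 * ((dist0 a)%:R / N%:R))%:C%C <= `|om ^+ a - 1|.
Proof.
pose x : R := pi * a%:R / N%:R.
have H : 2 / 3 * ((dist0 a)%:R / N%:R) <= sin x.
  have key b : (2 * b <= N)%N -> 2 / 3 * (b%:R / N%:R) <= sin (pi * b%:R / N%:R) :> R.
    move=> bN; have h : 0 <= pi * b%:R / (N%:R : R) <= pi / 2.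
      rewrite divr_ge0 ?mulr_ge0 ?pi_ge0//= ler_pdivrMr// [leRHS]mulrAC ler_pdivlMr//.
      by rewrite -mulrA ler_wpM2l ?pi_ge0// -natrM ler_nat mulnC.
    apply: le_trans (sin_ge_third h); have := pi_ge2 R.
    have : 0 <= (b%:R / N%:R : R) by rewrite divr_ge0.
    rewrite [X in _ -> _ -> _ <= X](_ : _ = pi / 3 * (b%:R / N%:R)); last by ring.
    by move=> u0 p2; rewrite ler_wpM2r//; lra.
  have aN := ltn_ord a; rewrite /dist0 /minn; case: ltnP => [lt|le].
    by apply: key; lia.
  have -> : sin x = sin (pi * (N - a)%:R / N%:R).
    rewrite natrB ?(ltnW aN)// (_ : _ / N%:R = - x + pi); last first.
      by rewrite /x; move: (pi : R) => p; field.
    by rewrite sinDpi sinN opprK.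
  by apply: key; lia.
have H0 : 0 <= sin x.
  by apply: le_trans H; rewrite mulr_ge0 ?divr_ge0.
rewrite om_exp normc_def /=.
have -> : ang a = x *+ 2 by rewrite /ang /x -[RHS]mulr_natl; ring.
rewrite cos_mulr2n sin_mulr2n lecR.
have c2 := cos2sin2 x.
rewrite [X in Num.sqrt X](_ : _ = (2 * sin x) ^+ 2); last first.
  have -> : cos x ^+ 2 *+ 2 - 1 - 1 = - 2 * sin x ^+ 2 by rewrite c2; ring.
  rewrite oppr0 addr0 exprMn [X in _ + X](_ : _ = 4 * cos x ^+ 2 * sin x ^+ 2); last by ring.
  by rewrite c2; ring.
rewrite sqrtr_sqr ger0_norm ?mulr_ge0//.
by move: (sin x) ((dist0 a)%:R / N%:R : R) H => s d; lra.
Qed.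

Lemma norm_geom (a : 'I_N) h : (0 < a)%N ->
  `|\sum_(1 <= m < h.+1) om ^+ (a * m)| <= (3 / 2 * (N%:R / (dist0 a)%:R))%:C%C.
Proof.
move=> a0; have d0 : 0 < ((dist0 a)%:R : R) by rewrite ltr0n dist0_gt0.
have S1 : `|\sum_(1 <= m < h.+1) om ^+ (a * m)| * `|om ^+ a - 1| <= 2.
  rewrite -normrM (_ : _ * _ = om ^+ a * ((om ^+ a) ^+ h - 1)).
    rewrite normrM norm_om_exp mul1r; apply: le_trans (ler_normB _ _) _.
    by rewrite normr1 -exprM norm_om_exp.
  rewrite (subrX1 (om ^+ a) h) big_add1/= big_mkord mulrCA mulr_sumr mulrC; congr (_ * _).
  by apply: eq_bigr => m _; rewrite mulnS exprD exprM.
have q0 : 0 < 4 / 3 * ((dist0 a)%:R / N%:R) :> R by rewrite mulr_gt0// divr_gt0.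
have := le_trans (ler_wpM2l (normr_ge0 _) (norm_om_sub1 a)) S1.
rewrite -ler_pdivlMr ?ltcR// => /le_trans; apply.
have -> : 2 = (2%:R : R)%:C%C :> R[i] by rewrite rmorph_nat.
rewrite -fmorphV -rmorphM lecR [leLHS](_ : _ = 3 / 2 * (N%:R / (dist0 a)%:R))//.
by move: (dist0 a)%:R (lt0r_neq0 d0) => d dn; field; rewrite Nn0 dn.
Qed.

Definition negI (a : 'I_N) : 'I_N := Ordinal (ltn_pmod (N - a) N0).

Lemma negI_add (a : 'I_N) : (N %| a + negI a)%N.
Proof.
by rewrite /dvdn /= modnDmr subnKC ?modnn// ltnW.
Qed.

Lemma negIK : involutive negI.
Proof.
move=> a; apply: val_inj => /=; have [a0|a0] := posnP a.
  by rewrite a0 subn0 modnn subn0 modnn.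
by rewrite [((N - a) %% N)%N]modn_small ?subKn ?modn_small// ?(ltnW (ltn_ord a))//; lia.
Qed.

Definition even (f : 'I_N -> R) := forall a, f (negI a) = f a.

(** For even [f] the complex transform is this real one, so Cauchy-Schwarz and Finner are only
    needed over [R]. *)
Definition rft (f : 'I_N -> R) (n : nat) : R := \sum_(a < N) f a * cos (ang (a * n)).

Lemma ft_even (f : 'I_N -> R) n : even f ->
  ft om (fun a => (f a)%:C%C) n = (rft f n)%:C%C.
Proof.
move=> ev; have E : ft om (fun a => (f a)%:C%C) n =
    (rft f n +i* \sum_(a < N) f a * sin (ang (a * n)))%C.
  rewrite /ft /rft; elim/big_rec3: _ => // a x y u _ ->.
  by rewrite om_exp; apply/eqP; rewrite eq_complex /=; apply/andP; split; apply/eqP; ring.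
rewrite E; congr (_ +i* _)%C; set s := \sum_(_ < _) _.
have : s = - s.
  rewrite {1}/s (reindex_inj (can_inj negIK)) -sumrN; apply: eq_bigr => a _.
  rewrite ev -mulrN; congr (_ * _).
  have H : om ^+ (a * n) * om ^+ (negI a * n) = 1.
    by rewrite -exprD -mulnDl om_dvd// dvdn_mulr// negI_add.
  move: H; rewrite !om_exp; move: (ang (a * n)) (ang (negI a * n)) => t u H.
  have H2 := congr1 (@Re R) H; have H1 := congr1 (@Im R) H; rewrite /= in H1 H2.
  have E1 := cos2Dsin2 t.
  have -> : sin u = (cos t ^+ 2 + sin t ^+ 2) * sin u by rewrite E1 mul1r.
  have -> : (cos t ^+ 2 + sin t ^+ 2) * sin u =
    cos t * (cos t * sin u + sin t * cos u) - sin t * (cos t * cos u - sin t * sin u) by ring.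
  by rewrite H1 H2; ring.
by move=> h; lra.
Qed.

Lemma real_ft_tuple k (f : 'I_k -> 'I_N -> R) : (forall i, even (f i)) ->
  \sum_(a : {ffun 'I_k -> 'I_N} | (N %| \sum_i a i)%N) \prod_i f i (a i) =
  N%:R^-1 * \sum_(n < N) \prod_i rft (f i) n.
Proof.
move=> ev; apply: (@complexI R).
have := @ft_tuple _ N om N0 om_N om_neq1 k (fun i a => (f i a)%:C%C).
rewrite !(rmorph_sum, rmorphM, fmorphV)/= rmorph_nat => H.
under [LHS]eq_bigr do rewrite rmorph_prod.
rewrite H; congr (_ * _); apply: eq_bigr => n _.
by rewrite rmorph_prod/=; apply: eq_bigr => i _; rewrite ft_even.
Qed.

End root_of_unity.

Lemma sum_multiples (V : nmodType) (F : nat -> V) (M D : nat) : (0 < M)%N ->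
  \sum_(0 <= a < D * M | (M %| a)%N) F a = \sum_(0 <= b < D) F (b * M)%N.
Proof.
case: M => // M _; elim: D => [|D IH]; first by rewrite mul0n !big_geq.
rewrite mulSn addnC (big_cat_nat (n := (D * M.+1)%N))//=; last exact: leq_addr.
rewrite IH big_nat_recr//=; congr (_ + _).
rewrite -{1}[(D * M.+1)%N]add0n big_addn addKn big_ltn_cond//= dvdn_mull//.
rewrite big_nat_cond big1 ?addr0// => a /andP[/andP[a0 aM]].
by rewrite dvdn_addl ?dvdn_mull// gtnNdvd.
Qed.

Section squarefree_fourier.
Variables (R : realType) (z : nat).
Implicit Types (S : {set 'I_z}).

Local Notation N := (np (pr z) ^ 2)%N.
Let N0 : (0 < N)%N := prz_gt0 z.
Local Notation w := (om R N).

Definition sqz (n : nat) : bool := [forall p in pr z, ~~ (p ^ 2 %| n)%N].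

(** As the modulus is the square of a product of distinct primes, [p] divides the reduced
    denominator of [a] over the modulus exactly when [p ^ 2] does not divide [a]. So [np (rs a)] is
    the radical of that denominator. *)
Definition rs (a : nat) : {set 'I_z} := [set p in pr z | ~~ (p ^ 2 %| a)%N].

Lemma rs_sub a : rs a \subset pr z.
Proof. by apply/subsetP => p; rewrite inE => /andP[]. Qed.

Lemma npC S : S \subset pr z -> N = (np (pr z :\: S) ^ 2 * np S ^ 2)%N.
Proof. by move=> sS; rewrite -expnMn (npID _ S) (setIidPr sS) mulnC. Qed.

Lemma rs_dvd a S : S \subset pr z -> (np (pr z :\: S) ^ 2 %| a)%N = (rs a \subset S).
Proof.
move=> sS; rewrite np_dvdn_exp ?subsetDl//; apply/'forall_implyP/subsetP => [H p|H p].
  rewrite inE => /andP[pp pa]; apply: contraNT pa => pS; apply: H.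
  by rewrite inE pS.
rewrite inE => /andP[pS pp]; apply: contraNT pS => pa; apply: H.
by rewrite inE pp.
Qed.

Lemma sqzE n :
  (sqz n)%:R = \sum_(S : {set 'I_z} | S \subset pr z) (-1) ^+ #|S| * (np S ^ 2 %| n)%:R :> R.
Proof.
pose B : {set 'I_z} := [set p in pr z | (p ^ 2 %| n)%N].
have -> : sqz n = (B == set0).
  apply/'forall_implyP/eqP => [H|H p pp].
    by apply/setP => p; rewrite in_set in_set0; apply/negP => /andP[/H/negP].
  by apply/negP => pn; have := in_set0 p; rewrite -H in_set pp pn.
rewrite -sum_sign_subsets big_mkcond [RHS]big_mkcond; apply: eq_bigr => S _.
case: (boolP (S \subset pr z)) => sS; last first.
  by case: ifP => // sB; case/negP: sS; apply: subset_trans sB _; apply/subsetP => p; rewrite in_set => /andP[].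
rewrite np_dvdn_exp//; case: 'forall_implyP => [H|H].
  rewrite mulr1 ifT//; apply/subsetP => p pS; rewrite in_set (subsetP sS)//=; exact: H.
rewrite mulr0 ifF//; apply/negP => /subsetP sB; apply: H => p /sB.
by rewrite in_set => /andP[].
Qed.

(* The Fourier coefficients of the indicator function [sqz]. *)
Definition gam (a : nat) : R :=
  \sum_(S : {set 'I_z} | (S \subset pr z) && (rs a \subset S)) (-1) ^+ #|S| * ((np S)%:R ^+ 2)^-1.

(** With [D = np S ^ 2], the indicator of [D %| n] is the average of the characters of order
    dividing [D]; their frequencies are the multiples of [N / D], that is, those with
    [rs a \subset S]. *)
Lemma dvd_fourier S n : S \subset pr z ->
  (np S ^ 2 %| n)%:R = \sum_(a < N | (rs a \subset S)) ((np S)%:R ^+ 2)^-1 * w ^+ (a * n) :> R[i].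
Proof.
move=> sS; set M := (np (pr z :\: S) ^ 2)%N; set D := (np S ^ 2)%N.
have M0 : (0 < M)%N by rewrite expn_gt0 np_gt0// subsetDl.
have D0 : (0 < D)%N by rewrite expn_gt0 np_gt0.
have NE : N = (D * M)%N by rewrite (npC sS) mulnC.
under eq_bigl do rewrite -rs_dvd//.
rewrite -mulr_sumr -(big_mkord (fun a => (M %| a)%N) (fun a => w ^+ (a * n))).
rewrite {1}NE sum_multiples// big_mkord.
have E b : w ^+ (b * M * n) = (w ^+ M) ^+ (n * b) by rewrite -exprM (mulnC b) -mulnA (mulnC b).
under eq_bigr do rewrite E.
have wD : (w ^+ M) ^+ D = 1 by rewrite -exprM mulnC -NE om_N.
have w1 b : ~~ (D %| b)%N -> (w ^+ M) ^+ b != 1.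
  move=> Db; rewrite -exprM om_neq1// NE [(M * b)%N]mulnC dvdn_pmul2r//.
have Dn : (np S)%:R ^+ 2 = D%:R :> R[i] by rewrite natrX.
by rewrite Dn (sum_expw D0 wD w1).
Qed.

Lemma sqz_fourier n : (sqz n)%:R = ft w (fun a : 'I_N => (gam a)%:C%C) n :> R[i].
Proof.
have -> : (sqz n)%:R = ((sqz n)%:R : R)%:C%C by rewrite rmorph_nat.
rewrite sqzE rmorph_sum/= /ft.
under [RHS]eq_bigr do rewrite rmorph_sum/= mulr_suml big_mkcondr/=.
rewrite [RHS]exchange_big/=; apply: eq_bigr => S sS.
rewrite rmorphM rmorph_nat dvd_fourier// mulr_sumr big_mkcond; apply: eq_bigr => a _.
case: ifP => // _; rewrite rmorphM mulrA; congr (_ * _ * _).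
by rewrite fmorphV rmorphXn rmorph_nat.
Qed.

Lemma sum_np_inv_sqr : \sum_(S : {set 'I_z} | S \subset pr z) ((np S)%:R ^+ 2)^-1 <= 2 :> R.
Proof.
have := @sum_np_le R z xpredT (fun n => (n%:R ^+ 2)^-1) (np (pr z)).+1.
move=> H; apply: (@le_trans _ _ (\sum_(1 <= n < (np (pr z)).+1) (n%:R ^+ 2)^-1)); last exact: sum_inv_sqr.
apply: le_trans (H _ _).
- by rewrite le_eqVlt; apply/orP; left; apply/eqP; apply: eq_bigl => S; rewrite andbT.
- by move=> n; rewrite invr_ge0 exprn_ge0.
- by move=> S sS _; exact: np_lt_bound.
Qed.

Lemma gam_le a : `|gam a| <= 2 / (np (rs a))%:R ^+ 2.
Proof.
apply: le_trans (ler_norm_sum _ _ _) _.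
apply: le_trans (_ : \sum_(S : {set 'I_z} | (S \subset pr z) && (rs a \subset S))
   ((np (rs a))%:R ^+ 2)^-1 * ((np (S :\: rs a))%:R ^+ 2)^-1 <= _).
  apply: ler_sum => S /andP[sS aS]; rewrite normrM normrX normrN1 expr1n mul1r.
  rewrite ger0_norm ?invr_ge0 ?exprn_ge0// (npID S (rs a)) (setIidPr aS) natrM exprMn invfM//.
rewrite -mulr_sumr mulrC ler_wpM2r ?invr_ge0 ?exprn_ge0//.
apply: le_trans sum_np_inv_sqr.
apply: (sum_inj_le (F := fun S : {set 'I_z} => ((np S)%:R ^+ 2)^-1 : R) (h := fun S => S :\: rs a)).
- move=> S T; rewrite !unfold_in => /andP[_ aS] /andP[_ aT] E.
  by rewrite -(setID S (rs a)) E (setIidPr aS) -{1}(setIidPr aT) setID.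
- by move=> S /andP[sS _]; rewrite (subset_trans _ sS)// subsetDl.
- by move=> S _; rewrite invr_ge0 exprn_ge0.
Qed.

Definition dens : R := pavg z (fun n => (sqz n)%:R).

Definition dev (h n : nat) : R := \sum_(1 <= m < h.+1) (sqz (n + m))%:R - h%:R * dens.

Definition al (h : nat) (a : 'I_N) : R[i] :=
  if a == 0%N :> nat then 0 else (gam a)%:C%C * \sum_(1 <= m < h.+1) w ^+ (a * m).

(** A majorant of [al]: the coefficient is [O(r^-2)] with [r] the radical, and the geometric sum is
    at most [h] and at most a multiple of [N / dist0 a]. The zero frequency is absent because the
    mean has been subtracted. *)
Definition wt (h : nat) (a : 'I_N) : R :=
  if a == 0%N :> nat then 0 else
  3 * Num.min (h%:R / (np (rs a))%:R ^+ 2) (N%:R / ((np (rs a))%:R ^+ 2 * (dist0 a)%:R)).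

Lemma dens_gam : (dens%:C)%C = (gam 0)%:C%C :> R[i].
Proof.
rewrite /dens /pavg rmorphM fmorphV rmorph_nat rmorph_sum/= big_mkord.
under eq_bigr do rewrite rmorph_nat sqz_fourier.
rewrite exchange_big/= mulr_suml (bigD1 (Ordinal N0))//= [X in _ + X]big1 ?addr0.
  under eq_bigr do rewrite mul0n expr0 mulr1.
  by rewrite sumr_const card_ord -[_ *+ _]mulr_natr mulfK// pnatr_eq0 -lt0n.
move=> a a0; rewrite -mulr_sumr -mulrA [X in _ * X]mulrC (sum_expw N0 (@om_N R _ N0) (@om_neq1 R _ N0)).
by rewrite gtnNdvd ?mulr0// lt0n; apply: contraNneq a0 => E; apply/eqP/val_inj.
Qed.

Lemma dev_fourier h n : ft w (al h) n = (dev h n)%:C%C.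
Proof.
rewrite /dev rmorphB rmorphM rmorph_nat rmorph_sum/= dens_gam.
under [in RHS]eq_bigr do rewrite rmorph_nat sqz_fourier /ft (bigD1 (Ordinal N0))//= mul0n expr0 mulr1.
rewrite big_split/= sumr_const_nat subn1/= mulr_natl [X in _ = X - _]addrC addrK.
rewrite /ft (bigD1 (Ordinal N0))//= {1}/al eqxx mul0r add0r exchange_big/=.
apply: eq_bigr => a a0; rewrite /al ifN; last first.
  by apply: contraNneq a0 => E; apply/eqP/val_inj.
rewrite -mulrA -mulr_sumr; congr (_ * _); rewrite mulr_suml; apply: eq_bigr => m _.
by rewrite -exprD mulnDr addnC.
Qed.

Lemma dev_moment h k : ftmoment w (al h) k = (pavg z (fun n => dev h n ^+ k))%:C%C.
Proof.
rewrite /ftmoment /pavg [RHS]rmorphM [in RHS]fmorphV rmorph_nat rmorph_sum/= big_mkord mulrC; congr (_ * _).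
by apply: eq_bigr => n _; rewrite dev_fourier rmorphXn.
Qed.

Lemma al_le h (a : 'I_N) : `|al h a| <= (wt h a)%:C%C.
Proof.
rewrite /al /wt; case: ifPn => a0; first by rewrite normr0.
have ap : (0 < a)%N by rewrite lt0n.
have r0 : 0 < ((np (rs a))%:R : R) by rewrite ltr0n np_gt0// rs_sub.
have d0 : 0 < ((dist0 a)%:R : R) by rewrite ltr0n dist0_gt0.
have g0 : 0 <= 2 / (np (rs a))%:R ^+ 2 :> R by rewrite divr_ge0// exprn_ge0// ltW.
have gC : `|(gam a)%:C%C| <= (2 / (np (rs a))%:R ^+ 2)%:C%C.
  by rewrite normc_def /= expr0n addr0 sqrtr_sqr lecR gam_le.
have E1 : `|\sum_(1 <= m < h.+1) w ^+ (a * m)| <= (h%:R)%:C%C.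
  apply: le_trans (ler_norm_sum _ _ _) _; under eq_bigr do rewrite norm_om_exp.
  by rewrite sumr_const_nat subn1/= rmorph_nat.
have E2 := norm_geom R N0 h ap.
rewrite normrM minr_pMr// /Num.min; case: ifP => _.
  apply: le_trans (ler_pM _ _ gC E1) _; rewrite ?normr_ge0// -rmorphM lecR.
  rewrite [leRHS](_ : _ = 3 / (np (rs a))%:R ^+ 2 * h%:R); last by ring.
  by rewrite ler_wpM2r// ler_wpM2r ?invr_ge0 ?exprn_ge0 ?(ltW r0)//; lra.
apply: le_trans (ler_pM _ _ gC E2) _; rewrite ?normr_ge0// -rmorphM lecR.
rewrite le_eqVlt; apply/orP; left; apply/eqP.
by move: (lt0r_neq0 r0) (lt0r_neq0 d0); move: (np _)%:R (dist0 a)%:R (N%:R) => r d n rn dn; field; rewrite ?rn ?dn.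
Qed.

End squarefree_fourier.

(** * Bounds for sums over tuples of frequencies *)

Section cauchy_schwarz.
Variable R : realType.

Lemma sum_cauchy_schwarz (I : Type) (r : seq I) (P : pred I) (f g : I -> R) :
  \sum_(i <- r | P i) f i * g i <=
  Num.sqrt (\sum_(i <- r | P i) f i ^+ 2) * Num.sqrt (\sum_(i <- r | P i) g i ^+ 2).
Proof.
set c := \sum_(i <- r | P i) f i * g i; set a := \sum_(i <- r | P i) f i ^+ 2.
set b := \sum_(i <- r | P i) g i ^+ 2.
have a0 : 0 <= a by apply: sumr_ge0 => i _; rewrite sqr_ge0.
have b0 : 0 <= b by apply: sumr_ge0 => i _; rewrite sqr_ge0.
suff cab : c ^+ 2 <= a * b.
  rewrite -sqrtrM//; apply: le_trans (ler_norm c) _.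
  by rewrite -sqrtr_sqr ler_wsqrtr.
have H t : 0 <= a - 2 * t * c + t ^+ 2 * b.
  have -> : a - 2 * t * c + t ^+ 2 * b = \sum_(i <- r | P i) (f i - t * g i) ^+ 2.
    rewrite /a /b /c !mulr_sumr -sumrB -big_split/=; apply: eq_bigr => i _; ring.
  by apply: sumr_ge0 => i _; rewrite sqr_ge0.
have [b00|bn0] := eqVneq b 0; last first.
  have bp : 0 < b by rewrite lt_neqAle eq_sym bn0.
  have := H (c / b); rewrite (_ : _ + _ = (a * b - c ^+ 2) / b); last by field.
  by rewrite pmulr_lge0 ?invr_gt0// subr_ge0.
have [c0|cn0] := eqVneq c 0; first by rewrite c0 expr0n mulr_ge0.
have := H ((a + 1) / (2 * c)); rewrite b00 mulr0 addr0.
have -> : 2 * ((a + 1) / (2 * c)) * c = a + 1 by field.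
by rewrite opprD addrA subrr sub0r oppr_ge0 ler10.
Qed.

(** Cauchy-Schwarz on two of the factors; every other factor is bounded pointwise by its l2 norm.
    This is why two factors are required. *)
Lemma sum_prod_le (I : eqType) (r : seq I) (J : finType) (c : pred J) (A : J -> I -> R) :
  (forall j x, 0 <= A j x) -> (1 < #|c|)%N ->
  \sum_(x <- r) \prod_(j | c j) A j x <= \prod_(j | c j) Num.sqrt (\sum_(x <- r) A j x ^+ 2).
Proof.
move=> A0 /card_gt1P[i [j [ci cj ij]]].
rewrite (bigD1 i)//= (bigD1 j)/=; last by rewrite eq_sym ij andbT.
under eq_bigr do rewrite (bigD1 i)//= (bigD1 j)/= ?(eq_sym j) ?ij ?andbT//.
set B := \prod_(_ | _) Num.sqrt _.
have B0 : 0 <= B by apply: prodr_ge0 => l _; rewrite sqrtr_ge0.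
elim: r @B B0 => [|x0 r _] B B0.
  by rewrite !big_nil mulr_ge0 ?sqrtr_ge0// mulr_ge0// sqrtr_ge0.
apply: le_trans (_ : \sum_(x <- x0 :: r) A i x * (A j x * B) <= _); last first.
  have E : \sum_(x <- x0 :: r) A i x * (A j x * B) = (\sum_(x <- x0 :: r) A i x * A j x) * B.
    by rewrite mulr_suml; apply: eq_bigr => x _; rewrite mulrA.
  by rewrite E [leRHS]mulrA ler_wpM2r// sum_cauchy_schwarz.
rewrite !big_seq; apply: ler_sum => x xr; rewrite ler_wpM2l// ler_wpM2l//.
apply: ler_prod => l _; rewrite A0/=.
have -> : A l x = Num.sqrt (A l x ^+ 2) by rewrite sqrtr_sqr ger0_norm.
apply: ler_wsqrtr; rewrite (big_rem x)//= lerDl; apply: sumr_ge0 => y _; exact: sqr_ge0.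
Qed.

End cauchy_schwarz.

Section finner.
Variable R : realType.

Lemma sum_crt_chinese (a b : nat) (G : nat -> R) : (0 < a)%N -> (0 < b)%N -> coprime a b ->
  per (a * b) G ->
  \sum_(0 <= n < a * b) G n = \sum_(0 <= x < a) \sum_(0 <= y < b) G (chinese a b x y).
Proof.
move=> a0 b0 ab pG; rewrite -(sum_crt (fun x y => G (chinese a b x y)))//.
apply: eq_bigr => n _; apply: pG; apply/eqP; rewrite chinese_remainder//.
by rewrite chinese_modl// chinese_modr// !modn_mod !eqxx.
Qed.

(* A Finner-type inequality: Cauchy-Schwarz prime by prime. *)
Lemma finner z (U : {set 'I_z}) (k : nat) (T : 'I_k -> {set 'I_z}) (F : 'I_k -> nat -> R) :
  U \subset pr z -> (forall i, T i \subset U) -> (forall i n, 0 <= F i n) ->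
  (forall i, per (np (T i) ^ 2) (F i)) ->
  (forall p, p \in U -> (1 < #|[pred i | p \in T i]|)%N) ->
  \sum_(0 <= n < np U ^ 2) \prod_i F i n <=
  \prod_i Num.sqrt (\sum_(0 <= n < np (T i) ^ 2) F i n ^+ 2).
Proof.
move: {2}#|U| (erefl #|U|) => m; elim: m U T F => [|m IH] U T F cU sU TU F0 pF cov.
  move/eqP: cU; rewrite cards_eq0 => /eqP U0.
  rewrite U0 np0 exp1n big_nat1; apply: ler_prod => i _; rewrite F0/=.
  have -> : T i = set0 by apply/eqP; rewrite -subset0 -U0.
  by rewrite np0 exp1n big_nat1 sqrtr_sqr ger0_norm.
have /card_gt0P[p pU] : (0 < #|U|)%N by rewrite cU.
have pp := pr_prime sU pU.
have sU' : U :\ p \subset pr z by rewrite (subset_trans _ sU) ?subD1set.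
have sTp i : T i :\ p \subset U :\ p by exact: setSD.
pose q := (p ^ 2)%N; pose M := (np (U :\ p) ^ 2)%N; pose mm i := (np (T i :\ p) ^ 2)%N.
have q0 : (0 < q)%N by rewrite expn_gt0 prime_gt0.
have M0 : (0 < M)%N by rewrite expn_gt0 np_gt0.
have m0 i : (0 < mm i)%N by rewrite expn_gt0 np_gt0// (subset_trans (sTp i)).
have copS (S : {set 'I_z}) : S \subset U :\ p -> coprime q (np S ^ 2).
  move=> sS; rewrite coprimeXl ?coprimeXr// coprime_np ?(subset_trans sS)//.
  by apply: contraTN isT => /(subsetP sS); rewrite !inE eqxx.
have cqM := copS _ (subxx _).
have cqm i := copS _ (sTp i).
have mM i : (mm i %| M)%N by rewrite dvdn_exp2r// np_sub.
have NU : (np U ^ 2 = q * M)%N by rewrite (npD1 pU) expnMn.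
have NTin i : p \in T i -> (np (T i) ^ 2 = q * mm i)%N by move=> pT; rewrite (npD1 pT) expnMn.
have NTout i : p \notin T i -> (np (T i) ^ 2 = mm i)%N.
  by move=> pT; rewrite /mm (_ : T i :\ p = T i)//; apply/setDidPl; rewrite disjoint_sym disjoints1.
have perq i : per (q * mm i) (F i).
  apply: per_dvd (pF i); case: (boolP (p \in T i)) => [/NTin ->//|/NTout ->].
  exact: dvdn_mull.
pose chi := chinese q M.
have chiq x y : chi x y = x %[mod q] by exact: chinese_modl.
have chiM x y : chi x y = y %[mod M] by exact: chinese_modr.
have chim i x y : chi x y = y %[mod mm i].
  by rewrite -(modn_dvdm _ (mM i)) chiM modn_dvdm.
(* [A i x] is the l2 norm of [F i] on the residues congruent to [x] modulo [p ^ 2]. It is constant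
   in [x] unless [p] belongs to [T i], so after the induction hypothesis only the factors with
   [p \in T i] enter the sum over [x]. *)
pose A i x := Num.sqrt (\sum_(0 <= y < mm i) F i (chi x y) ^+ 2).
pose B i := Num.sqrt (\sum_(0 <= n < np (T i) ^ 2) F i n ^+ 2).
have A0 i x : 0 <= A i x by exact: sqrtr_ge0.
rewrite NU sum_crt_chinese//; last first.
  move=> n n' nn; apply: eq_bigr => i _; apply: (per_dvd _ (pF i)) nn.
  by rewrite -NU dvdn_exp2r// np_sub.
apply: le_trans (_ : \sum_(0 <= x < q) \prod_i A i x <= _).
  apply: ler_sum => x _.
  apply: (IH (U :\ p) (fun i => T i :\ p) (fun i y => F i (chi x y))) => //.
  - by have := cardsD1 p U; rewrite cU pU add1n => -[].
  - move=> i y y' yy; apply: perq; apply/eqP; rewrite chinese_remainder ?cqm//.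
    by rewrite !chiq eqxx/= !chim; apply/eqP.
  - move=> p'; rewrite !inE => /andP[p'p p'U]; apply: leq_trans (cov _ p'U) _.
    by apply: eq_leq; apply: eq_card => i; rewrite !inE p'p.
have Aout i x : p \notin T i -> A i x = B i.
  move=> pT; rewrite /A /B NTout//; congr Num.sqrt; apply: eq_bigr => y _.
  by congr (_ ^+ 2); apply: (pF i); rewrite NTout// chim.
have Ain i : p \in T i -> Num.sqrt (\sum_(0 <= x < q) A i x ^+ 2) = B i.
  move=> pT; rewrite /B NTin// (@sum_crt_chinese q (mm i)) ?cqm//; last first.
    by move=> n n' nn; congr (_ ^+ 2); exact: perq.
  congr Num.sqrt; apply: eq_bigr => x _; rewrite /A sqr_sqrtr ?sumr_ge0//; last first.
    by move=> y _; rewrite sqr_ge0.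
  apply: eq_bigr => y _; congr (_ ^+ 2); apply: perq; apply/eqP.
  by rewrite chinese_remainder ?cqm// chiq chim (chinese_modl (cqm i)) (chinese_modr (cqm i)) !eqxx.
rewrite -/(B _) [leRHS](bigID (fun i => p \in T i))/= mulrC.
under eq_bigr do rewrite (bigID (fun i => p \in T i))/= mulrC.
under eq_bigr => x _ do under eq_bigr => i pT do rewrite Aout//.
rewrite -mulr_sumr ler_wpM2l//; first by apply: prodr_ge0 => i _; exact: sqrtr_ge0.
apply: le_trans (sum_prod_le _ A0 (cov p pU)) _.
by rewrite le_eqVlt; apply/orP; left; apply/eqP; apply: eq_bigr => i pT; rewrite Ain.
Qed.

End finner.

(** * Weights of reduced fractions grouped by radical *)

Section weights.
Variables (R : realType) (z : nat).
Implicit Types (S : {set 'I_z}).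

Local Notation N := (np (pr z) ^ 2)%N.
Let N0 : (0 < N)%N := prz_gt0 z.

(* For [a != 0], writing [a / N] as a reduced fraction modulo 1 in ]-1/2, 1/2] gives
   [+- bb a / np (rs a) ^ 2]. *)
Definition cof (a : nat) : nat := (np (pr z :\: rs z a) ^ 2)%N.
Definition bb (a : 'I_N) : nat := (dist0 a %/ cof a)%N.

Lemma cof_gt0 a : (0 < cof a)%N.
Proof. by rewrite expn_gt0 np_gt0// subsetDl. Qed.

Lemma N_cof a : N = (cof a * np (rs z a) ^ 2)%N.
Proof. exact: npC (rs_sub z a). Qed.

Lemma dvdn_cof a : (cof a %| a)%N.
Proof. by rewrite /cof rs_dvd// rs_sub. Qed.

Lemma dist0_bb (a : 'I_N) : dist0 a = (bb a * cof a)%N.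
Proof.
rewrite /bb divnK// /dist0 /minn; case: ifP => _; first exact: dvdn_cof.
by rewrite dvdn_sub ?dvdn_cof// {2}(N_cof a) dvdn_mulr.
Qed.

Lemma bb_gt0 (a : 'I_N) : (0 < a)%N -> (0 < bb a)%N.
Proof. by move=> /dist0_gt0; rewrite dist0_bb; case: (bb a). Qed.

Lemma bb_le (a : 'I_N) : (bb a <= np (rs z a) ^ 2)%N.
Proof.
rewrite -(leq_pmul2r (cof_gt0 a)) -dist0_bb mulnC -N_cof.
by rewrite (leq_trans (geq_minl _ _))// ltnW.
Qed.

Lemma rs_gt0 (a : nat) : 0 < ((np (rs z a))%:R : R).
Proof. by rewrite ltr0n np_gt0// rs_sub. Qed.

Lemma wtE h (a : 'I_N) : (0 < a)%N ->
  wt R h a = 3 * Num.min (h%:R / (np (rs z a))%:R ^+ 2) ((bb a)%:R^-1).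
Proof.
move=> a0; rewrite /wt gtn_eqF//; congr (3 * Num.min _ _).
have c0 : 0 < ((cof a)%:R : R) by rewrite ltr0n cof_gt0.
have b0 : 0 < ((bb a)%:R : R) by rewrite ltr0n bb_gt0.
have -> : (N%:R : R) = (cof a)%:R * (np (rs z a))%:R ^+ 2 by rewrite -natrX -natrM -N_cof.
rewrite dist0_bb natrM.
by move: (rs_gt0 a) c0 b0 => /lt0r_neq0 ? /lt0r_neq0 ? /lt0r_neq0 ?; field; apply/and3P.
Qed.

Lemma wt_ge0 h (a : 'I_N) : 0 <= wt R h a.
Proof.
have [a0|a0] := posnP a; first by rewrite /wt a0.
by rewrite wtE// mulr_ge0// le_min divr_ge0 ?exprn_ge0//= invr_ge0.
Qed.

Lemma wt_le_bb h (a : 'I_N) : wt R h a <= 3 / (bb a)%:R.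
Proof.
have [a0|a0] := posnP a; first by rewrite /wt a0/= mulr_ge0// invr_ge0.
by rewrite wtE// ler_wpM2l// ge_min lexx orbT.
Qed.

Lemma wt_le3 h (a : 'I_N) : wt R h a <= 3.
Proof.
apply: le_trans (wt_le_bb h a) _; rewrite ler_piMr//.
by case: (bb a) => [|b]; rewrite ?invr0// invf_le1 ?ler1n.
Qed.

Lemma rs_negI (a : 'I_N) : rs z (negI N0 a) = rs z a.
Proof.
apply/setP => p; rewrite ![_ \in rs _ _]in_set; case: (boolP (p \in pr z)) => //= pp; congr (~~ _).
have pN : (p ^ 2 %| N)%N by rewrite dvdn_exp2r// (npD1 pp) dvdn_mulr.
rewrite /= [LHS](_ : _ = (p ^ 2 %| N - a)%N); last by rewrite /dvdn modn_dvdm.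
by apply/idP/idP => d; [rewrite -(subKn (ltnW (ltn_ord a)))|]; exact: dvdn_sub.
Qed.

Lemma dist0_negI (a : 'I_N) : dist0 (negI N0 a) = dist0 a.
Proof.
rewrite /dist0 /=; have [a0|a0] := posnP a; first by rewrite a0 subn0 modnn subn0.
rewrite modn_small; last by rewrite ltn_subrL a0.
by rewrite subKn 1?minnC// ltnW.
Qed.

Lemma wt_even h : even N0 (wt R h).
Proof.
move=> a; rewrite /wt rs_negI dist0_negI; congr (if _ then _ else _).
have [a0|a0] := posnP a; first by rewrite /= a0 subn0 modnn.
rewrite /= modn_small ?ltn_subrL ?a0//.
by rewrite subn_eq0 leqNgt ltn_ord; case: (nat_of_ord a) a0.
Qed.

(** The sign that [dist0] forgets: radical, sign and numerator [bb] together determine the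
    fraction. *)
Definition half (a : 'I_N) : bool := (a <= N - a)%N.

Lemma rep_inj (a b : 'I_N) : rs z a = rs z b -> half a = half b -> bb a = bb b -> a = b.
Proof.
move=> rab hab bab.
have : dist0 a = dist0 b by rewrite !dist0_bb bab /cof rab.
move: hab (ltn_ord a) (ltn_ord b); rewrite /half /dist0 => hab aN bN dab; apply: val_inj => /=.
by move: hab aN bN dab; clear; move: N (a : nat) (b : nat) => M x y; lia.
Qed.

Lemma sum_min_sqr (x : R) n : 0 < x ->
  \sum_(1 <= b < n.+1) Num.min x (b%:R^-1) ^+ 2 <= 3 * x.
Proof.
move=> x0; have m0 b : 0 <= Num.min x (b%:R^-1) by rewrite le_min ltW//= invr_ge0.
have minV b : Num.min x (b%:R^-1) ^+ 2 <= (b%:R ^+ 2)^-1.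
  by rewrite -exprVn ler_pXn2r ?nnegrE// ?invr_ge0// ge_min lexx orbT.
have [x1|x1] := leP 1 x.
  apply: le_trans (_ : \sum_(1 <= b < n.+1) (b%:R ^+ 2)^-1 <= _); first exact: ler_sum.
  by apply: le_trans (sum_inv_sqr _) _; move: x1; clear; lra.
pose B := Num.truncn x^-1.
have xV1 : 1 <= x^-1 by rewrite invf_ge1// ltW.
have /andP[Bx xB] : (B%:R : R) <= x^-1 < B.+1%:R.
  by rewrite truncn_itv// (le_trans ler01).
have B0 : (0 < B)%N by rewrite truncn_gt0.
have Br : 0 < (B%:R : R) by rewrite ltr0n.
have BV : (B%:R)^-1 <= 2 * x.
  rewrite -ler_pdivrMl// -invfM -[leRHS]invrK lef_pV2 ?posrE ?invr_gt0 ?mulr_gt0//.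
  rewrite (le_trans (ltW xB))// -natr1; have : 1 <= (B%:R : R) by rewrite ler1n.
  by move: (B%:R : R) => u; lra.
apply: le_trans (_ : \sum_(1 <= b < (maxn B n).+1) Num.min x (b%:R^-1) ^+ 2 <= _).
  rewrite [leRHS](big_cat_nat (n := n.+1))//= ?ltnS ?leq_maxr// lerDl.
  by apply: sumr_ge0 => b _; rewrite sqr_ge0.
rewrite (big_cat_nat (n := B.+1))//= ?ltnS ?leq_maxl//.
rewrite (_ : 3 * x = x + 2 * x); last by ring.
apply: lerD.
  apply: le_trans (_ : \sum_(1 <= b < B.+1) x ^+ 2 <= _).
    by apply: ler_sum => b _; rewrite ler_pXn2r ?nnegrE// ?(ltW x0)// ge_min lexx.
  rewrite sumr_const_nat subn1/= -[_ *+ _]mulr_natr expr2 -mulrA ger_pMr//.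
  by rewrite mulrC -ler_pdivlMr// mul1r.
apply: le_trans (_ : \sum_(B.+1 <= b < (maxn B n).+1) (b%:R ^+ 2)^-1 <= _); first exact: ler_sum.
exact: le_trans (sum_inv_sqr_gt _ B0) BV.
Qed.

Lemma sum_rs_le S (F : nat -> R) : (forall b, 0 <= F b) ->
  \sum_(a < N | (0 < a)%N && (rs z a == S)) F (bb a) <= 2 * \sum_(1 <= b < N.+1) F b.
Proof.
move=> F0; have bN (a : 'I_N) : (bb a < N.+1)%N.
  rewrite ltnS (leq_trans (leq_div _ _))//.
  by rewrite (leq_trans (geq_minl _ _))// ltnW.
pose r (a : 'I_N) : bool * 'I_N.+1 := (half a, Ordinal (bN a)).
have H := @sum_inj_le R _ _ (fun a : 'I_N => (0 < a)%N && (rs z a == S))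
  (fun u : bool * 'I_N.+1 => (0 < u.2)%N) r (fun u => F u.2).
apply: le_trans (H _ _ _) _.
- move=> a b; rewrite !unfold_in => /andP[_ /eqP ra] /andP[_ /eqP rb] [hab bab].
  by apply: rep_inj => //; rewrite ra rb.
- by move=> a /andP[a0 _]; rewrite /= bb_gt0.
- by move=> u _.
rewrite -(pair_big xpredT (fun b : 'I_N.+1 => (0 < b)%N) (fun _ b => F b))/=.
rewrite sumr_const card_bool mulr_natl.
rewrite le_eqVlt; apply/orP; left; apply/eqP; congr (_ *+ _).
rewrite -(big_mkord (fun b => (0 < b)%N) F) big_ltn_cond//= big_nat_cond [RHS]big_nat_cond.
by apply: eq_bigl => b; case: b => [|b]; rewrite ?andbF ?andbT.
Qed.

Lemma wt_l2 h S : \sum_(a < N | rs z a == S) wt R h a ^+ 2 <= 36.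
Proof.
rewrite (bigID (fun a : 'I_N => (0 < a)%N))/= [X in _ + X]big1 ?addr0; last first.
  by move=> a /andP[_]; rewrite -eqn0Ngt /wt => ->; rewrite expr0n.
apply: le_trans (_ : \sum_(a < N | (0 < a)%N && (rs z a == S)) 9 * (((bb a)%:R : R) ^+ 2)^-1 <= _).
  rewrite [leLHS](eq_bigl (fun a : 'I_N => (0 < a)%N && (rs z a == S))); last first.
    by move=> a; rewrite andbC.
  apply: ler_sum => a _; rewrite (_ : 9 * _ = (3 / (bb a)%:R) ^+ 2); last first.
    by rewrite exprMn exprVn; congr (_ * _); ring.
  by rewrite ler_pXn2r ?nnegrE ?wt_ge0 ?wt_le_bb// mulr_ge0// invr_ge0.
rewrite -mulr_sumr (_ : 36 = 9 * (2 * 2)); last by ring.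
rewrite ler_wpM2l//; apply: le_trans (sum_rs_le S (F := fun b => (b%:R ^+ 2)^-1) _) _.
  by move=> b; rewrite invr_ge0 sqr_ge0.
by rewrite ler_wpM2l// sum_inv_sqr.
Qed.

(** Together with [wt_l2]: the weights of one radical [r] have square sum [O(min(1, h / r^2))], so
    [r] near [sqrt h] is the critical size. *)
Lemma wt_l2_np h S : (0 < h)%N -> S \subset pr z ->
  (np S)%:R ^+ 2 * \sum_(a < N | rs z a == S) wt R h a ^+ 2 <= 54 * h%:R.
Proof.
move=> h0 sS; have s0 : 0 < ((np S)%:R ^+ 2 : R) by rewrite exprn_gt0// ltr0n np_gt0.
pose x : R := h%:R / (np S)%:R ^+ 2.
have x0 : 0 < x by rewrite divr_gt0// ltr0n.
rewrite (bigID (fun a : 'I_N => (0 < a)%N))/= [X in _ + X]big1 ?addr0; last first.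
  by move=> a /andP[_]; rewrite -eqn0Ngt /wt => ->; rewrite expr0n.
pose F b : R := 9 * Num.min x (b%:R^-1) ^+ 2.
rewrite mulrC -ler_pdivlMr//.
rewrite (eq_bigl (fun a : 'I_N => (0 < a)%N && (rs z a == S))); last first.
  by move=> a; rewrite andbC.
rewrite (eq_bigr (fun a => F (bb a))); last first.
  move=> a /andP[a0 /eqP rS]; rewrite wtE// rS -/x /F exprMn; congr (_ * _); ring.
apply: le_trans (sum_rs_le S (F := F) _) _.
  by move=> b; rewrite mulr_ge0 ?sqr_ge0.
rewrite -mulr_sumr; apply: le_trans (_ : 2 * (9 * (3 * x)) <= _).
  by rewrite !ler_wpM2l// sum_min_sqr.
by rewrite -mulrA -/x; clear; move: x => u; lra.
Qed.

Lemma pavg_ord F : pavg z F = N%:R^-1 * \sum_(n < N) F n :> R.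
Proof. by rewrite /pavg big_mkord mulrC. Qed.

Lemma per_rft_rs S (f : 'I_N -> R) : S \subset pr z ->
  (forall a, f a != 0 -> rs z a = S) -> per (np S ^ 2) (rft f).
Proof.
move=> sS fS n m nm; apply: eq_bigr => a _; have [->|fa] := eqVneq (f a) 0; first by rewrite !mul0r.
congr (_ * _); have H : om R N ^+ (a * n) = om R N ^+ (a * m).
  rewrite -(expw_mod (@om_N R _ N0) (a * n)) -(expw_mod (@om_N R _ N0) (a * m)); congr (_ ^+ _).
  have /dvdnP[q aE] := dvdn_cof a.
  suff : (a * n = a * m %[mod cof a * np (rs z a) ^ 2])%N by rewrite -N_cof.
  rewrite (fS _ fa); move: (cof a) aE => c ->; rewrite mulnAC [(q * c * m)%N]mulnAC -!(mulnC c) -!muln_modr.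
  by rewrite -modnMmr nm modnMmr.
by move: H; rewrite !om_exp => /(congr1 (@Re R)).
Qed.

Lemma pavg_rft_sqr (f : 'I_N -> R) : even N0 f ->
  pavg z (fun n => rft f n ^+ 2) <= \sum_a f a ^+ 2.
Proof.
move=> ev; rewrite pavg_ord.
have E n : rft f n ^+ 2 = \prod_(i < 2) rft ((fun=> f) i) n.
  by rewrite !big_ord_recl big_ord0 mulr1.
under eq_bigr do rewrite E.
rewrite -(@real_ft_tuple R N N0 2 (fun=> f))//.
rewrite (eq_bigr (fun a : {ffun 'I_2 -> 'I_N} => f (a ord0) ^+ 2)); last first.
  move=> a; rewrite !big_ord_recl !big_ord0 addn0 mulr1 => aN.
  rewrite expr2; congr (_ * _); rewrite -(ev (a ord0)); congr f; apply: val_inj => /=.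
  move: aN; set x := a _; set y := a _; move: (ltn_ord x) (ltn_ord y) => xN yN.
  move=> xyN; rewrite -[LHS](modn_small yN); apply/eqP.
  by rewrite -(eqn_modDl x) subnKC ?(ltnW xN)// modnn.
have H := @sum_inj_le R {ffun 'I_2 -> 'I_N} 'I_N (fun a => (N %| \sum_i a i)%N) xpredT (fun a => a ord0) (fun a => f a ^+ 2).
apply: H => //; last by move=> a _; exact: sqr_ge0.
move=> a b; rewrite !unfold_in !big_ord_recl !big_ord0 !addn0 => aN bN ab.
apply/ffunP => i; case: (unliftP ord0 i) => [j ->|->//]; rewrite (ord1 j).
move: aN bN; rewrite ab; set x := b _; set y := a _; set t := b _ => aN bN.
apply: val_inj; have : y = t %[mod N].
  by apply/eqP; rewrite -(eqn_modDl x) (eqP aN) (eqP bN).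
by rewrite !modn_small.
Qed.

Lemma parseval_le S (f : 'I_N -> R) : S \subset pr z -> even N0 f ->
  (forall a, f a != 0 -> rs z a = S) ->
  \sum_(0 <= n < np S ^ 2) rft f n ^+ 2 <= (np S)%:R ^+ 2 * \sum_a f a ^+ 2.
Proof.
move=> sS ev fS; have s0 : 0 < ((np S)%:R ^+ 2 : R) by rewrite exprn_gt0// ltr0n np_gt0.
rewrite mulrC -ler_pdivrMr// -natrX -(@pavg_sub R z S (fun n => rft f n ^+ 2))//.
  exact: pavg_rft_sqr.
by move=> n m nm; rewrite (per_rft_rs sS fS nm).
Qed.

Definition cup k (T : 'I_k -> {set 'I_z}) : {set 'I_z} := \bigcup_i T i.
Definition types k (a : {ffun 'I_k -> 'I_N}) : {ffun 'I_k -> {set 'I_z}} := [ffun i => rs z (a i)].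

Lemma cup_types k (a : {ffun 'I_k -> 'I_N}) : cup (types a) \subset pr z.
Proof. by apply/bigcupsP => i _; rewrite ffunE rs_sub. Qed.

Lemma types_cup k (T : 'I_k -> {set 'I_z}) i : T i \subset cup T.
Proof. exact: bigcup_sup. Qed.

(** A prime in the denominator of just one of the fractions would remain in the denominator of their
    sum, which is an integer. This supplies the covering hypothesis of [finner]. *)
Lemma types_cover k (a : {ffun 'I_k -> 'I_N}) p : (N %| \sum_i a i)%N ->
  p \in cup (types a) -> (1 < #|[pred i | p \in types a i]|)%N.
Proof.
move=> aN /bigcupP[i _ pi]; rewrite ltnNge; apply/negP => c1.
have E j : j != i -> p \notin types a j.
  move=> ji; apply/negP => pj; move: c1; apply/negP; rewrite -ltnNge.
  by apply/card_gt1P; exists i, j; split=> //; rewrite eq_sym.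
move: pi; rewrite ffunE inE => /andP[pp /negP]; apply.
have pN : (p ^ 2 %| N)%N by rewrite dvdn_exp2r// (npD1 pp) dvdn_mulr.
have := dvdn_trans pN aN; rewrite (bigD1 i)//= dvdn_addl//.
apply: dvdn_sum => j ji; have := E j ji; rewrite ffunE inE pp/= => /negPn.
by [].
Qed.

(** With the radicals prescribed, the sum is the average of a product of transforms over the period
    [np (cup T) ^ 2]. Finner bounds it by l2 norms, each at most [sqrt (54 * h)] by Parseval and
    [wt_l2_np]; the division by the period remains. *)
Lemma sum_types_le h k (T : {ffun 'I_k -> {set 'I_z}}) : (0 < h)%N ->
  \sum_(a : {ffun 'I_k -> 'I_N} | (N %| \sum_i a i)%N && (types a == T)) \prod_i wt R h (a i)
  <= Num.sqrt (54 * h%:R) ^+ k / (np (cup T))%:R ^+ 2.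
Proof.
move=> h0; have R0 : 0 <= Num.sqrt (54 * h%:R) ^+ k / (np (cup T))%:R ^+ 2 :> R.
  by rewrite divr_ge0// exprn_ge0// sqrtr_ge0.
case: (pickP (fun a : {ffun 'I_k -> 'I_N} => (N %| \sum_i a i)%N && (types a == T))); last first.
  by move=> e; rewrite big_pred0.
move=> a0 /andP[a0N /eqP a0T].
have sT : cup T \subset pr z by rewrite -a0T cup_types.
have cov p : p \in cup T -> (1 < #|[pred i | p \in T i]|)%N by rewrite -a0T; exact: types_cover.
have sTi i : T i \subset pr z by rewrite (subset_trans (types_cup T i)).
pose f i (a : 'I_N) : R := if rs z a == T i then wt R h a else 0.
have ev i : even N0 (f i) by move=> a; rewrite /f rs_negI wt_even.
have fT i a : f i a != 0 -> rs z a = T i by rewrite /f; case: ifP => [/eqP//|_]; rewrite eqxx.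
rewrite big_mkcondr/= (eq_bigr (fun a : {ffun 'I_k -> 'I_N} => \prod_i f i (a i))); last first.
  move=> a _; case: ifP => [/eqP aT|/negbT aT].
    by apply: eq_bigr => i _; rewrite /f -aT ffunE eqxx.
  have [i iT] : exists i, types a i != T i.
    apply/existsP; apply: contraNT aT => /existsPn E; apply/eqP/ffunP => i.
    by apply/eqP; rewrite -[_ == _]negbK E.
  by rewrite (bigD1 i)//= /f; move: iT; rewrite ffunE => /negbTE ->; rewrite mul0r.
rewrite (real_ft_tuple ev) -(pavg_ord (fun n => \prod_i rft (f i) n)).
have pT i : per (np (T i) ^ 2) (rft (f i)) := per_rft_rs (sTi i) (@fT i).
have dT i : (np (T i) ^ 2 %| np (cup T) ^ 2)%N by rewrite dvdn_exp2r// np_sub// types_cup.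
rewrite (@pavg_sub R z (cup T))//; last first.
  by move=> n m nm; apply: eq_bigr => i _; exact: per_dvd (dT i) (pT i) _ _ nm.
rewrite natrX ler_wpM2r ?invr_ge0 ?exprn_ge0//.
apply: le_trans (_ : \sum_(0 <= n < np (cup T) ^ 2) \prod_i `|rft (f i) n| <= _).
  by apply: ler_sum => n _; rewrite -normr_prod ler_norm.
apply: le_trans (finner sT (types_cup T) (F := fun i n => `|rft (f i) n|) _ _ cov) _ => //.
  by move=> i n m nm; rewrite (pT i _ _ nm).
rewrite -[in leRHS](card_ord k) -prodr_const; apply: ler_prod => i _; rewrite sqrtr_ge0/=.
apply: ler_wsqrtr; under eq_bigr do rewrite real_normK ?num_real//.
apply: le_trans (parseval_le (sTi i) (ev i) (fT i)) _.
apply: le_trans (wt_l2_np h0 (sTi i)); rewrite ler_wpM2l ?exprn_ge0//.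
rewrite [leRHS]big_mkcond/=; apply: ler_sum => a _; rewrite /f; case: ifP => // _.
by rewrite expr0n.
Qed.

Lemma card_types k (U : {set 'I_z}) :
  (\sum_(T : {ffun 'I_k -> {set 'I_z}} | cup T == U) 1 <= (2 ^ k) ^ #|U|)%N.
Proof.
have -> : ((2 ^ k) ^ #|U| = #|powerset U| ^ #|'I_k|)%N.
  by rewrite card_powerset card_ord -!expnM mulnC.
rewrite sum1_card -card_ffun_on.
apply: subset_leq_card; apply/subsetP => T; move=> TU0.
have /eqP TU : cup T == U := TU0.
by apply/ffun_onP => i; rewrite powersetE -TU types_cup.
Qed.

End weights.

(** The bound is about [h^(k/2) / Y], which beats [h^(k/4)] as soon as the union exceeds
    [h^(k/4)]. *)
Lemma sum_large_types (R : realType) k (eps : R) : 0 < eps -> eps <= 1 / 2 ->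
  exists2 C : R, 0 < C & forall z h (Y : R), (0 < h)%N -> 0 < Y ->
  \sum_(a : {ffun 'I_k -> 'I_(np (pr z) ^ 2)} |
     (np (pr z) ^ 2 %| \sum_i a i)%N && (Y < (np (cup (types a)))%:R)) \prod_i wt R h (a i)
  <= C * Num.sqrt (h%:R) ^+ k * Y `^ (- 1 + 2 * eps).
Proof.
move=> e0 e1; have [C0 C01 HC] := @divisor_bound R (2 ^ k) _ e0.
have C00 : 0 < C0 by apply: lt_le_trans C01.
have eV : 0 < 1 + eps^-1 by rewrite addr_gt0// invr_gt0.
exists (Num.sqrt 54 ^+ k * (C0 * (1 + eps^-1))) => [|z h Y h0 Y0].
  by rewrite mulr_gt0 ?exprn_gt0 ?sqrtr_gt0// mulr_gt0.
set N := (np (pr z) ^ 2)%N.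
rewrite (partition_big (fun a : {ffun 'I_k -> 'I_N} => cup (types a))
  (fun U => (U \subset pr z) && (Y < (np U)%:R)))/=; last first.
  by move=> a /andP[_ ->]; rewrite cup_types.
set s : R := Num.sqrt (54 * h%:R) ^+ k.
have s0 : 0 <= s by rewrite exprn_ge0// sqrtr_ge0.
apply: le_trans (_ : \sum_(U : {set 'I_z} | (U \subset pr z) && (Y < (np U)%:R))
   s * C0 * (np U)%:R `^ (-2 + eps) <= _); last first.
  rewrite -mulr_sumr; apply: le_trans (ler_wpM2l _ (sum_np_tail z e0 e1 Y0)) _.
    by rewrite mulr_ge0// ltW.
  rewrite /s sqrtrM// exprMn; move: (Y `^ _) => u; rewrite le_eqVlt; apply/orP; left; apply/eqP; ring.
apply: ler_sum => U /andP[sU YU].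
rewrite (partition_big (@types z k) (fun T => cup T == U))/=; last by move=> a /andP[_].
apply: le_trans (_ : \sum_(T : {ffun 'I_k -> {set 'I_z}} | cup T == U) s / (np U)%:R ^+ 2 <= _).
  apply: ler_sum => T /eqP TU; rewrite -TU /s.
  apply: le_trans (sum_types_le R T h0).
  rewrite [leLHS]big_mkcond [leRHS]big_mkcond; apply: ler_sum => a _.
  case: (boolP (types a == T)) => aT; rewrite ?andbF// !andbT; case: (boolP (N %| _)%N) => //= _.
  by case: ifP => // _; apply: prodr_ge0 => i _; exact: wt_ge0.
have U0 : 0 < ((np U)%:R : R) by rewrite ltr0n np_gt0.
have -> : ((np U)%:R : R) `^ (-2 + eps) = (np U)%:R `^ eps / (np U)%:R ^+ 2.
  rewrite powRD; last by rewrite (gt_eqF U0)/= implybT.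
  by rewrite mulrC powRN -powR_mulrn ?ltW.
rewrite sumr_const -[_ *+ _]mulr_natr -mulrA -(mulrA s) ler_wpM2l// mulrC [leRHS]mulrA ler_wpM2r ?invr_ge0 ?exprn_ge0//.
apply: le_trans (HC z U sU); rewrite ler_nat -sum1_card.
exact: card_types.
Qed.

(** * Counting tuples of fractions *)

Section counting.
Variable R : realType.

Lemma sum_types_cup_le k (eps : R) : 0 < eps ->
  exists2 C : R, 0 < C & forall z (Y : R), 1 <= Y ->
  \sum_(T : {ffun 'I_k -> {set 'I_z}} | (cup T \subset pr z) && ((np (cup T))%:R <= Y)) 1
  <= C * Y `^ (1 + eps).
Proof.
move=> e0; have [C C1 HC] := @divisor_bound R (2 ^ k) _ e0.
have C0 : 0 < C by apply: lt_le_trans C1.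
exists C => // z Y Y1; have Y0 : 0 < Y by apply: lt_le_trans Y1.
rewrite (partition_big (fun T : {ffun 'I_k -> {set 'I_z}} => cup T)
  (fun U => (U \subset pr z) && ((np U)%:R <= Y)))//=.
apply: le_trans (_ : \sum_(U : {set 'I_z} | (U \subset pr z) && ((np U)%:R <= Y)) C * Y `^ eps * 1 <= _).
  apply: ler_sum => U /andP[sU YU].
  apply: le_trans (_ : \sum_(T : {ffun 'I_k -> {set 'I_z}} | cup T == U) 1 <= _).
    rewrite [leLHS]big_mkcond [leRHS]big_mkcond; apply: ler_sum => T _.
    by case: (cup T == U); rewrite ?andbF//; case: ifP.
  rewrite mulr1; apply: le_trans (_ : C * (np U)%:R `^ eps <= _); last first.
    by rewrite ler_wpM2l ?(ltW C0)// ge0_ler_powR ?nnegrE// ?ltW.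
  by apply: le_trans (HC z U sU); rewrite sumr_const -sum1_card ler_nat card_types.
rewrite -mulr_sumr -mulrA ler_wpM2l ?(ltW C0)//.
rewrite [Y `^ (1 + eps)]powRD ?(gt_eqF Y0) ?implybT// powRr1 ?(ltW Y0)// mulrC ler_wpM2r ?powR_ge0//.
by apply: card_np_le; exact: ltW.
Qed.

Lemma sum_inv_le (eps : R) (B : nat) : 0 < eps -> (0 < B)%N ->
  \sum_(b < B.+1) (b%:R : R)^-1 <= (1 + eps^-1) * B%:R `^ eps.
Proof.
move=> e0 B0; rewrite big_ord_recl invr0 add0r.
rewrite -(big_mkord xpredT (fun b => (b.+1%:R : R)^-1)) -(big_add1 _ _ 0 B.+1 xpredT (fun b => (b%:R : R)^-1)).
apply: le_trans (_ : \sum_(1 <= b < B.+1) B%:R `^ eps * (b%:R : R) `^ (-1 - eps) <= _).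
  rewrite !big_nat; apply: ler_sum => b /andP[b0 bB].
  have br : 0 < (b%:R : R) by rewrite ltr0n.
  rewrite powRD ?(gt_eqF br) ?implybT// (powRN _ 1) powRr1 ?(ltW br)// (powRN _ eps) mulrCA ler_peMr ?invr_ge0 ?(ltW br)//.
  rewrite ler_pdivlMr ?powR_gt0// mul1r ge0_ler_powR ?nnegrE ?(ltW e0)// ler_nat; lia.
by rewrite -mulr_sumr mulrC ler_wpM2r ?powR_ge0// zeta_partial_bound.
Qed.

(** Each weight is at most [3 / bb], and numerators are at most [T ^+ 2], so summing over them costs
    only [T ^ eps]; what remains is the number of values of [tau] and [m]. [tau] is the family of
    radicals, possibly with primes removed, and [m] a bounded extra datum that restores
    injectivity. *)
Lemma count_tuples k (eps : R) : 0 < eps ->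
  exists2 C : R, 0 < C & forall z h M (T Y : R) (P : pred {ffun 'I_k -> 'I_(np (pr z) ^ 2)})
    (tau : {ffun 'I_k -> 'I_(np (pr z) ^ 2)} -> {ffun 'I_k -> {set 'I_z}})
    (m : {ffun 'I_k -> 'I_(np (pr z) ^ 2)} -> 'I_M),
  1 <= T -> 1 <= Y ->
  (forall a, P a -> cup (tau a) \subset pr z /\ (np (cup (tau a)))%:R <= Y) ->
  (forall a, P a -> (np (cup (types a)))%:R <= T) ->
  (forall a b, P a -> P b -> tau a = tau b -> m a = m b ->
     (forall i, half (a i) = half (b i)) -> (forall i, bb (a i) = bb (b i)) -> a = b) ->
  \sum_(a | P a) \prod_i wt R h (a i) <= C * M%:R * T `^ eps * Y `^ (1 + eps).
Proof.
move=> e0; have [C0 C00 HC] := sum_types_cup_le k e0.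
pose e1 := eps / (2 * k.+1%:R).
have k0 : 0 < (2 * k.+1%:R : R) by rewrite mulr_gt0.
have e10 : 0 < e1 by rewrite divr_gt0.
have c0 : 0 < 3 * (1 + e1^-1) by rewrite mulr_gt0// addr_gt0// invr_gt0.
pose K := (2 ^ k)%:R * (3 * (1 + e1^-1)) ^+ k.
have K0 : 0 < K by rewrite mulr_gt0 ?exprn_gt0// ltr0n expn_gt0.
exists (C0 * K) => [|z h M T Y P tau m T1 Y1 tauP TP inj]; first by rewrite mulr_gt0.
set N := (np (pr z) ^ 2)%N in P tau m tauP TP inj *.
have T0 : 0 < T by apply: lt_le_trans T1.
pose B := Num.truncn (T ^+ 2).
have B0 : (0 < B)%N by rewrite truncn_gt0 exprn_ege1.
have BT : (B%:R : R) <= T ^+ 2 by rewrite truncn_le// exprn_ge0// ltW.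
have bbB (a : {ffun 'I_k -> 'I_N}) i : P a -> (bb (a i) < B.+1)%N.
  move=> Pa; rewrite ltnS truncn_ge_nat ?exprn_ge0 ?(ltW T0)//.
  apply: le_trans (_ : ((np (rs z (a i)))%:R : R) ^+ 2 <= _).
    by rewrite -natrX ler_nat bb_le.
  rewrite ler_pXn2r ?nnegrE ?(ltW T0)//; apply: le_trans (TP a Pa).
  rewrite ler_nat np_le ?cup_types//.
  by have := types_cup (types a) i; rewrite ffunE.
pose Tgt := (({ffun 'I_k -> {set 'I_z}} * {ffun 'I_k -> bool}) * ({ffun 'I_k -> 'I_B.+1} * 'I_M))%type.
pose r (a : {ffun 'I_k -> 'I_N}) : Tgt :=
  ((tau a, [ffun i => half (a i)]), ([ffun i => inord (bb (a i))], m a)).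
pose Q (u : Tgt) := (cup u.1.1 \subset pr z) && ((np (cup u.1.1))%:R <= Y).
pose F (u : Tgt) : R := \prod_i (3 / (u.2.1 i)%:R).
have F0 u : 0 <= F u by apply: prodr_ge0 => i _; rewrite divr_ge0.
apply: le_trans (_ : \sum_(a | P a) F (r a) <= _).
  apply: ler_sum => a Pa; apply: ler_prod => i _; rewrite wt_ge0 ffunE inordK ?bbB//=.
  exact: wt_le_bb.
apply: le_trans (sum_inj_le (h := r) (Q := Q) (F := F) _ _ _) _ => //.
- move=> a b Pa Pb [tab hab bab mab]; apply: inj => // i.
    by have := congr1 (fun g : {ffun 'I_k -> bool} => g i) hab; rewrite !ffunE.
  have := congr1 (fun g : {ffun 'I_k -> 'I_B.+1} => val (g i)) bab; rewrite !ffunE /=.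
  by rewrite !inordK ?bbB.
- by move=> a /tauP[? ?]; apply/andP.
pose F2 (v : {ffun 'I_k -> 'I_B.+1} * 'I_M) : R := \prod_i (3 / (v.1 i)%:R).
set s := \sum_v F2 v; have s0 : 0 <= s by apply: sumr_ge0 => v _; apply: prodr_ge0 => i _; rewrite divr_ge0.
pose Q2 (U : {ffun 'I_k -> {set 'I_z}}) := (cup U \subset pr z) && ((np (cup U))%:R <= Y).
have -> : \sum_(u | Q u) F u = \sum_(U | Q2 U) \sum_(v : {ffun 'I_k -> bool}) s.
  rewrite pair_big /s pair_big; apply: eq_big => u; last by [].
  by rewrite /Q /Q2 !andbT.
under eq_bigr do rewrite sumr_const card_ffun card_bool card_ord.
have -> : s *+ 2 ^ k = (s * (2 ^ k)%:R) * 1 by rewrite mulr1 mulr_natr.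
rewrite -mulr_sumr.
have sE : s <= M%:R * ((3 * (1 + e1^-1)) ^+ k * T `^ eps).
  rewrite /s -(pair_big xpredT xpredT (fun v _ => \prod_i (3 / ((v : {ffun 'I_k -> 'I_B.+1}) i)%:R)))/=.
  under eq_bigr do rewrite sumr_const card_ord -[_ *+ _]mulr_natl.
  rewrite -mulr_sumr ler_wpM2l// -(bigA_distr_bigA (fun _ (b : 'I_B.+1) => 3 / (b%:R : R))).
  rewrite prodr_const card_ord -mulr_sumr.
  apply: le_trans (_ : (3 * (1 + e1^-1) * T `^ (2 * e1)) ^+ k <= _).
    rewrite lerXn2r ?nnegrE//; first by rewrite mulr_ge0// sumr_ge0// => b _; rewrite invr_ge0.
      by rewrite mulr_ge0 ?powR_ge0// ltW.
    rewrite -mulrA ler_wpM2l//; apply: le_trans (sum_inv_le e10 B0) _.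
    rewrite ler_wpM2l ?addr_ge0 ?invr_ge0 ?(ltW e10)// powRrM powR_mulrn ?(ltW T0)//.
    by rewrite ge0_ler_powR ?nnegrE ?(ltW e10) ?exprn_ge0 ?(ltW T0).
  rewrite exprMn ler_wpM2l ?exprn_ge0 ?(ltW c0)// -powR_mulrn ?powR_ge0// -powRrM.
  apply: powR_le_max => //.
  have -> : 2 * e1 * k%:R = eps * (k%:R / k.+1%:R).
    by rewrite /e1; field; rewrite addrC natr1.
  by rewrite ler_piMr ?(ltW e0)// ler_pdivrMr// mul1r ler_nat.
have HT := HC z Y Y1.
apply: le_trans (ler_pM _ _ (ler_wpM2r _ sE) HT) _ => //.
- by rewrite mulr_ge0.
- by apply: sumr_ge0.
rewrite le_eqVlt; apply/orP; left; apply/eqP; rewrite /K.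
by move: (T `^ _) (Y `^ _) (_ ^+ k) => u v x; ring.
Qed.

Definition realS z h k : R :=
  \sum_(a : {ffun 'I_k -> 'I_(np (pr z) ^ 2)} | (np (pr z) ^ 2 %| \sum_i a i)%N) \prod_i wt R h (a i).

Lemma sqrt_powR (x : R) k : 0 <= x -> Num.sqrt x ^+ k = x `^ (k%:R / 2).
Proof.
by move=> x0; rewrite -powR12_sqrt// -powR_mulrn ?powR_ge0// -powRrM mulrC.
Qed.

(** Splitting at a union of size [Y = h^(k/4)] balances the counting bound [Y] against the Finner
    bound [h^(k/2) / Y]. This has the order of the main term, without saving. *)
Lemma realS_le k (eps : R) : 0 < eps ->
  exists2 C : R, 0 < C & forall z h, (0 < h)%N -> realS z h k <= C * h%:R `^ (k%:R / 4 + eps).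
Proof.
move=> eps0; pose e := Num.min eps 1 / (2 * k.+1%:R).
have k0 : 0 < (2 * k.+1%:R : R) by rewrite mulr_gt0.
have e0 : 0 < e by rewrite divr_gt0// lt_min eps0/=.
have ke : k%:R * e / 2 <= eps.
  have -> : k%:R * e / 2 = Num.min eps 1 * (k%:R / (4 * k.+1%:R)).
    by rewrite /e; field; rewrite addrC natr1.
  apply: le_trans (_ : Num.min eps 1 * 1 <= _); last by rewrite mulr1 ge_min lexx.
  rewrite ler_wpM2l ?le_min ?(ltW eps0)//= ler_pdivrMr ?mulr_gt0// mul1r.
  by rewrite -natrM ler_nat; lia.
have e1 : e <= 1 / 2.
  rewrite ler_pdivrMr// ; apply: le_trans (_ : 1 <= _); first by rewrite ge_min lexx orbT.
  by rewrite mulrA divfK// mul1r ler1n.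
have [C1 C10 H1] := count_tuples k e0.
have [C2 C20 H2] := sum_large_types k e0 e1.
exists (C1 + C2) => [|z h h0]; first by rewrite addr_gt0.
set x : R := h%:R; have x1 : 1 <= x by rewrite ler1n.
have x0 : 0 < x by apply: lt_le_trans x1.
pose Y := x `^ (k%:R / 4).
have Y1 : 1 <= Y by rewrite -(powRr0 x) powR_le_max// divr_ge0.
rewrite /realS (bigID (fun a : {ffun 'I_k -> 'I_(np (pr z) ^ 2)} => Y < (np (cup (types a)))%:R))/=.
rewrite mulrDl addrC; apply: lerD; last first.
  apply: le_trans (H2 z h Y h0 _) _; first by apply: lt_le_trans Y1.
  rewrite -mulrA ler_wpM2l ?(ltW C20)// sqrt_powR ?(ltW x0)// /Y -powRrM -powRD ?(gt_eqF x0) ?implybT//.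
  apply: powR_le_max => //; move: ke; set kk := k%:R : R; move=> ke.
  have -> : kk / 2 + kk / 4 * (-1 + 2 * e) = kk / 4 + kk * e / 2 by field.
  by rewrite lerD2l.
apply: le_trans (H1 z h 1%N Y Y _ (@types z k) (fun=> ord0) Y1 Y1 _ _ _) _.
- by move=> a /andP[_]; rewrite -leNgt => ?; split=> //; exact: cup_types.
- by move=> a /andP[_]; rewrite -leNgt.
- move=> a b _ _ tab _ hab bab; apply/ffunP => i; apply: rep_inj => //.
  by have := congr1 (fun T : {ffun 'I_k -> {set 'I_z}} => T i) tab; rewrite !ffunE.
rewrite mulr1 -mulrA ler_wpM2l ?(ltW C10)// /Y -!powRrM -powRD ?(gt_eqF x0) ?implybT//.
apply: powR_le_max => //; move: ke; set kk := k%:R : R; move=> ke.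
have -> : kk / 4 * e + kk / 4 * (1 + e) = kk / 4 + kk * e / 2 by field.
by rewrite lerD2l.
Qed.

End counting.

(** * Arithmetic of unpaired tuples *)

Section unpaired.
Variables (R : realType) (z : nat).
Implicit Types (S : {set 'I_z}).

Local Notation N := (np (pr z) ^ 2)%N.
Let N0 : (0 < N)%N := prz_gt0 z.

(** Cauchy-Schwarz isolates coordinate [i]; the mean square of the other [k] is a sum over
    [2 * k]-tuples, for which [realS_le] loses nothing essential. Any saving in the l2 norm of the
    restricted coordinate is thus a saving in the whole sum. *)
Lemma bad_coord h k (B : pred 'I_N) (i : 'I_k.+1) : (forall a, B (negI N0 a) = B a) ->
  \sum_(a : {ffun 'I_k.+1 -> 'I_N} | (N %| \sum_i a i)%N && B (a i)) \prod_i wt R h (a i) <=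
  Num.sqrt (\sum_(a | B a) wt R h a ^+ 2) * Num.sqrt (realS R z h (2 * k)).
Proof.
move=> Bneg; pose f0 (a : 'I_N) : R := if B a then wt R h a else 0.
pose f (j : 'I_k.+1) := if j == i then f0 else wt R h.
have ev0 : even N0 f0 by move=> a; rewrite /f0 Bneg wt_even.
have ev j : even N0 (f j) by rewrite /f; case: ifP => // _; exact: wt_even.
rewrite big_mkcondr/= (eq_bigr (fun a : {ffun 'I_k.+1 -> 'I_N} => \prod_j f j (a j))); last first.
  move=> a _; rewrite [RHS](bigD1 i)//= {1}/f eqxx /f0; case: ifP => _; last by rewrite mul0r.
  by rewrite (bigD1 i)//=; congr (_ * _); apply: eq_bigr => j /negbTE ji; rewrite /f ji.
rewrite (real_ft_tuple ev).
have E (n : nat) : \prod_j rft (f j) n = rft f0 n * rft (wt R h : 'I_N -> R) n ^+ k.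
  rewrite (bigD1 i)//= {1}/f eqxx; congr (_ * _).
  transitivity (\prod_(j < k.+1 | j != i) rft (wt R h : 'I_N -> R) n).
    by apply: eq_bigr => j /negbTE ji; rewrite /f ji.
  by rewrite prodr_const (cardC1 i) card_ord -pred_Sn.
rewrite (eq_bigr _ (fun (n : 'I_N) _ => E n)).
apply: le_trans (ler_wpM2l _ (sum_cauchy_schwarz _ _ _ _)) _; first by rewrite invr_ge0.
have NV : (N%:R : R)^-1 = Num.sqrt (N%:R^-1) * Num.sqrt (N%:R^-1).
  by rewrite -expr2 sqr_sqrtr// invr_ge0.
rewrite NV mulrACA; apply: ler_pM; rewrite ?mulr_ge0 ?sqrtr_ge0//; rewrite -sqrtrM ?invr_ge0//; apply: ler_wsqrtr.
  rewrite -(@pavg_ord R z (fun n => rft f0 n ^+ 2)); apply: le_trans (pavg_rft_sqr ev0) _.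
  rewrite [leRHS]big_mkcond; apply: ler_sum => a _; rewrite /f0; case: ifP => // _.
  by rewrite expr0n.
rewrite /realS (real_ft_tuple (fun=> wt_even R h)) ler_wpM2l ?invr_ge0//.
by apply: ler_sum => n _; rewrite prodr_const card_ord -exprM mulnC.
Qed.

Lemma sum_wt_sqr_small h (r : R) : 0 <= r ->
  \sum_(a : 'I_N | (np (rs z a))%:R <= r) wt R h a ^+ 2 <= 36 * r.
Proof.
move=> r0; rewrite (partition_big (fun a : 'I_N => rs z a) (fun S => (S \subset pr z) && ((np S)%:R <= r)))/=; last first.
  by move=> a ->; rewrite rs_sub.
apply: le_trans (_ : \sum_(S : {set 'I_z} | (S \subset pr z) && ((np S)%:R <= r)) 36 * 1 <= _); last first.
  by rewrite -mulr_sumr ler_wpM2l// card_np_le.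
apply: ler_sum => S _; rewrite mulr1; apply: le_trans (wt_l2 R h S).
rewrite [leLHS]big_mkcond [leRHS]big_mkcond; apply: ler_sum => a _.
by case: (rs z a == S); rewrite ?andbF// andbT; case: ifP => // _; exact: sqr_ge0.
Qed.

Lemma sum_wt_sqr_large h (r e : R) : (0 < h)%N -> 0 < r -> 0 < e -> e <= 1 / 2 ->
  \sum_(a : 'I_N | r < (np (rs z a))%:R) wt R h a ^+ 2 <=
  54 * h%:R * (r `^ (-1 + 2 * e) * (1 + e^-1)).
Proof.
move=> h0 r0 e0 e1; rewrite (partition_big (fun a : 'I_N => rs z a) (fun S => (S \subset pr z) && (r < (np S)%:R)))/=; last first.
  by move=> a ->; rewrite rs_sub.
apply: le_trans (ler_wpM2l _ (sum_np_tail z e0 e1 r0)); last by rewrite mulr_ge0.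
rewrite mulr_sumr; apply: ler_sum => S /andP[sS _].
have S0 : 0 < ((np S)%:R : R) by rewrite ltr0n np_gt0.
have S1 : 1 <= ((np S)%:R : R) by rewrite ler1n np_gt0.
apply: le_trans (_ : 54 * h%:R * (np S)%:R `^ (-2) <= _); last first.
  by rewrite ler_wpM2l ?mulr_ge0// powR_le_max// lerDl ltW.
rewrite powRN powR_mulrn ?(ltW S0)// ler_pdivlMr ?exprn_gt0// mulrC.
apply: le_trans (wt_l2_np R h0 sS); rewrite ler_wpM2l ?exprn_ge0 ?(ltW S0)//.
rewrite [leLHS]big_mkcond [leRHS]big_mkcond; apply: ler_sum => a _.
by case: (rs z a == S); rewrite ?andbF// andbT; case: ifP => // _; exact: sqr_ge0.
Qed.

Lemma frac_rep (a : 'I_N) : (a : nat)%:R / N%:R =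
  (-1) ^+ (~~ half a) * ((bb a)%:R / (np (rs z a))%:R ^+ 2) + (~~ half a)%:R :> R.
Proof.
have c0 : 0 < ((cof z a)%:R : R) by rewrite ltr0n cof_gt0.
have -> : (bb a)%:R / (np (rs z a))%:R ^+ 2 = (dist0 a)%:R / N%:R :> R.
  have -> : (N%:R : R) = (cof z a)%:R * (np (rs z a))%:R ^+ 2 by rewrite -natrX -natrM -N_cof.
  rewrite dist0_bb natrM.
  by move: (rs_gt0 R z a) c0 => /lt0r_neq0 ? /lt0r_neq0 ?; field; apply/andP.
have Nn : (N%:R : R) != 0 by rewrite pnatr_eq0 -lt0n.
rewrite /dist0 /half; have [le|lt] := leqP a (N - a)%N.
  by rewrite expr0 mul1r addr0.
rewrite natrB ?(ltnW (ltn_ord a))//= expr1.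
by move: (N%:R : R) Nn => M Mn; field.
Qed.

Definition gs k (T : {ffun 'I_k -> {set 'I_z}}) i j : {set 'I_z} :=
  [set p in T i :&: T j | [forall l, (l != i) && (l != j) ==> (p \notin T l)]].

Definition cut k (T : {ffun 'I_k -> {set 'I_z}}) i j : {ffun 'I_k -> {set 'I_z}} :=
  [ffun l => if (l == i) || (l == j) then T l :\: gs T i j else T l].

Lemma gs_sub k (T : {ffun 'I_k -> {set 'I_z}}) i j : (gs T i j \subset T i) && (gs T i j \subset T j).
Proof. by apply/andP; split; apply/subsetP => p; rewrite !inE => /andP[/andP[]]. Qed.

Lemma cut_sub k (T : {ffun 'I_k -> {set 'I_z}}) i j : cup (cut T i j) \subset cup T :\: gs T i j.
Proof.
apply/bigcupsP => l _; rewrite ffunE; case: ifP => lij; first by rewrite setSD// types_cup.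
apply/subsetP => p pl; rewrite in_setD (subsetP (types_cup T l))// andbT.
rewrite in_set negb_and; apply/orP; right; apply/forallPn; exists l.
by rewrite negb_imply negbK pl andbT -negb_or lij.
Qed.

Lemma np_cut k (T : {ffun 'I_k -> {set 'I_z}}) i j : cup T \subset pr z ->
  (np (cup (cut T i j)) * np (gs T i j) <= np (cup T))%N.
Proof.
move=> sT; have gT : gs T i j \subset cup T.
  by have /andP[s _] := gs_sub T i j; rewrite (subset_trans s)// types_cup.
rewrite (npID (cup T) (gs T i j)) (setIidPr gT) mulnC leq_mul2l np_le ?orbT ?cut_sub//.
by rewrite (subset_trans _ sT)// subsetDl.
Qed.

(* The equation on the fractional parts determines the primes that were cut out. *)
Lemma cut_inj k (a b : {ffun 'I_k -> 'I_N}) i j : i != j ->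
  cut (types a) i j = cut (types b) i j -> (\sum_l a l = \sum_l b l)%N ->
  (forall l, half (a l) = half (b l)) -> (forall l, bb (a l) = bb (b l)) ->
  ~~ (N %| a i + a j)%N -> a = b.
Proof.
move=> ij cab sab hab bab nN.
have cabl l : cut (types a) i j l = cut (types b) i j l by rewrite cab.
have E l : l != i -> l != j -> a l = b l.
  move=> li lj; apply: rep_inj => //; have := cabl l.
  by rewrite !ffunE (negbTE li) (negbTE lj).
have ji : j != i by rewrite eq_sym.
have sij : (a i + a j = b i + b j)%N.
  have S (c : {ffun 'I_k -> 'I_N}) :
      (\sum_l c l = c i + c j + \sum_(l | (l != i) && (l != j)) c l)%N.
    by rewrite (bigD1 i)//= (bigD1 j)//= addnA.
  move: sab; rewrite !S (eq_bigr (fun l => b l : nat)); first by move/eqP; rewrite eqn_add2r => /eqP.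
  by move=> l /andP[li lj]; rewrite E.
pose T c l : {set 'I_z} := cut (types c) i j l; pose g c := gs (types c) i j.
have gp (c : {ffun 'I_k -> 'I_N}) : 0 < ((np (g c))%:R : R).
  rewrite ltr0n np_gt0//; have /andP[s _] := gs_sub (types c) i j.
  by rewrite (subset_trans s)// ffunE rs_sub.
have npE (c : {ffun 'I_k -> 'I_N}) l : (l == i) || (l == j) ->
    np (rs z (c l)) = (np (g c) * np (T c l))%N.
  move=> lij; rewrite /T ffunE lij ffunE (npID _ (g c)); congr (np _ * _)%N.
  apply/setIidPr; have /andP[si sj] := gs_sub (types c) i j.
  by move: lij si sj; rewrite !ffunE => /orP[]/eqP ->.
have TE l : T a l = T b l by exact: cabl.
have Tp (l : 'I_k) : (l == i) || (l == j) -> ((np (T a l))%:R : R) != 0.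
  move=> lij; rewrite pnatr_eq0 -lt0n np_gt0// /T ffunE lij ffunE.
  by rewrite (subset_trans (subsetDl _ _))// rs_sub.
pose Q l : R := (-1) ^+ (~~ half (a l)) * ((bb (a l))%:R / (np (T a l))%:R ^+ 2).
pose c0 : R := (~~ half (a i))%:R + (~~ half (a j))%:R.
have F (c : {ffun 'I_k -> 'I_N}) : (forall l, half (c l) = half (a l)) ->
   (forall l, bb (c l) = bb (a l)) -> (forall l, T c l = T a l) ->
   (c i + c j)%:R / N%:R - c0 = (Q i + Q j) / (np (g c))%:R ^+ 2.
  move=> hc bc Tc; rewrite natrD mulrDl !frac_rep !npE ?eqxx ?orbT// !hc !bc !Tc !natrM /Q /c0.
  move: (Tp i) (Tp j); rewrite !eqxx orbT => /(_ isT) ti /(_ isT) tj.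
  by field; rewrite ti tj lt0r_neq0.
have Fa := F a (fun=> erefl) (fun=> erefl) (fun=> erefl).
have Fb := F b (fun l => esym (hab l)) (fun l => esym (bab l)) (fun l => esym (TE l)).
have D0 : (a i + a j)%:R / N%:R - c0 != 0 :> R.
  rewrite subr_eq0; apply: contra nN => /eqP.
  have Nn : (N%:R : R) != 0 by rewrite pnatr_eq0 -lt0n.
  move/(congr1 (fun u => u * N%:R)); rewrite divfK// /c0 -natrD -natrM => /eqP.
  by rewrite eqr_nat => /eqP ->; rewrite dvdn_mull.
(* By [F] the two fractions add up, after removal of the integer [c0], to [(Q i + Q j) / g^2] with
   [Q] depending only on the cut data. The other entries agree and the total sums are equal, so this
   value is common to [a] and [b]; it is nonzero because [a i + a j] is not divisible by [N]. Hence
   [g] is determined. *)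
have gab : np (g a) = np (g b).
  move: Fb; rewrite -sij Fa => gE; rewrite Fa in D0.
  have Qn : Q i + Q j != 0 by apply: contraNneq D0 => ->; rewrite mul0r.
  have := mulfI Qn gE => /invr_inj /eqP.
  by rewrite eqrXn2 ?(ltW (gp _))// eqr_nat => /eqP.
have H l : (l == i) || (l == j) -> a l = b l.
  move=> lij; apply: rep_inj => //; apply: np_inj; rewrite ?rs_sub//.
  by rewrite !npE// gab TE.
apply/ffunP => l; have [li|li] := eqVneq l i; first by rewrite H// li eqxx.
have [lj|lj] := eqVneq l j; first by rewrite H// lj eqxx orbT.
exact: E.
Qed.

Lemma np_ind (S U : {set 'I_z}) : S \subset U -> np S = (\prod_(p in U) p ^ (p \in S))%N.
Proof.
move=> sSU; rewrite /np big_mkcond [RHS]big_mkcond; apply: eq_bigr => p _.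
by case: (boolP (p \in S)) => [/(subsetP sSU) ->|_]; rewrite ?expn1// expn0 if_same.
Qed.

Definition triple k (T : {ffun 'I_k.+1 -> {set 'I_z}}) : {set 'I_z} :=
  [set p in T ord0 | (2 < #|[pred i | p \in T i]|)%N].

(** The exponent of a prime on the right is the number of sets containing it: at least two on the
    union, at least three on [triple T]. *)
Lemma np_triple k (T : {ffun 'I_k.+1 -> {set 'I_z}}) : cup T \subset pr z ->
  (forall p, p \in cup T -> (1 < #|[pred i | p \in T i]|)%N) ->
  (np (cup T) ^ 2 * np (triple T) <= \prod_i np (T i))%N.
Proof.
move=> sT cov; have tT : triple T \subset cup T.
  apply: subset_trans (types_cup T ord0); apply/subsetP => p; rewrite inE => /andP[]//.
rewrite (np_ind tT); under [leqRHS]eq_bigr do rewrite (np_ind (types_cup T _)).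
rewrite exchange_big/= /np -mulnn -!big_split/=; apply: leq_prod => p pT.
rewrite mulnn -expnD -expn_sum leq_pexp2l ?prime_gt0 ?(pr_prime sT)//.
have -> : (\sum_(i < k.+1) (p \in T i) = #|[pred i | p \in T i]|)%N.
  by rewrite -sum1_card [RHS]big_mkcond; apply: eq_bigr => i _; rewrite inE; case: ifP.
rewrite in_set; case: ltnP => c; first by rewrite andbT; case: (p \in _) => //=; rewrite ?addn0 ?(ltnW c)//; exact: cov.
by rewrite andbF addn0 cov.
Qed.

(** A prime of [T ord0] outside [triple T] lies in exactly one further [T j], hence in
    [gs T ord0 j]. *)
Lemma np_gs_triple k (T : {ffun 'I_k.+1 -> {set 'I_z}}) : cup T \subset pr z ->
  (forall p, p \in cup T -> (1 < #|[pred i | p \in T i]|)%N) ->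
  (np (T ord0) <= np (triple T) * \prod_(j < k) np (gs T ord0 (lift ord0 j)))%N.
Proof.
move=> sT cov; have tT : triple T \subset T ord0 by apply/subsetP => p; rewrite inE => /andP[].
have gT j : gs T ord0 (lift ord0 j) \subset T ord0 by have /andP[] := gs_sub T ord0 (lift ord0 j).
rewrite (np_ind tT) (eq_bigr _ (fun j _ => np_ind (gT j))).
rewrite exchange_big/= {1}/np -big_split/=; apply: leq_prod => p pT.
have pU := subsetP (types_cup T ord0) p pT.
have p0 : (0 < p)%N by rewrite prime_gt0// (pr_prime sT).
rewrite -expn_sum -expnD -{1}(expn1 p) leq_pexp2l// in_set pT/=.
case: (ltnP 2) => //= c2; rewrite add0n.
have /card_gt1P[i1 [i2 [i1p i2p i12]]] := cov p pU.
have [j jp] : exists j : 'I_k, p \in T (lift ord0 j).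
  move: i1p i2p i12; rewrite !inE.
  case: (unliftP ord0 i1) => [j ->|->] pi; first by exists j.
  by case: (unliftP ord0 i2) => [j -> ?|->]; [exists j|rewrite eqxx].
rewrite (bigD1 j)//= in_set in_setI pT jp/= (_ : [forall _, _])//.
apply/forallP => l; apply/implyP => /andP[l0 lj]; apply/negP => pl.
move: c2; rewrite leqNgt => /negP; apply.
apply: leq_trans (_ : #|l |: [set ord0; lift ord0 j]| <= _)%N.
  by rewrite cardsU1 cards2 !inE negb_or l0 lj.
by apply: subset_leq_card; apply/subsetP => i; rewrite !inE => /orP[|/orP[]] /eqP ->.
Qed.

End unpaired.

(** * The saving for unpaired tuples *)

Section unpaired_bound.
Variable R : realType.

Lemma sum_cover2 (I : finType) (P Q1 Q2 : pred I) (F : I -> R) : (forall a, 0 <= F a) ->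
  (forall a, P a -> Q1 a || Q2 a) -> \sum_(a | P a) F a <= \sum_(a | Q1 a) F a + \sum_(a | Q2 a) F a.
Proof.
move=> F0 PQ; rewrite [leLHS]big_mkcond [X in _ <= X + _]big_mkcond [X in _ <= _ + X]big_mkcond -big_split/=.
apply: ler_sum => a _; case: ifP => [/PQ|_]; last by rewrite addr_ge0//; case: ifP.
by case: (Q1 a); case: (Q2 a) => //= _; rewrite ?lerDl ?addr0 ?add0r.
Qed.

Lemma sum_cover_exists (I J : finType) (P : pred I) (Q : J -> pred I) (F : I -> R) :
  (forall a, 0 <= F a) -> (forall a, P a -> exists j, Q j a) ->
  \sum_(a | P a) F a <= \sum_j \sum_(a | Q j a) F a.
Proof.
move=> F0 PQ; under [leRHS]eq_bigr do rewrite big_mkcond.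
rewrite exchange_big/= big_mkcond; apply: ler_sum => a _; case: ifP => [/PQ[j Qj]|_].
  by rewrite (bigD1 j)//= Qj lerDl sumr_ge0// => l _; case: ifP.
by apply: sumr_ge0 => l _; case: ifP.
Qed.

Variable k : nat.
(** [K] is the number of coordinates and [gamma] the exponent to reach, a gain of [q / 64] over
    [K / 4]. Radicals are confined to exponents within [q / 16] of 1/2, so that the total excess
    over [K] coordinates is at most 1/16. The losses [e] and [e'] of the divisor bounds must stay
    well below [q]; [e'] has a further factor [q] because it gets multiplied by [K]. *)
Local Notation K := (k.+1%:R : R).
Local Notation q := (K^-1).
Local Notation gamma := (K / 4 - q / 64).
Local Notation e := (q / 96).
Local Notation e' := (q ^+ 2 / 96).

Let K0 : 0 < K. Proof. by rewrite ltr0n. Qed.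
Let K1 : 1 <= K. Proof. by rewrite ler1n. Qed.
Let q0 : 0 < q. Proof. by rewrite invr_gt0. Qed.
Let q1 : q <= 1. Proof. by rewrite invf_le1. Qed.
Let Kq : K * q = 1. Proof. by rewrite divff// gt_eqF. Qed.
Let Kqq : K * q ^+ 2 = q. Proof. by rewrite expr2 mulrA Kq mul1r. Qed.
Let qq : q ^+ 2 <= q. Proof. by rewrite expr2 ger_pMl. Qed.
Let qq0 : 0 < q ^+ 2. Proof. by rewrite exprn_gt0. Qed.
Let kE : (k%:R : R) = K - 1. Proof. by rewrite -natr1 addrK. Qed.
Let e0 : 0 < e. Proof. by rewrite divr_gt0. Qed.
Let e1 : e <= 1 / 2. Proof. by move: q1; move: (q) => u; lra. Qed.
Let e'0 : 0 < e'. Proof. by rewrite divr_gt0. Qed.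
Let e'1 : e' <= 1 / 2. Proof. by move: q1 qq; move: (q ^+ 2) (q) => u v; lra. Qed.

Let Kq8 : 0 <= K / 4 - q / 8.
Proof. by move: K1 q1; move: (q) => v; move: (K) => t; lra. Qed.

Lemma sqrt_prod_powR (x c1 c2 u v w : R) : 1 <= x -> 0 <= c1 -> 0 <= c2 -> u / 2 + v / 2 <= w ->
  Num.sqrt (c1 * x `^ u) * Num.sqrt (c2 * x `^ v) <= Num.sqrt c1 * Num.sqrt c2 * x `^ w.
Proof.
move=> x1 c10 c20 uvw; have x0 : 0 < x by apply: lt_le_trans x1.
rewrite !sqrtrM// mulrACA ler_wpM2l ?mulr_ge0 ?sqrtr_ge0//.
rewrite -!powR12_sqrt ?powR_ge0// -!powRrM -powRD ?(gt_eqF x0) ?implybT//.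
by apply: powR_le_max => //; lra.
Qed.

Lemma sum_bad_small : exists2 C : R, 0 < C & forall z h (i : 'I_k.+1), (0 < h)%N ->
  \sum_(a : {ffun 'I_k.+1 -> 'I_(np (pr z) ^ 2)} | (np (pr z) ^ 2 %| \sum_i a i)%N &&
     ((np (rs z (a i)))%:R <= h%:R `^ (1 / 2 - q / 16) :> R)) \prod_i wt R h (a i) <=
  C * h%:R `^ gamma.
Proof.
have [C C0 HC] := @realS_le R (2 * k) _ e0.
exists (Num.sqrt 36 * Num.sqrt C) => [|z h i h0]; first by rewrite mulr_gt0 ?sqrtr_gt0.
have h1 : 1 <= (h%:R : R) by rewrite ler1n.
apply: le_trans (bad_coord R h (B := fun a => (np (rs z a))%:R <= h%:R `^ (1 / 2 - q / 16)) _ _) _.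
  by move=> a; rewrite rs_negI.
apply: le_trans (ler_pM _ _ (ler_wsqrtr (sum_wt_sqr_small z h _)) (ler_wsqrtr (HC z h h0))) _;
  rewrite ?sqrtr_ge0 ?powR_ge0//.
apply: sqrt_prod_powR => //; first exact: ltW.
by rewrite natrM kE; move: q0; move: (q) => v v0; move: (K) => u; lra.
Qed.

Lemma sum_bad_large : exists2 C : R, 0 < C & forall z h (i : 'I_k.+1), (0 < h)%N ->
  \sum_(a : {ffun 'I_k.+1 -> 'I_(np (pr z) ^ 2)} | (np (pr z) ^ 2 %| \sum_i a i)%N &&
     (h%:R `^ (1 / 2 + q / 16) < (np (rs z (a i)))%:R :> R)) \prod_i wt R h (a i) <=
  C * h%:R `^ gamma.
Proof.
have [C C0 HC] := @realS_le R (2 * k) _ e0.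
have eV : 0 < 1 + e^-1 by rewrite addr_gt0// invr_gt0.
exists (Num.sqrt (54 * (1 + e^-1)) * Num.sqrt C) => [|z h i h0].
  by rewrite mulr_gt0 ?sqrtr_gt0// mulr_gt0.
have h1 : 1 <= (h%:R : R) by rewrite ler1n.
have hp : 0 < (h%:R : R) by rewrite ltr0n.
apply: le_trans (bad_coord R h (B := fun a => h%:R `^ (1 / 2 + q / 16) < (np (rs z a))%:R) _ _) _.
  by move=> a; rewrite rs_negI.
have H : 54 * h%:R * ((h%:R `^ (1 / 2 + q / 16)) `^ (-1 + 2 * e) * (1 + e^-1)) <=
   54 * (1 + e^-1) * h%:R `^ (1 / 2 - q / 16 + 2 * e).
  rewrite mulrAC mulrA -!mulrA ler_wpM2l// mulrCA ler_wpM2l ?(ltW eV)//.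
  rewrite mulrC -{1}(powRr1 (ltW hp)) -powRrM -powRD ?(gt_eqF hp) ?implybT//.
  apply: powR_le_max => //.
  have -> : 1 + (1 / 2 + q / 16) * (-1 + 2 * e) = 1 / 2 - q / 16 + e + q * e / 8 by field.
  have : q * e <= e by rewrite ger_pMl.
  by move: (q * e) => u; move: q0; move: (q) => v; lra.
apply: le_trans (ler_pM _ _ (ler_wsqrtr (le_trans (sum_wt_sqr_large z h0 _ e0 e1) H))
  (ler_wsqrtr (HC z h h0))) _; rewrite ?sqrtr_ge0 ?powR_gt0//.
have c0 : 0 <= 54 * (1 + e^-1) by rewrite mulr_ge0 ?(ltW eV).
apply: sqrt_prod_powR => //; first exact: ltW.
by rewrite natrM kE; move: q0; move: (q) => v v0; move: (K) => u; lra.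
Qed.

Local Notation tt := (K / 4 + q / 16).

(** [tt] exceeds the critical exponent [K / 4] by [q / 16], which Finner converts into a gain.
    Counting tuples below [h ^ tt] would lose the same amount; [sum_large_gs] regains it. *)
Lemma sum_large_cup : exists2 C : R, 0 < C & forall z h, (0 < h)%N ->
  \sum_(a : {ffun 'I_k.+1 -> 'I_(np (pr z) ^ 2)} | (np (pr z) ^ 2 %| \sum_i a i)%N &&
     (h%:R `^ tt < (np (cup (types a)))%:R :> R)) \prod_i wt R h (a i) <=
  C * h%:R `^ gamma.
Proof.
have [C C0 HC] := @sum_large_types R k.+1 _ e'0 e'1; exists C => // z h h0.
have h1 : 1 <= (h%:R : R) by rewrite ler1n.
have hp : 0 < (h%:R : R) by rewrite ltr0n.
apply: le_trans (HC z h _ h0 (powR_gt0 _ hp)) _.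
rewrite -mulrA ler_wpM2l ?(ltW C0)// sqrt_powR ?(ltW hp)// -powRrM -powRD ?(gt_eqF hp) ?implybT//.
apply: powR_le_max => //.
have -> : K / 2 + tt * (-1 + 2 * e') = K / 4 - q / 16 + (K * q ^+ 2 / 192 + q * q ^+ 2 / 768) by field.
have : q * q ^+ 2 <= q by apply: le_trans qq; rewrite ger_pMl.
by rewrite Kqq; move: (q * q ^+ 2) => u; move: q0; move: (q) => v; move: (K) => t; lra.
Qed.

(** The quotient of the sum by the modulus. It takes boundedly many values, and fixing it turns the
    congruence for the sum into the equality required by [cut_inj]. *)
Let modsum z (a : {ffun 'I_k.+1 -> 'I_(np (pr z) ^ 2)}) : 'I_k.+2 :=
  inord ((\sum_i a i) %/ (np (pr z) ^ 2)).

Let modsumE z (a : {ffun 'I_k.+1 -> 'I_(np (pr z) ^ 2)}) : (np (pr z) ^ 2 %| \sum_i a i)%N ->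
  (\sum_i a i = modsum a * np (pr z) ^ 2)%N.
Proof.
move=> aN; rewrite inordK ?divnK// ltnS leq_divLR//.
apply: leq_trans (_ : \sum_(i < k.+1) np (pr z) ^ 2 <= _)%N; last by rewrite sum_nat_const card_ord.
by apply: leq_sum => i _; exact: ltnW.
Qed.

(** These tuples are counted by their cut radicals, whose union is smaller by a factor
    [h ^ (3 * (q / 16))]. This outweighs the excess [q / 16] in [tt] and leaves the exponent
    [K / 4 - q / 8]. *)
Lemma sum_large_gs : exists2 C : R, 0 < C & forall z h (j : 'I_k), (0 < h)%N ->
  \sum_(a : {ffun 'I_k.+1 -> 'I_(np (pr z) ^ 2)} | [&& (np (pr z) ^ 2 %| \sum_i a i)%N,
     ~~ (np (pr z) ^ 2 %| a ord0 + a (lift ord0 j))%N,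
     ((np (cup (types a)))%:R <= h%:R `^ tt :> R) &
     (h%:R `^ (3 * (q / 16)) <= (np (gs (types a) ord0 (lift ord0 j)))%:R :> R)])
    \prod_i wt R h (a i) <= C * h%:R `^ gamma.
Proof.
have [C C0 HC] := @count_tuples R k.+1 _ e'0; exists (C * k.+2%:R) => [|z h j h0]; first by rewrite mulr_gt0.
have h1 : 1 <= (h%:R : R) by rewrite ler1n.
have hp : 0 < (h%:R : R) by rewrite ltr0n.
have p1 (u : R) : 0 <= u -> 1 <= (h%:R : R) `^ u by move=> u0; rewrite -[leLHS](powRr0 (h%:R : R)) powR_le_max.
pose P (a : {ffun 'I_k.+1 -> 'I_(np (pr z) ^ 2)}) := [&& (np (pr z) ^ 2 %| \sum_i a i)%N,
     ~~ (np (pr z) ^ 2 %| a ord0 + a (lift ord0 j))%N,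
     ((np (cup (types a)))%:R <= h%:R `^ tt :> R) &
     (h%:R `^ (3 * (q / 16)) <= (np (gs (types a) ord0 (lift ord0 j)))%:R :> R)].
have := HC z h k.+2 (h%:R `^ tt) (h%:R `^ (K / 4 - q / 8)) P
  (fun a => cut (types a) ord0 (lift ord0 j)) (@modsum z).
move=> H; apply: le_trans (H _ _ _ _ _) _.
- by apply: p1; rewrite addr_ge0 ?divr_ge0 ?(ltW K0) ?(ltW q0).
- exact: p1 Kq8.
- move=> a /and4P[_ _ aT aG]; split.
    apply: subset_trans (cut_sub _ _ _) _; apply: subset_trans (subsetDl _ _) _; exact: cup_types.
  have -> : K / 4 - q / 8 = tt - 3 * (q / 16) by field.
  rewrite powRD ?(gt_eqF hp) ?implybT// powRN ler_pdivlMr ?powR_gt0//.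
  apply: le_trans aT; apply: le_trans (_ : (np (cup (cut (types a) ord0 (lift ord0 j))))%:R *
    (np (gs (types a) ord0 (lift ord0 j)))%:R <= _); first by rewrite ler_wpM2l.
  by rewrite -natrM ler_nat np_cut// cup_types.
- by move=> a /and4P[].
- move=> a b /and4P[aN anN _ _] /and4P[bN _ _ _] cab mab hab bab.
  by apply: (cut_inj R (i := ord0) (j := lift ord0 j)) => //; rewrite (modsumE aN) (modsumE bN) mab.
rewrite -[leLHS]mulrA ler_wpM2l ?mulr_ge0 ?(ltW C0)// -!powRrM -powRD ?(gt_eqF hp) ?implybT//.
apply: powR_le_max => //.
have -> : tt * e' + (K / 4 - q / 8) * (1 + e') = K / 4 - q / 8 + (K * q ^+ 2 / 192 - q * q ^+ 2 / 1536) by field.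
have : 0 <= q * q ^+ 2 by rewrite mulr_ge0 ?(ltW q0)// ltW.
by rewrite Kqq; move: (q * q ^+ 2) => u; move: q0; move: (q) => v; move: (K) => t; lra.
Qed.

(** If no other fraction shares many primes with the first one alone, most primes of the first
    radical lie in three sets, and [np_triple] makes the union small. In the exponent of its square,
    the gain 1/2 from the first radical exceeds the losses 1/16 (radicals above [sqrt h]) and 3/16
    (the sets [gs]). *)
Lemma np_cup_small z (h : nat) (a : {ffun 'I_k.+1 -> 'I_(np (pr z) ^ 2)}) : (0 < h)%N ->
  (np (pr z) ^ 2 %| \sum_i a i)%N ->
  h%:R `^ (1 / 2 - q / 16) <= (np (rs z (a ord0)))%:R :> R ->
  (forall i, (np (rs z (a i)))%:R <= h%:R `^ (1 / 2 + q / 16) :> R) ->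
  (forall j : 'I_k, (np (gs (types a) ord0 (lift ord0 j)))%:R <= h%:R `^ (3 * (q / 16)) :> R) ->
  (np (cup (types a)))%:R <= h%:R `^ (K / 4 - 1 / 8 - q / 16) :> R.
Proof.
move=> h0 aN a0 aR aG; have h1 : 1 <= (h%:R : R) by rewrite ler1n.
have hp : 0 < (h%:R : R) by rewrite ltr0n.
have cov p : p \in cup (types a) -> (1 < #|[pred i | p \in types a i]|)%N by exact: types_cover.
have := np_triple (cup_types a) cov; rewrite -(ler_nat R) natrM natrX natr_prod.
have := np_gs_triple (cup_types a) cov; rewrite -(ler_nat R) natrM [X in _ <= _ * X]natr_prod.
set u := np (triple _); set U := np (cup _) => H2 H1.
set x : R := h%:R in hp h1 a0 aR aG *.
have H3 : \prod_(i < k.+1) (np (types a i))%:R <= x `^ ((1 / 2 + q / 16) * K).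
  rewrite powRrM powR_mulrn ?powR_ge0//; set y := x `^ _.
  rewrite (_ : y ^+ k.+1 = \prod_(i < k.+1) y); last by rewrite prodr_const card_ord.
  by apply: ler_prod => i _; rewrite ler0n ffunE aR.
have H4 : \prod_(j < k) (np (gs (types a) ord0 (lift ord0 j)))%:R <= x `^ (3 * (q / 16) * k%:R).
  rewrite powRrM powR_mulrn ?powR_ge0//; set y := x `^ _.
  rewrite (_ : y ^+ k = \prod_(i < k) y); last by rewrite prodr_const card_ord.
  by apply: ler_prod => i _; rewrite ler0n aG.
have H5 : x `^ (1 / 2 - q / 16) <= u%:R * x `^ (3 * (q / 16) * k%:R).
  apply: le_trans a0 _; rewrite -[rs z _](ffunE (fun i => rs z (a i))) -/(types a).
  by apply: le_trans H2 _; rewrite ler_wpM2l.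
have H6 : U%:R ^+ 2 * u%:R <= x `^ ((1 / 2 + q / 16) * K) := le_trans H1 H3.
have H7 : U%:R ^+ 2 * x `^ (1 / 2 - q / 16) <= x `^ ((1 / 2 + q / 16) * K + 3 * (q / 16) * k%:R).
  apply: le_trans (ler_wpM2l _ H5) _; first by rewrite exprn_ge0.
  by rewrite [leLHS]mulrA powRD ?(gt_eqF hp) ?implybT// ler_wpM2r ?powR_ge0.
rewrite -ler_sqr ?nnegrE ?powR_ge0//.
rewrite -(ler_pM2r (powR_gt0 (1 / 2 - q / 16) hp)); apply: le_trans H7 _.
rewrite -powR_mulrn ?powR_ge0// -powRrM -powRD ?(gt_eqF hp) ?implybT//.
apply: powR_le_max => //; rewrite kE.
have -> : (1 / 2 + q / 16) * K + 3 * (q / 16) * (K - 1) =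
  K / 2 + (K * q) / 16 + 3 / 16 * (K * q) - 3 / 16 * q by field.
by rewrite Kq; move: (q) => v; move: (K) => t; lra.
Qed.

Lemma sum_small_gs : exists2 C : R, 0 < C & forall z h, (0 < h)%N ->
  \sum_(a : {ffun 'I_k.+1 -> 'I_(np (pr z) ^ 2)} | (np (pr z) ^ 2 %| \sum_i a i)%N &&
     ((np (cup (types a)))%:R <= h%:R `^ (K / 4 - 1 / 8 - q / 16) :> R))
    \prod_i wt R h (a i) <= C * h%:R `^ gamma.
Proof.
have [C C0 HC] := @count_tuples R k.+1 _ e'0; exists C => // z h h0.
have h1 : 1 <= (h%:R : R) by rewrite ler1n.
have hp : 0 < (h%:R : R) by rewrite ltr0n.
pose Y : R := h%:R `^ (K / 4 - 1 / 8 - q / 16).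
have Y1 : 1 <= Y by rewrite -[leLHS](powRr0 (h%:R : R)) powR_le_max//; move: K1 q1; move: (q) => v; move: (K) => t; lra.
pose P (a : {ffun 'I_k.+1 -> 'I_(np (pr z) ^ 2)}) := (np (pr z) ^ 2 %| \sum_i a i)%N &&
     ((np (cup (types a)))%:R <= Y).
apply: le_trans (HC z h 1%N Y Y P (@types z k.+1) (fun=> ord0) Y1 Y1 _ _ _) _.
- by move=> a /andP[_ ?]; split=> //; exact: cup_types.
- by move=> a /andP[].
- move=> a b _ _ tab _ hab bab; apply/ffunP => i; apply: rep_inj => //.
  by have := congr1 (fun T : {ffun 'I_k.+1 -> {set 'I_z}} => T i) tab; rewrite !ffunE.
rewrite mulr1 -mulrA ler_wpM2l ?(ltW C0)// /Y -!powRrM -powRD ?(gt_eqF hp) ?implybT//.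
apply: powR_le_max => //.
have -> : (K / 4 - 1 / 8 - q / 16) * e' + (K / 4 - 1 / 8 - q / 16) * (1 + e') =
  K / 4 - 1 / 8 - q / 16 + (K * q ^+ 2 / 192 - q ^+ 2 / 384 - q * q ^+ 2 / 768) by field.
have : 0 <= q * q ^+ 2 by rewrite mulr_ge0 ?(ltW q0)// ltW.
rewrite Kqq; move: (q * q ^+ 2) => u; move: q0 qq0; move: (q ^+ 2) => v; move: (q) => w; move: (K) => t; lra.
Qed.

Definition realU z h : R :=
  \sum_(a : {ffun 'I_k.+1 -> 'I_(np (pr z) ^ 2)} | (np (pr z) ^ 2 %| \sum_i a i)%N &&
     [forall j : 'I_k, ~~ (np (pr z) ^ 2 %| a ord0 + a (lift ord0 j))%N]) \prod_i wt R h (a i).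

Lemma realU_le : exists2 C : R, 0 < C & forall z h, (0 < h)%N -> realU z h <= C * h%:R `^ gamma.
Proof.
have [C1 C10 H1] := sum_bad_small; have [C2 C20 H2] := sum_bad_large.
have [C3 C30 H3] := sum_large_cup; have [C4 C40 H4] := sum_large_gs.
have [C5 C50 H5] := sum_small_gs.
exists (C1 + (K * C2 + (C3 + (k%:R * C4 + C5)))) => [|z h h0].
  by rewrite addr_gt0// addr_gt0 ?mulr_gt0// addr_gt0// ltr_wpDl// mulr_ge0// ltW.
set x := h%:R `^ gamma; have x0 : 0 <= x by exact: powR_ge0.
have w0 (a : {ffun 'I_k.+1 -> 'I_(np (pr z) ^ 2)}) : 0 <= \prod_i wt R h (a i).
  by apply: prodr_ge0 => i _; exact: wt_ge0.
set N := (np (pr z) ^ 2)%N in w0 *.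
pose P0 (a : {ffun 'I_k.+1 -> 'I_N}) := (N %| \sum_i a i)%N.
pose B1 (a : {ffun 'I_k.+1 -> 'I_N}) := (np (rs z (a ord0)))%:R <= h%:R `^ (1 / 2 - q / 16) :> R.
pose B2 i (a : {ffun 'I_k.+1 -> 'I_N}) := h%:R `^ (1 / 2 + q / 16) < (np (rs z (a i)))%:R :> R.
pose B3 (a : {ffun 'I_k.+1 -> 'I_N}) := h%:R `^ tt < (np (cup (types a)))%:R :> R.
pose B4 (j : 'I_k) (a : {ffun 'I_k.+1 -> 'I_N}) := [&& ~~ (N %| a ord0 + a (lift ord0 j))%N,
   (np (cup (types a)))%:R <= h%:R `^ tt :> R &
   h%:R `^ (3 * (q / 16)) <= (np (gs (types a) ord0 (lift ord0 j)))%:R :> R].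
pose P1 a := P0 a && [forall j : 'I_k, ~~ (N %| a ord0 + a (lift ord0 j))%N].
apply: le_trans (sum_cover2 (Q1 := fun a => P0 a && B1 a) (Q2 := fun a => P1 a && ~~ B1 a) w0 _) _.
  by move=> a; rewrite /P1 /P0 => /andP[-> ->]/=; exact: orbN.
rewrite mulrDl lerD ?H1//.
apply: le_trans (sum_cover2 (Q1 := fun a => P0 a && [exists i, B2 i a])
   (Q2 := fun a => [&& P1 a, ~~ B1 a & [forall i, ~~ B2 i a]]) w0 _) _.
  move=> a /andP[P1a B1a]; have /andP[P0a _] := P1a; rewrite P0a P1a B1a/= -negb_exists; exact: orbN.
rewrite mulrDl; apply: lerD.
  apply: le_trans (sum_cover_exists (Q := fun i a => P0 a && B2 i a) w0 _) _.
    by move=> a /andP[-> /existsP[i ?]]; exists i.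
  apply: le_trans (ler_sum _ (fun i _ => H2 z h i h0)) _.
  by rewrite sumr_const card_ord -[_ *+ _]mulr_natl mulrA.
apply: le_trans (sum_cover2 (Q1 := fun a => P0 a && B3 a)
   (Q2 := fun a => [&& P1 a, ~~ B1 a, [forall i, ~~ B2 i a] & ~~ B3 a]) w0 _) _.
  move=> a /and3P[P1a B1a B2a]; have /andP[P0a _] := P1a; rewrite P0a P1a B1a B2a/=; exact: orbN.
rewrite mulrDl lerD ?H3//.
apply: le_trans (sum_cover2 (Q1 := fun a => P0 a && [exists j, B4 j a])
   (Q2 := fun a => P0 a && ((np (cup (types a)))%:R <= h%:R `^ (K / 4 - 1 / 8 - q / 16) :> R)) w0 _) _.
  move=> a /and4P[/andP[P0a Pa] B1a /forallP B2a B3a]; rewrite P0a/=.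
  case: (boolP [exists j, B4 j a]) => //= /existsPn B4a; apply: np_cup_small => //.
  - by move: B1a; rewrite -ltNge => /ltW.
  - by move=> i; rewrite leNgt; exact: B2a.
  move=> j; have := B4a j; rewrite /B4 (forallP Pa j)/= negb_and -!ltNge.
  by move: B3a; rewrite /B3 => /negbTE ->/= => /ltW.
rewrite mulrDl lerD ?H5//.
apply: le_trans (sum_cover_exists (Q := fun j a => P0 a && B4 j a) w0 _) _.
  by move=> a /andP[-> /existsP[i ?]]; exists i.
apply: le_trans (ler_sum _ (fun j _ => H4 z h j h0)) _.
by rewrite sumr_const card_ord -[_ *+ _]mulr_natl mulrA.
Qed.

End unpaired_bound.

(** * Recurrence for the moments *)

Section moments_recurrence.
Variable R : realType.

Definition mom z h k : R := pavg z (fun n => dev R z h n ^+ k).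

Lemma mom_recurrence_le z h k :
  `|mom z h k.+2 - k.+1%:R * mom z h 2 * mom z h k| <=
  realU R k.+1 z h + (k.+1 ^ 2)%:R * 9 * realS R z h k.
Proof.
have N0 := prz_gt0 z; set N := (np (pr z) ^ 2)%N in N0 *.
have := @moment_recurrence R[i] N (om R N) N0 (@om_N R N N0) (@om_neq1 R N N0)
  (@al R z h) (fun a => (wt R h a)%:C)%C (3%:C)%C (al_le R h) _ k.
rewrite !dev_moment -!/(mom _ _ _) => H.
rewrite -lecR; apply: le_trans (le_trans (H _) _).
- rewrite le_eqVlt; apply/orP; left; apply/eqP.
  rewrite -[k.+1%:R in RHS](rmorph_nat (real_complex R)) -!rmorphM -rmorphB.
  by rewrite normc_def /= expr0n addr0 sqrtr_sqr.
- by move=> a; rewrite lecR wt_le3.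
rewrite le_eqVlt; apply/orP; left; apply/eqP; rewrite [RHS]rmorphD ![in RHS]rmorphM [in RHS]rmorph_nat; congr (_ + _ * _ * _).
- by rewrite /tupU /realU rmorph_sum/=; apply: eq_bigr => a _; rewrite rmorph_prod.
- by rewrite -rmorphXn; congr (_%:C)%C; ring.
- by rewrite /tupS /realS rmorph_sum/=; apply: eq_bigr => a _; rewrite rmorph_prod.
Qed.

Lemma mom_recurrence k : exists2 C : R, 0 < C & forall z h, (0 < h)%N ->
  `|mom z h k.+2 - k.+1%:R * mom z h 2 * mom z h k| <=
  C * h%:R `^ (k.+2%:R / 4 - k.+2%:R^-1 / 64).
Proof.
have [C1 C10 H1] := @realU_le R k.+1.
(* Tuples with two cancelling entries leave a sum over [k] coordinates, smaller by [h ^ (1 / 2)]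
   than the main term, so a loss of 1/4 is affordable. *)
have e0 : 0 < (1 / 4 : R) by rewrite divr_gt0.
have [C2 C20 H2] := @realS_le R k _ e0.
exists (C1 + (k.+1 ^ 2)%:R * 9 * C2) => [|z h h0]; first by rewrite addr_gt0// !mulr_gt0// ltr0n expn_gt0.
have h1 : 1 <= (h%:R : R) by rewrite ler1n.
apply: le_trans (mom_recurrence_le z h k) _; rewrite mulrDl lerD ?H1//.
rewrite -[leRHS]mulrA ler_wpM2l ?mulr_ge0//; apply: le_trans (H2 z h h0) _.
rewrite ler_wpM2l ?(ltW C20)// powR_le_max//.
have -> : (k.+2%:R : R) = k%:R + 2 by rewrite -addn2 natrD.
have k2 : 1 <= (k%:R + 2 : R) by rewrite (le_trans _ (_ : 2 <= _))// lerDr.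
have : (k%:R + 2 : R)^-1 <= 1 by rewrite invf_le1// (lt_le_trans ltr01).
by set u := (_ + 2)^-1; move: u (k%:R : R) => u v; lra.
Qed.

Lemma mom0 z h : mom z h 0 = 1.
Proof. by rewrite /mom (_ : (fun=> _) = fun=> 1) ?pavg_cst//; apply: funext => n; rewrite expr0. Qed.

Lemma per_sqz z : per (np (pr z) ^ 2) (fun n => (sqz z n)%:R : R).
Proof.
move=> n m nm; congr (nat_of_bool _)%:R; apply: eq_forallb_in => p pp.
congr (~~ _); have pN : (p ^ 2 %| np (pr z) ^ 2)%N by rewrite dvdn_exp2r// (npD1 pp) dvdn_mulr.
by rewrite /dvdn -(modn_dvdm n pN) nm modn_dvdm.
Qed.

Lemma mom1 z h : mom z h 1 = 0.
Proof.
rewrite /mom (_ : (fun=> _) = fun n => \sum_(1 <= m < h.+1) (sqz z (n + m))%:R + (- (h%:R * dens R z)) * 1); last first.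
  by apply: funext => n; rewrite expr1 mulr1.
rewrite pavgD pavgZ pavg_cst pavg_sum mulr1.
under eq_bigr do rewrite (pavg_shift _ (@per_sqz z)).
by rewrite sumr_const_nat subn1/= -/(dens R z) mulr_natl subrr.
Qed.

End moments_recurrence.

(** * The variance *)

Section variance.
Variables (R : realType) (z : nat).
Implicit Types (S : {set 'I_z}).

Lemma sum_eqmod D h : (0 < D)%N ->
  (\sum_(1 <= m < h.+1) \sum_(1 <= m' < h.+1) (m == m' %[mod D]) =
   D * (h %/ D) ^ 2 + 2 * (h %/ D) * (h %% D) + h %% D)%N.
Proof.
move=> D0; elim: h => [|h IH]; first by rewrite !big_geq// div0n mod0n exp0n// !muln0.
have cnt : (\sum_(1 <= m < h.+1) (m == h.+1 %[mod D]) = h %/ D)%N.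
  rewrite divn_count_dvd big_nat_rev/= add1n !big_nat; apply: eq_bigr => j /andP[j0 jh].
  by rewrite subSS eq_sym eqn_mod_dvd ?leq_subr// subKn// ltnW.
rewrite big_nat_recr//=; under eq_bigr do rewrite big_nat_recr//=.
rewrite big_split/= IH cnt [X in (_ + X)%N]big_nat_recr//= eqxx.
have -> : (\sum_(1 <= i < h.+1) (h.+1 == i %[mod D]) = h %/ D)%N.
  by rewrite -cnt; apply: eq_bigr => i _; rewrite eq_sym.
have := divn_eq h D; have := ltn_pmod h D0.
set q := (h %/ D)%N; set r := (h %% D)%N => rD hE.
have [rD1|rD1] := ltnP r.+1 D.
  have -> : (h.+1 %/ D = q)%N by rewrite hE -addnS divnMDl// divn_small// addn0.
  have -> : (h.+1 %% D = r.+1)%N by rewrite hE -addnS modnMDl modn_small.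
  by clear; lia.
have DE : D = r.+1 by apply/eqP; rewrite eqn_leq rD rD1.
have -> : (h.+1 %/ D = q.+1)%N by rewrite hE -addnS -DE -mulSnr mulnK.
have -> : (h.+1 %% D = 0)%N by rewrite hE -addnS -DE -mulSnr modnMl.
by rewrite DE; clear; lia.
Qed.

Lemma sum_eqmod_frp D h : (0 < D)%N ->
  (\sum_(1 <= m < h.+1) \sum_(1 <= m' < h.+1) (m == m' %[mod D]))%:R =
  h%:R ^+ 2 / D%:R + D%:R * frp h D :> R.
Proof.
move=> D0; rewrite sum_eqmod// /frp; have Dn : (D%:R : R) != 0 by rewrite pnatr_eq0 -lt0n.
have hE : (h%:R : R) = (h %/ D)%:R * D%:R + (h %% D)%:R by rewrite -natrM -natrD -divn_eq.
rewrite [X in _ = X ^+ 2 / _ + _]hE {hE}.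
rewrite !natrD !natrM; move: (h %/ D)%:R (h %% D)%:R (D%:R : R) Dn => q r d dn.
by field.
Qed.

Lemma sqz_prod n : (sqz z n)%:R = \prod_(p in pr z) (~~ (p ^ 2 %| n)%N)%:R :> R.
Proof.
rewrite /sqz; case: 'forall_implyP => [H|/'forall_implyP].
  by rewrite big1// => p /H ->.
by rewrite negb_forall_in => /exists_inP[p pp /negbTE pn]; rewrite (bigD1 p)//= pn mul0r.
Qed.

Lemma sum_not_dvd2 D m m' : (0 < D)%N ->
  \sum_(0 <= n < D) ((~~ (D %| n + m)%N)%:R * (~~ (D %| n + m')%N)%:R) =
  D%:R - 2 + (m == m' %[mod D])%:R :> R.
Proof.
move=> D0.
have E n : (~~ (D %| n + m)%N)%:R * (~~ (D %| n + m')%N)%:R =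
  1 - (D %| n + m)%:R - (D %| n + m')%:R + (m == m' %[mod D])%:R * (D %| n + m)%:R :> R.
  have -> : (m == m' %[mod D])%:R * (D %| n + m)%:R = ((D %| n + m)%N && (D %| n + m')%N)%:R :> R.
    rewrite -natrM mulnb; congr (nat_of_bool _)%:R; case: (boolP (D %| n + m)%N) => [d|]; last by rewrite andbF.
    rewrite andbT/= -(eqn_modDl n) (eqP d).
    by rewrite eq_sym.
  by case: (D %| n + m)%N; case: (D %| n + m')%N; rewrite /= ?mulr0 ?mul0r ?mulr1; ring.
under eq_bigr do rewrite E.
rewrite big_split/= !sumrB -mulr_sumr !sum_dvd_shift// mulr1 sumr_const_nat subn0.
by congr (_ + _); ring.
Qed.

Lemma sum_not_dvd D m : (0 < D)%N ->
  \sum_(0 <= n < D) (~~ (D %| n + m)%N)%:R = D%:R - 1 :> R.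
Proof.
move=> D0; have E n : (~~ (D %| n + m)%N)%:R = 1 - (D %| n + m)%:R :> R.
  by case: (D %| n + m)%N; rewrite /= ?subrr ?subr0.
by under eq_bigr do rewrite E; rewrite sumrB sum_dvd_shift// sumr_const_nat subn0.
Qed.

Lemma per_dvd_shift D m : per D (fun n => (~~ (D %| n + m)%N)%:R : R).
Proof. by move=> n n' nn; rewrite /dvdn -modnDml nn modnDml. Qed.

Lemma sqr_prime_ge4 (p : 'I_z) : p \in pr z -> 4 <= (p%:R : R) ^+ 2.
Proof.
move=> pp; have : (2 <= p)%N by rewrite prime_gt1// (pr_prime (subxx _) pp).
by rewrite -(ler_nat R) => p2; have -> : 4 = 2 ^+ 2 :> R; [ring|rewrite lerXn2r ?nnegrE].
Qed.

Lemma dens_prod : dens R z = \prod_(p in pr z) (1 - (p%:R ^+ 2)^-1).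
Proof.
rewrite /dens (_ : (fun n => _) = fun n => \prod_(p in pr z) (~~ (p ^ 2 %| n + 0)%N)%:R); last first.
  by apply: funext => n; rewrite addn0 sqz_prod.
rewrite (@pavg_prod R z (pr z) (fun p n => (~~ (p ^ 2 %| n + 0)%N)%:R))//; last by move=> p _; exact: per_dvd_shift.
apply: eq_bigr => p pp; have p0 : (0 < p ^ 2)%N by rewrite expn_gt0 prime_gt0// (pr_prime (subxx _) pp).
rewrite sum_not_dvd// natrX; have := sqr_prime_ge4 pp => p4; have : (p%:R : R) ^+ 2 != 0 by rewrite gt_eqF// (lt_le_trans _ p4).
by move: (_ ^+ 2) => x xn; field.
Qed.

Definition varW : R := \prod_(p in pr z) (1 - 2 / p%:R ^+ 2).
Definition varf S : R := \prod_(p in S) (p%:R ^+ 2 - 2)^-1.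

Lemma prod_1D_subsets (A : {set 'I_z}) (F : 'I_z -> R) :
  \prod_(i in A) (1 + F i) = \sum_(S : {set 'I_z} | S \subset A) \prod_(i in S) F i.
Proof.
rewrite big_mkcond/= (eq_bigr (fun i => (if i \in A then F i else 0) + 1)); last first.
  by move=> i _; case: ifP; rewrite ?add0r// addrC.
rewrite bigA_distr [RHS]big_mkcond; apply: eq_bigr => S _.
case: ifPn => [sSB|/subsetPn[i iS iB]]; last first.
  by rewrite (bigD1 i)//= iS (negbTE iB) mul0r.
rewrite [RHS]big_mkcond; apply: eq_bigr => i _.
by case: ifP => // iS; rewrite (subsetP sSB).
Qed.

Lemma eqmod_np S m m' : S \subset pr z ->
  \prod_(p in S) (m == m' %[mod p ^ 2])%:R = (m == m' %[mod np S ^ 2])%:R :> R.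
Proof.
move=> sS; wlog le : m m' / (m <= m')%N.
  move=> H; case/orP: (leq_total m m') => le; first exact: H.
  by rewrite eq_sym -H//; apply: eq_bigr => p _; rewrite eq_sym.
rewrite [in RHS]eq_sym eqn_mod_dvd// np_dvdn_exp//; case: 'forall_implyP => [H|/'forall_implyP].
  by rewrite big1// => p /H; rewrite -eqn_mod_dvd// eq_sym => ->.
rewrite negb_forall_in => /exists_inP[p pp pn]; rewrite (bigD1 p)//= eq_sym eqn_mod_dvd//.
by rewrite (negbTE pn) mul0r.
Qed.

(** Modulo [p ^ 2] the proportion avoiding both residues is [1 - 2 / p^2], increased by [1 / p^2]
    when they coincide: a factor [1 + 1 / (p^2 - 2)]. Expanding the product over primes gives the
    sum over [S]. *)
Lemma pair_corr m m' : pavg z (fun n => (sqz z (n + m))%:R * (sqz z (n + m'))%:R) =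
  varW * \sum_(S : {set 'I_z} | S \subset pr z) varf S * (m == m' %[mod np S ^ 2])%:R.
Proof.
rewrite (_ : (fun n => _) = fun n => \prod_(p in pr z) ((~~ (p ^ 2 %| n + m)%N)%:R * (~~ (p ^ 2 %| n + m')%N)%:R)); last first.
  by apply: funext => n; rewrite !sqz_prod -big_split.
rewrite (@pavg_prod R z (pr z) (fun p n => (~~ (p ^ 2 %| n + m)%N)%:R * (~~ (p ^ 2 %| n + m')%N)%:R))//; last first.
  by move=> p _ n n' nn; congr (_ * _); exact: per_dvd_shift.
rewrite (eq_bigr (fun S => \prod_(p in S) ((p%:R ^+ 2 - 2)^-1 * (m == m' %[mod p ^ 2])%:R))); last first.
  by move=> S sS; rewrite -eqmod_np// /varf -big_split.
rewrite -prod_1D_subsets /varW -big_split; apply: eq_bigr => p pp /=.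
have p0 : (0 < p ^ 2)%N by rewrite expn_gt0 prime_gt0// (pr_prime (subxx _) pp).
rewrite sum_not_dvd2// natrX; have := sqr_prime_ge4 pp; move: (_ ^+ 2) => x x4; move: (m == m' %[mod p ^ 2])%N => y.
have xn : x != 0 by rewrite gt_eqF// (lt_le_trans _ x4).
have x2 : x - 2 != 0 by rewrite gt_eqF// subr_gt0 (lt_le_trans _ x4)// ltr_nat.
by field; rewrite xn x2.
Qed.

(** [varf S] times the modulus [np S ^ 2], the latter coming from the factor [D] in
    [sum_eqmod_frp]. *)
Definition varg S : R := \prod_(p in S) (p%:R ^+ 2 / (p%:R ^+ 2 - 2)).

(** In the count of pairs congruent modulo [np S ^ 2], the terms in [h ^+ 2] add up to the square of
    the mean [h * dens] and cancel; only the [frp] parts remain. *)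
Lemma mom2_frp h : pavg z (fun n => dev R z h n ^+ 2) =
  varW * \sum_(S : {set 'I_z} | S \subset pr z) varg S * frp h (np S ^ 2).
Proof.
set d := dens R z.
pose s n : R := \sum_(1 <= m < h.+1) (sqz z (n + m))%:R.
have -> : (fun n => dev R z h n ^+ 2) = fun n =>
   \sum_(1 <= m < h.+1) \sum_(1 <= m' < h.+1) ((sqz z (n + m))%:R * (sqz z (n + m'))%:R) +
   ((- (2 * h%:R * d)) * s n + (h%:R * d) ^+ 2).
  apply: funext => n; rewrite /dev -/d -/(s n).
  have -> : \sum_(1 <= m < h.+1) \sum_(1 <= m' < h.+1) ((sqz z (n + m))%:R * (sqz z (n + m'))%:R) = s n * s n :> R.
    by rewrite /s mulr_suml; apply: eq_bigr => m _; rewrite mulr_sumr.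
  ring.
rewrite !pavgD pavgZ pavg_cst /s !pavg_sum.
under [X in _ + (_ * X + _)]eq_bigr do rewrite (@pavg_shift R z (fun n => (sqz z n)%:R) _ (@per_sqz R z)).
rewrite sumr_const_nat subn1/= -/(dens R z) -/d.
under eq_bigr do rewrite pavg_sum; under eq_bigr do under eq_bigr do rewrite pair_corr.
have -> : \sum_(1 <= m < h.+1) \sum_(1 <= m' < h.+1)
     varW * (\sum_(S : {set 'I_z} | S \subset pr z) varf S * (m == m' %[mod np S ^ 2])%:R) =
   varW * \sum_(S : {set 'I_z} | S \subset pr z) varf S *
      (\sum_(1 <= m < h.+1) \sum_(1 <= m' < h.+1) (m == m' %[mod np S ^ 2]))%:R.
  under eq_bigr do rewrite -mulr_sumr exchange_big/=.
  rewrite -mulr_sumr exchange_big/=; congr (_ * _); apply: eq_bigr => S _.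
  rewrite natr_sum mulr_sumr; apply: eq_bigr => m _.
  by rewrite natr_sum mulr_sumr.
have E S : S \subset pr z -> varf S * (\sum_(1 <= m < h.+1) \sum_(1 <= m' < h.+1) (m == m' %[mod np S ^ 2]))%:R =
   h%:R ^+ 2 * (\prod_(p in S) ((p%:R ^+ 2 * (p%:R ^+ 2 - 2))^-1)) + varg S * frp h (np S ^ 2).
  move=> sS; rewrite sum_eqmod_frp ?expn_gt0 ?np_gt0// mulrDr.
  have nE : ((np S ^ 2)%:R : R) = \prod_(p in S) (p%:R ^+ 2).
    by rewrite natrX /np natr_prod prodrXl.
  congr (_ + _).
    rewrite mulrCA nE -prodfV /varf -big_split/=; congr (_ * _).
    by apply: eq_bigr => p _; rewrite [RHS]invfM mulrC.
  rewrite mulrA; congr (_ * _); rewrite nE /varf /varg -big_split/=.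
  by apply: eq_bigr => p _; rewrite mulrC.
rewrite (eq_bigr _ E) big_split/= -mulr_sumr -prod_1D_subsets mulrDr.
have -> : varW * (h%:R ^+ 2 * \prod_(i in pr z) (1 + (i%:R ^+ 2 * (i%:R ^+ 2 - 2))^-1)) = h%:R ^+ 2 * d ^+ 2.
  rewrite mulrCA /d dens_prod -prodrXl /varW -big_split/=; congr (_ * _); apply: eq_bigr => p pp.
  have := sqr_prime_ge4 pp; move: (_ ^+ 2) => x x4.
  have xn : x != 0 by rewrite gt_eqF// (lt_le_trans _ x4).
  have x2 : x - 2 != 0 by rewrite gt_eqF// subr_gt0 (lt_le_trans _ x4)// ltr_nat.
  by field; rewrite xn x2.
rewrite -[_ *+ _]mulr_natl; move: (varW * _) => u; ring.
Qed.

End variance.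

(** * Asymptotic evaluation of the variance *)

Section variance_asymptotics.
Variable R : realType.

(** With the Fourier series cut at [z], the sum over [m] for frequency [b] is [Ssum] at
    [h * b / D^2], with main term [pi / 2 * sqrt (h * b) / D]; divided by [b^2] it yields the sum of
    [b^(-3/2)] behind the factor [zeta (3 / 2)] of [A]. The condition [h ^ 2 <= z] absorbs the cost
    of stopping the sum over [m]. *)
Lemma sum_frp_multiples (h z D : nat) : (0 < h)%N -> (h ^ 2 <= z)%N -> (0 < D)%N ->
  `|\sum_(1 <= m < (z.-1 %/ D).+1) frp h ((D * m) ^ 2) -
    Num.sqrt h%:R / (pi * D%:R) * \sum_(1 <= b < z.+1) (b%:R : R) `^ (- 1 - 1 / 2)|
  <= 562 * (h%:R `^ (1 / 3) * (D%:R : R) `^ (- (2 / 3))).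
Proof.
move=> h0 hz D0; set Y := (z.-1 %/ D)%N.
have z0 : (0 < z)%N by apply: leq_trans hz; rewrite expn_gt0 h0.
have hr : 1 <= (h%:R : R) by rewrite ler1n.
have zr : 0 < (z%:R : R) by rewrite ltr0n.
have Dr : 1 <= (D%:R : R) by rewrite ler1n.
have Dp : 0 < (D%:R : R) by rewrite ltr0n.
have hp : 0 < (h%:R : R) by rewrite ltr0n.
have pp := pi_gt0 R.
pose x (b : nat) : R := h%:R * b%:R / D%:R ^+ 2.
pose T := h%:R `^ (1 / 3) * (D%:R : R) `^ (- (2 / 3)).
have DV : (D%:R : R)^-1 <= T.
  rewrite -(powR_inv1 (ltW Dp)); apply: le_trans (_ : 1 * D%:R `^ (- (2 / 3)) <= _).
    by rewrite mul1r powR_le_max//; lra.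
  by rewrite ler_wpM2r ?powR_ge0// -[leLHS](powRr0 (h%:R : R)) powR_le_max// divr_ge0.
pose F : R := 2 / pi ^+ 2 * \sum_(1 <= b < z.+1) Ssum (x b) Y / b%:R ^+ 2.
have E1 : `|\sum_(1 <= m < Y.+1) frp h ((D * m) ^ 2) - F| <= 12 * T.
  have -> : F = \sum_(1 <= m < Y.+1) (2 / pi ^+ 2 *
      \sum_(1 <= b < z.+1) sin (pi * (h%:R * b%:R) / ((D * m) ^ 2)%:R) ^+ 2 / b%:R ^+ 2).
    rewrite /F -mulr_sumr exchange_big/=; congr (_ * _); apply: eq_bigr => b _.
    rewrite /Ssum mulr_suml; rewrite !big_nat; apply: eq_bigr => m /andP[m0 _].
    congr (sin _ ^+ 2 / _); rewrite /x natrX natrM exprMn.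
    have mn : (m%:R : R) != 0 by rewrite pnatr_eq0 -lt0n.
    by move: (pi : R) => p; field; rewrite mn gt_eqF.
  rewrite -sumrB; apply: le_trans (ler_norm_sum _ _ _) _.
  apply: le_trans (_ : \sum_(1 <= m < Y.+1) 12 / z%:R <= _).
    rewrite !big_nat; apply: ler_sum => m /andP[m0 _]; apply: frp_fourier => //.
    by rewrite expn_gt0 muln_gt0 D0 m0.
  rewrite sumr_const_nat subn1/= -[_ *+ _]mulr_natr -mulrA ler_wpM2l//.
  apply: le_trans DV; rewrite mulrC ler_pdivrMr// mulrC ler_pdivlMr// -natrM ler_nat.
  by rewrite (leq_trans (leq_trunc_div _ _))// leq_pred.
have E2 : `|F - Num.sqrt h%:R / (pi * D%:R) * \sum_(1 <= b < z.+1) (b%:R : R) `^ (- 1 - 1 / 2)| <= 550 * T.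
  have -> : Num.sqrt h%:R / (pi * D%:R) * \sum_(1 <= b < z.+1) (b%:R : R) `^ (- 1 - 1 / 2) =
     2 / pi ^+ 2 * \sum_(1 <= b < z.+1) (pi / 2 * Num.sqrt (x b)) / b%:R ^+ 2.
    rewrite !mulr_sumr !big_nat; apply: eq_bigr => b /andP[b0 _].
    have bp : 0 < (b%:R : R) by rewrite ltr0n.
    have -> : Num.sqrt (x b) = Num.sqrt h%:R * Num.sqrt b%:R / D%:R.
      by rewrite /x sqrtrM ?mulr_ge0// sqrtrM// sqrtrV ?exprn_ge0// sqrtr_sqr ger0_norm.
    have -> : (b%:R : R) `^ (- 1 - 1 / 2) = Num.sqrt b%:R / b%:R ^+ 2.
      rewrite -powR12_sqrt// -powR_mulrn// -powRN -powRD ?(gt_eqF bp) ?implybT//.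
      by congr (_ `^ _); field.
    move: (Num.sqrt h%:R) (Num.sqrt b%:R) (pi : R) pp => u v p /lt0r_neq0 pn.
    by field; rewrite pn gt_eqF// gt_eqF.
  rewrite /F -mulrBr -sumrB normrM ger0_norm; last by rewrite divr_ge0// exprn_ge0// pi_ge0.
  apply: le_trans (_ : 1 * (550 * T) <= _); last by rewrite mul1r.
  apply: ler_pM => //.
  - by rewrite divr_ge0// exprn_ge0// pi_ge0.
  - rewrite ler_pdivrMr ?exprn_gt0// mul1r; have := pi_ge2 R => p2.
    by apply: le_trans (_ : 2 ^+ 2 <= _); [rewrite expr2; lra|rewrite lerXn2r ?nnegrE ?pi_ge0].
  apply: le_trans (ler_norm_sum _ _ _) _.
  apply: le_trans (_ : \sum_(1 <= b < z.+1) (100 * T * b%:R `^ (- 1 - 2 / 3) + 100 * (h%:R / (D%:R * z%:R)) * (b%:R)^-1) <= _).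
    rewrite !big_nat; apply: ler_sum => b /andP[b0 _].
    have bp : 0 < (b%:R : R) by rewrite ltr0n.
    have xp : 0 < x b by rewrite divr_gt0 ?mulr_gt0// exprn_gt0.
    rewrite -mulrBl normrM [`|_^-1|]ger0_norm ?invr_ge0 ?exprn_ge0//.
    rewrite ler_pdivrMr ?exprn_gt0//; apply: le_trans (Ssum_asymp Y xp) _.
    have xE : x b = h%:R * b%:R * (D%:R : R) `^ (-2) by rewrite /x powRN powR_mulrn// ltW.
    have P1 : x b `^ (1 / 3) = T * b%:R `^ (1 / 3).
      rewrite xE !powRM ?mulr_ge0 ?powR_ge0// -powRrM /T mulrAC.
      by rewrite (_ : -2 * (1 / 3) = - (2 / 3) :> R)//; field.
    have P2 : (b%:R : R) `^ (1 / 3) = b%:R `^ (-1 - 2 / 3) * b%:R ^+ 2.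
      rewrite -powR_mulrn// -powRD ?(gt_eqF bp) ?implybT//.
      by rewrite (_ : -1 - 2 / 3 + 2%:R = 1 / 3 :> R)//; field.
    have P3 : x b / Y.+1%:R <= h%:R / (D%:R * z%:R) * b%:R.
      have -> : x b / Y.+1%:R = h%:R / (D%:R * (D%:R * Y.+1%:R)) * b%:R.
        rewrite /x; have yn : (Y.+1%:R : R) != 0 by [].
        by move: (Y.+1%:R : R) yn => y yn; field; rewrite yn gt_eqF.
      rewrite ler_wpM2r// ler_wpM2l// lef_pV2 ?posrE ?mulr_gt0// ler_wpM2l// -natrM ler_nat.
      by have := ltn_ceil z.-1 D0; rewrite prednK// mulnC.
    have -> : (100 * T * b%:R `^ (-1 - 2 / 3) + 100 * (h%:R / (D%:R * z%:R)) / b%:R) * b%:R ^+ 2 =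
      100 * (T * (b%:R `^ (-1 - 2 / 3) * b%:R ^+ 2) + h%:R / (D%:R * z%:R) * b%:R).
      by move: (h%:R / _) (_ `^ _) => u v; field; rewrite gt_eqF.
    by rewrite -P2 -P1 ler_wpM2l// lerD2l.
  rewrite big_split/= -!mulr_sumr.
  have S1 : \sum_(1 <= b < z.+1) (b%:R : R) `^ (-1 - 2 / 3) <= 5 / 2.
    have e0 : 0 < (2 / 3 : R) by rewrite divr_gt0.
    apply: le_trans (zeta_partial_bound _ e0) _.
    by rewrite [leLHS](_ : _ = 5 / 2)//; field.
  have S2 : \sum_(1 <= b < z.+1) (b%:R : R)^-1 <= 3 * z%:R `^ (1 / 2).
    have e0 : 0 < (1 / 2 : R) by rewrite divr_gt0.
    have := sum_inv_le e0 z0; rewrite -(big_mkord xpredT (fun b => (b%:R : R)^-1)) big_ltn// invr0 add0r.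
    by rewrite [X in _ <= X * _ -> _](_ : _ = 3)//; field.
  have S3 : h%:R / (D%:R * z%:R) * z%:R `^ (1 / 2) <= T.
    apply: le_trans DV; have sz : 0 < (z%:R : R) `^ (1 / 2) by exact: powR_gt0.
    have zz : (z%:R : R) = z%:R `^ (1 / 2) * z%:R `^ (1 / 2).
      by rewrite -powRD ?(gt_eqF zr) ?implybT// -splitr powRr1// ltW.
    rewrite {1}zz [leLHS](_ : _ = h%:R / z%:R `^ (1 / 2) * D%:R^-1); last first.
      by move: (_ `^ _) sz => s /lt0r_neq0 sn; field; rewrite sn gt_eqF.
    rewrite ler_piMl ?invr_ge0// ler_pdivrMr// !mul1r powR12_sqrt//.
    by rewrite -(ler_sqr) ?nnegrE ?sqrtr_ge0// sqr_sqrtr// -natrX ler_nat.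
  have T0 : 0 <= T by rewrite mulr_ge0 ?powR_ge0.
  rewrite (_ : 550 * T = 100 * T * (5 / 2) + 100 * (3 * T)); last by field.
  apply: lerD; first by rewrite ler_wpM2l// mulr_ge0.
  rewrite -mulrA ler_wpM2l//; apply: le_trans (ler_wpM2l _ S2) _; first by rewrite divr_ge0// mulr_ge0.
  by rewrite mulrCA ler_wpM2l.
rewrite -/T (_ : 562 = 12 + 550); last by ring.
rewrite [leRHS]mulrDl; apply: le_trans (lerD E1 E2); apply: le_trans (ler_normD _ _).
by rewrite addrA subrK.
Qed.

Lemma powR_prod (I : Type) (r : seq I) (P : pred I) (F : I -> R) c :
  (forall i, P i -> 0 <= F i) ->
  (\prod_(i <- r | P i) F i) `^ c = \prod_(i <- r | P i) F i `^ c.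
Proof.
move=> F0; have [] : 0 <= \prod_(i <- r | P i) F i /\
    (\prod_(i <- r | P i) F i) `^ c = \prod_(i <- r | P i) F i `^ c; last by [].
apply: (big_rec2 (fun x y => 0 <= x /\ x `^ c = y)) => [|i y x Pi [y0 <-]]; first by rewrite powR1.
by rewrite mulr_ge0 ?F0// powRM ?F0.
Qed.

Section convolution.
Variable z : nat.
Implicit Types (S : {set 'I_z}) (f : {ffun 'I_z -> 'I_3}).

(* The multiplicative function [u] with [g = 1 * u], where [g] is [varg] on squarefree
   integers and vanishes elsewhere; [up p j] is its value at [p ^ j]. *)
Definition up (p : 'I_z) (j : 'I_3) : R :=
  if p \in pr z then
    if j == 0%N :> nat then 1 else
    if j == 1%N :> nat then 2 / (p%:R ^+ 2 - 2) else - (p%:R ^+ 2 / (p%:R ^+ 2 - 2))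
  else (j == 0%N :> nat)%:R.

Definition uf f : R := \prod_p up p (f p).
Definition df f : nat := (\prod_(p in pr z) p ^ f p)%N.

Lemma df_gt0 f : (0 < df f)%N.
Proof.
by rewrite prodn_cond_gt0// => p pp; rewrite expn_gt0 prime_gt0// (pr_prime (subxx _) pp).
Qed.

Lemma dvdn_prod_exp S f e : S \subset pr z ->
  ((\prod_(p in S) p ^ f p) %| e)%N = [forall p in S, (p ^ f p %| e)%N].
Proof.
move: {2}#|S| (erefl #|S|) => m; elim: m S => [|m IH] S cS sS.
  move/eqP: cS; rewrite cards_eq0 => /eqP ->; rewrite big_set0 dvd1n.
  by apply/esym/'forall_implyP => p; rewrite inE.
have /card_gt0P[p pS] : (0 < #|S|)%N by rewrite cS.
have sS' : S :\ p \subset pr z by rewrite (subset_trans (subD1set _ _)).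
rewrite (big_setD1 p)//= Gauss_dvd; last first.
  rewrite coprimeXl//; elim/big_ind: _ => [|a b|q]; first exact: coprimen1.
    by rewrite coprimeMr => -> ->.
  rewrite !inE => /andP[qp qS]; rewrite coprimeXr// prime_coprime ?(pr_prime sS)//.
  by rewrite dvdn_prime2 ?(pr_prime sS)// eq_sym (inj_eq val_inj).
rewrite IH//; last by have := cardsD1 p S; rewrite cS pS add1n => -[].
apply/andP/'forall_implyP => [[pe /'forall_implyP H] q qS|H].
  by have [->//|qp] := eqVneq q p; apply: H; rewrite !inE qp.
split; first exact: H.
by apply/'forall_implyP => q; rewrite inE => /andP[_]; exact: H.
Qed.

Lemma sum_uf e : \sum_(f : {ffun 'I_z -> 'I_3}) uf f * (df f %| e)%:R =
  \prod_(p in pr z) (1 + 2 / (p%:R ^+ 2 - 2) * (p %| e)%:R - p%:R ^+ 2 / (p%:R ^+ 2 - 2) * (p ^ 2 %| e)%:R).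
Proof.
pose F (p : 'I_z) (j : 'I_3) : R := up p j * (if p \in pr z then (p ^ j %| e)%:R else 1).
transitivity (\sum_(f : {ffun 'I_z -> 'I_3}) \prod_p F p (f p)).
  apply: eq_bigr => f _; rewrite /F big_split/= -/(uf f) -big_mkcond/=; congr (_ * _).
  rewrite /df dvdn_prod_exp//; case: 'forall_implyP => [H|/'forall_implyP].
    by rewrite big1// => p /H ->.
  by rewrite negb_forall_in => /exists_inP[p pp /negbTE pn]; rewrite (bigD1 p)//= pn mul0r.
rewrite -(bigA_distr_bigA F) [RHS]big_mkcond; apply: eq_bigr => p _.
rewrite !big_ord_recl big_ord0 /F /up; case: ifP => /= _.
  by rewrite expn0 dvd1n expn1 !mulr1 addr0 addrA mulNr.
by rewrite !mulr1 !addr0.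
Qed.

Definition gz e : R := \sum_(S : {set 'I_z} | (S \subset pr z) && (np S == e)) varg R S.

(** The Euler factors on the right are 1 if [p] does not divide [e], [p^2 / (p^2 - 2)] if it divides
    [e] once, and 0 if [p^2] divides [e]. Below [z], every prime factor of [e] belongs to [pr z]. *)
Lemma gz_uf e : (0 < e < z)%N -> gz e = \sum_(f : {ffun 'I_z -> 'I_3}) uf f * (df f %| e)%:R.
Proof.
move=> /andP[e0 ez]; rewrite sum_uf.
pose S0 : {set 'I_z} := [set p in pr z | (p %| e)%N].
have sS0 : S0 \subset pr z by apply/subsetP => p; rewrite inE => /andP[].
have x2 (p : 'I_z) : p \in pr z -> (p%:R ^+ 2 - 2 : R) != 0.
  by move=> pp; rewrite gt_eqF// subr_gt0 (lt_le_trans _ (sqr_prime_ge4 R pp))// ltr_nat.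
case: (boolP [exists p in pr z, (p ^ 2 %| e)%N]) => [/exists_inP[p pp pe]|].
  rewrite (bigD1 p)//= pe (dvdn_trans _ pe) ?dvdn_exp//.
  rewrite (_ : 1 + _ - _ = 0) ?mul0r; last by have := x2 p pp; move: (_ ^+ 2) => x xn; rewrite /= !mulr1n !mulr1; field.
  rewrite /gz big1// => S /andP[sS /eqP Se]; exfalso.
  move: pe; rewrite -Se; have [pS|pS] := boolP (p \in S).
    rewrite (npD1 pS) -mulnn dvdn_pmul2l ?prime_gt0 ?(pr_prime sS)//.
    by rewrite dvdn_np ?(pr_prime sS pS) ?(subset_trans (subD1set _ _))// !inE eqxx.
  move=> /(dvdn_trans (dvdn_exp _ (dvdnn p))) => /(_ isT).
  by rewrite dvdn_np ?(pr_prime (subxx _) pp)// (negbTE pS).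
rewrite negb_exists_in => /'forall_implyP sqf.
have S0e : np S0 = e.
  have d : (np S0 %| e)%N.
    by rewrite -[np S0]expn1 np_dvdn_exp//; apply/'forall_implyP => p; rewrite inE expn1 => /andP[].
  have /dvdnP[q eE] := d; have [q1|q1] := leqP q 1.
    by move: q1 e0; rewrite eE; case: q {eE} => [|[|]]//; rewrite mul1n.
  have pq := pdiv_prime q1; have qe : (pdiv q %| e)%N by rewrite eE dvdn_mulr// pdiv_dvd.
  have qz : (pdiv q < z)%N by apply: leq_ltn_trans ez; exact: dvdn_leq.
  pose r := Ordinal qz; have rp : r \in pr z by rewrite prP.
  have rS : r \in S0 by rewrite inE rp.
  have /negP[] := sqf r rp; rewrite eE -mulnn dvdn_mul ?pdiv_dvd//.
  by rewrite (npD1 rS) dvdn_mulr.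
rewrite /gz (big_pred1 S0); last first.
  move=> S /=; apply/andP/eqP => [[sS /eqP Se]|->]; last by rewrite sS0 S0e eqxx.
  by apply: np_inj => //; rewrite Se.
rewrite /varg [RHS](bigID (fun p : 'I_z => (p %| e)%N))/= [X in _ = _ * X]big1 ?mulr1; last first.
  by move=> p /andP[pp /negbTE pe]; rewrite pe (negbTE (sqf p pp)) !mulr0 addr0 subr0.
rewrite (eq_bigl (fun p => (p \in pr z) && (p %| e)%N)); last by move=> p; rewrite inE.
apply: eq_bigr => p /andP[pp pe]; rewrite pe (negbTE (sqf p pp)) mulr1 mulr0 subr0.
by have := x2 p pp; move: (_ ^+ 2) => x xn; field.
Qed.

Lemma sum_uf_inv : \sum_(f : {ffun 'I_z -> 'I_3}) uf f / (df f)%:R =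
  \prod_(p in pr z) (1 + 2 / (p%:R ^+ 2 - 2) / p%:R - p%:R ^+ 2 / (p%:R ^+ 2 - 2) / p%:R ^+ 2).
Proof.
pose F (p : 'I_z) (j : 'I_3) : R := up p j * (if p \in pr z then (p%:R ^+ j)^-1 else 1).
transitivity (\sum_(f : {ffun 'I_z -> 'I_3}) \prod_p F p (f p)).
  apply: eq_bigr => f _; rewrite /F big_split/= -/(uf f) -big_mkcond/=; congr (_ * _).
  by rewrite /df natr_prod -prodfV; apply: eq_bigr => p _; rewrite natrX.
rewrite -(bigA_distr_bigA F) [RHS]big_mkcond; apply: eq_bigr => p _.
rewrite !big_ord_recl big_ord0 /F /up; case: ifP => /= _.
  by rewrite expr0 invr1 expr1 !mulr1 addr0 addrA mulNr.
by rewrite !mulr1 !addr0.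
Qed.

(** The Euler factors are [1 + O(p^(-4/3))], dominated by [u(p^2)], which is close to -1. The
    constant is 6 from the bound on one factor times 4 for the sum of [n^(-4/3)]. *)
Lemma sum_norm_uf : \sum_(f : {ffun 'I_z -> 'I_3}) `|uf f| * ((df f)%:R : R) `^ (- (2 / 3)) <= expR 24.
Proof.
pose F (p : 'I_z) (j : 'I_3) : R := `|up p j| * (if p \in pr z then (p%:R `^ (- (2 / 3))) ^+ j else 1).
have -> : \sum_(f : {ffun 'I_z -> 'I_3}) `|uf f| * ((df f)%:R : R) `^ (- (2 / 3)) = \sum_(f : {ffun 'I_z -> 'I_3}) \prod_p F p (f p).
  apply: eq_bigr => f _; rewrite /F big_split/= -normr_prod -/(uf f) -big_mkcond/=; congr (_ * _).
  rewrite /df natr_prod powR_prod//; apply: eq_bigr => p pp.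
  by rewrite natrX -[_ ^+ f p in LHS]powR_mulrn// -powRrM mulrC powRrM powR_mulrn ?powR_ge0.
rewrite -(bigA_distr_bigA F).
have H p : \sum_j F p j <= expR ((if p \in pr z then 6 * (p%:R : R) `^ (- 1 - 1 / 3) else 0)).
  rewrite !big_ord_recl big_ord0 /F /up; case: ifP => /= pp; last first.
    by rewrite expR0 normr0 normr1 !mul0r !addr0 mulr1.
  rewrite normr1 mulr1 addr0 -[bump 0 (bump 0 0)]/2%N -[bump 0 0]/1%N expr1.
  have p2 := sqr_prime_ge4 R pp; have p0 : 0 < (p%:R : R) by rewrite ltr0n prime_gt0// (pr_prime (subxx _) pp).
  have p1 : 1 <= (p%:R : R) by rewrite ler1n prime_gt0// (pr_prime (subxx _) pp).
  set y : R := _ `^ (- (2 / 3)).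
  have y0 : 0 <= y by exact: powR_ge0.
  have y1 : y <= 1 by rewrite -[leRHS](powRr0 (p%:R : R)) powR_le_max// oppr_le0 divr_ge0.
  have y2 : (p%:R : R) `^ (-1 - 1 / 3) = y ^+ 2.
    by rewrite -powR_mulrn// -powRrM (_ : -1 - 1 / 3 = - (2 / 3) * 2%:R :> R)//; field.
  have y3 : ((p%:R : R) ^+ 2)^-1 = y ^+ 3.
    rewrite -[RHS]powR_mulrn// -powRrM (_ : - (2 / 3) * 3%:R = -2 :> R); last by field.
    by rewrite powRN powR_mulrn// ltW.
  apply: le_trans (expR_ge1Dx _); rewrite lerD2l y2.
  set x : R := p%:R ^+ 2 in p2 y3 *.
  have x2 : 0 < x - 2 by rewrite subr_gt0 (lt_le_trans _ p2)// ltr_nat.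
  have x0 : 0 < x by apply: lt_le_trans p2.
  have h1 : 2 / (x - 2) <= 4 * y ^+ 3.
    by rewrite -y3 ler_pdivrMr// mulrAC ler_pdivlMr//; move: p2; lra.
  have h2 : x / (x - 2) <= 2 by rewrite ler_pdivrMr//; move: p2; lra.
  rewrite normrN !ger0_norm ?divr_ge0 ?(ltW x2) ?(ltW x0)//.
  rewrite (_ : 6 * y ^+ 2 = 4 * y ^+ 2 + 2 * y ^+ 2); last by ring.
  apply: lerD; last by rewrite ler_wpM2r ?exprn_ge0.
  apply: le_trans (ler_wpM2r y0 h1) _; rewrite -mulrA ler_wpM2l// -exprSr.
  exact: ler_wiXn2l.
apply: le_trans (_ : \prod_(p < z) expR (if p \in pr z then 6 * (p%:R : R) `^ (- 1 - 1 / 3) else 0) <= _).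
  apply: ler_prod => p _; rewrite H andbT; apply: sumr_ge0 => j _.
  by rewrite mulr_ge0//; case: ifP => // _; rewrite exprn_ge0// powR_ge0.
rewrite -expR_sum ler_expR -big_mkcond/= -mulr_sumr (_ : 24 = 6 * 4); last by ring.
rewrite ler_wpM2l//.
have e0 : 0 < (1 / 3 : R) by rewrite divr_gt0.
apply: le_trans (_ : \sum_(1 <= n < z) (n%:R : R) `^ (- 1 - 1 / 3) <= _); last first.
  by apply: le_trans (zeta_partial_bound _ e0) _; rewrite [leLHS](_ : _ = 4)//; field.
under eq_bigl do rewrite prP.
rewrite -(big_mkord (fun p => prime p) (fun n => (n%:R : R) `^ (- 1 - 1 / 3))).
case: z => [|z']; first by rewrite !big_geq.
rewrite big_ltn_cond//= big_mkcond/=; apply: ler_sum => n _; case: ifP => // _; exact: powR_ge0.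
Qed.

Lemma sum_multiples_nat (D n : nat) (F : nat -> R) : (0 < D)%N ->
  \sum_(1 <= e < n.+1) (D %| e)%:R * F e = \sum_(1 <= m < (n %/ D).+1) F (D * m)%N.
Proof.
move=> D0; elim: n => [|n IH]; first by rewrite div0n !big_geq.
rewrite big_nat_recr//= IH divnS//; case: (boolP (D %| n.+1)%N) => d; last by rewrite mul0r addr0.
rewrite add1n [RHS]big_nat_recr//= mul1r; congr (_ + F _).
by rewrite -{1}(divnK d) mulnC divnS// d.
Qed.

Definition Az : R := pi^-1 * (\sum_(1 <= b < z.+1) (b%:R : R) `^ (- 1 - 1 / 2)) *
  \prod_(p in pr z) (1 - 3 / p%:R ^+ 2 + 2 / p%:R ^+ 3).

Lemma varW_ge0_le1 (S : {set 'I_z}) : S \subset pr z ->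
  0 <= \prod_(p in S) (1 - 2 / (p%:R : R) ^+ 2) <= 1.
Proof.
move=> sS; have H p : p \in S -> 0 <= 1 - 2 / (p%:R : R) ^+ 2 <= 1.
  move=> pS; have p4 := sqr_prime_ge4 R (subsetP sS p pS); have x0 : 0 < (p%:R : R) ^+ 2 by apply: lt_le_trans p4.
  rewrite subr_ge0 gerBl divr_ge0 ?(ltW x0)// andbT ler_pdivrMr// mul1r; move: p4; lra.
rewrite prodr_ge0 /=; last by move=> p /H /andP[].
exact: prodr_ile1.
Qed.

Lemma varW_varg_le (S : {set 'I_z}) : S \subset pr z -> 0 <= varW R z * varg R S <= 1.
Proof.
move=> sS; have -> : varW R z * varg R S = \prod_(p in pr z :\: S) (1 - 2 / (p%:R : R) ^+ 2).
  rewrite /varW (big_setID S)/= (setIidPr sS) mulrAC /varg -big_split/= big1 ?mul1r// => p pS.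
  have p4 := sqr_prime_ge4 R (subsetP sS p pS); move: (_ ^+ 2) p4 => x x4.
  have xn : x != 0 by rewrite gt_eqF// (lt_le_trans _ x4).
  have x2 : x - 2 != 0 by rewrite gt_eqF// subr_gt0 (lt_le_trans _ x4)// ltr_nat.
  by field; rewrite xn x2.
by apply: varW_ge0_le1; rewrite subsetDl.
Qed.

Lemma frp_ge0_le h N : (0 < N)%N -> 0 <= (frp h N : R) <= h%:R / N%:R.
Proof.
move=> N0; have Nr : 0 < (N%:R : R) by rewrite ltr0n.
have u0 : 0 <= (h %% N)%:R / N%:R :> R by rewrite divr_ge0.
have u1 : (h %% N)%:R / N%:R <= 1 :> R by rewrite ler_pdivrMr// mul1r ler_nat ltnW// ltn_pmod.
rewrite /frp mulr_ge0 ?subr_ge0//=; apply: le_trans (_ : (h %% N)%:R / N%:R <= _).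
  by rewrite ler_piMr// gerBl.
by rewrite ler_wpM2r ?invr_ge0// ler_nat leq_mod.
Qed.

(** Moduli beyond [z] are handled by [frp h N <= h / N]; [h ^ 2 <= z] makes their total bounded. *)
Lemma tail_frp h : (h ^ 2 <= z)%N -> (1 < z)%N -> (0 < h)%N ->
  `|\sum_(S : {set 'I_z} | (S \subset pr z) && (z <= np S)%N) varW R z * (varg R S * frp h (np S ^ 2))| <= 2.
Proof.
move=> hz z1 h0; apply: le_trans (ler_norm_sum _ _ _) _.
apply: le_trans (_ : \sum_(S : {set 'I_z} | (S \subset pr z) && (z <= np S)%N) h%:R * (((np S)%:R : R) ^+ 2)^-1 <= _).
  apply: ler_sum => S /andP[sS _]; have /andP[w0 w1] := varW_varg_le sS.
  have S0 : (0 < np S ^ 2)%N by rewrite expn_gt0 np_gt0.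
  have /andP[f0 f1] := frp_ge0_le h S0.
  rewrite mulrA (ger0_norm (mulr_ge0 w0 f0)).
  have -> : h%:R * (((np S)%:R : R) ^+ 2)^-1 = 1 * (h%:R / (np S ^ 2)%:R) by rewrite natrX mul1r.
  exact: ler_pM.
rewrite -mulr_sumr.
apply: le_trans (ler_wpM2l _ (@sum_np_le R z (fun n => (z <= n)%N) (fun n => (n%:R ^+ 2)^-1) (np (pr z)).+1 _ _)) _ => //.
  by move=> S sS _; exact: np_lt_bound.
have B0 : (0 < z.-1)%N by rewrite -ltnS prednK// ltnW.
have H : \sum_(1 <= n < (np (pr z)).+1 | (z <= n)%N) ((n%:R : R) ^+ 2)^-1 <= (z.-1%:R)^-1.
  apply: le_trans (@sum_inv_sqr_gt R z.-1 (np (pr z)) B0); rewrite prednK ?(ltnW z1)//.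
  have [le|lt] := leqP z (np (pr z)).+1; last first.
    rewrite [leRHS]big_geq ?(ltnW lt)// big_nat_cond big1// => n /andP[/andP[_ n1] n2].
    by move: lt n1 n2; clear; lia.
  rewrite (big_cat_nat (n := z))//= ?(ltnW z1)// [X in X + _]big_nat_cond big1 ?add0r; last first.
    by move=> n /andP[/andP[_ n1] n2]; move: n1 n2; clear; lia.
  by rewrite [leLHS]big_mkcond; apply: ler_sum => n _; case: ifP => // _; rewrite invr_ge0 exprn_ge0.
apply: le_trans (ler_wpM2l _ H) _; first exact: ler0n.
have zr : 0 < (z.-1%:R : R) by rewrite ltr0n.
rewrite ler_pdivrMr// -natrM ler_nat; move: hz z1 h0; clear; case: h => [|[|h]]//; first by lia.
by rewrite -mulnn; nia.
Qed.

(** Writing [g = 1 * u] as a Dirichlet convolution turns the sum over [e < z] into sums over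
    multiples of [d = df f], each given by [sum_frp_multiples]. The errors sum since
    [|u(d)| d^(-2/3)] is summable, and [varW] times the sum of [u(d) / d] is the product
    [1 - 3 / p^2 + 2 / p^3] over primes in [A]. *)
Lemma mom2_asymp h : (h ^ 2 <= z)%N -> (1 < z)%N -> (0 < h)%N ->
  `|pavg z (fun n => dev R z h n ^+ 2) - Az * Num.sqrt h%:R| <= (2 + 562 * expR 24) * h%:R `^ (1 / 3).
Proof.
move=> hz z1 h0; rewrite mom2_frp mulr_sumr.
have hr : 1 <= (h%:R : R) by rewrite ler1n.
have h3 : 1 <= (h%:R : R) `^ (1 / 3).
  by rewrite -[leLHS](powRr0 (h%:R : R)) powR_le_max// divr_ge0.
rewrite (bigID (fun S => (z <= np S)%N))/= -addrA.
apply: le_trans (ler_normD _ _) _; rewrite [leRHS]mulrDl; apply: lerD.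
  by apply: le_trans (tail_frp hz z1 h0) _; rewrite ler_peMr.
have -> : \sum_(S : {set 'I_z} | (S \subset pr z) && ~~ (z <= np S)%N) varW R z * (varg R S * frp h (np S ^ 2)) =
    varW R z * \sum_(1 <= e < z) gz e * frp h (e ^ 2).
  rewrite -mulr_sumr; congr (_ * _); rewrite /gz; under [RHS]eq_bigr do rewrite mulr_suml big_mkcondr/=.
  rewrite exchange_big/= big_mkcondr/=; apply: eq_bigr => S sS; rewrite -ltnNge; case: ltnP => Sz.
    rewrite (bigD1_seq (np S))/= ?mem_index_iota ?iota_uniq ?np_gt0 ?Sz// eqxx big1 ?addr0//.
    by move=> e eS; rewrite eq_sym (negbTE eS).
  rewrite big_nat_cond big1// => e /andP[/andP[_ ez] _]; case: eqP => // Se.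
  by move: Sz; rewrite Se leqNgt ez.
have -> : \sum_(1 <= e < z) gz e * frp h (e ^ 2) =
    \sum_(f : {ffun 'I_z -> 'I_3}) uf f * \sum_(1 <= m < (z.-1 %/ df f).+1) frp h ((df f * m) ^ 2).
  rewrite big_nat (eq_bigr (fun e => \sum_(f : {ffun 'I_z -> 'I_3}) uf f * ((df f %| e)%:R * frp h (e ^ 2)))); last first.
    by move=> e ez; rewrite gz_uf// mulr_suml; apply: eq_bigr => f _; rewrite mulrA.
  rewrite -big_nat exchange_big/=; apply: eq_bigr => f _; rewrite -mulr_sumr; congr (_ * _).
  rewrite -(sum_multiples_nat z.-1 (fun e => frp h (e ^ 2)) (df_gt0 f)) prednK//; exact: ltnW.
set Zb := \sum_(1 <= b < z.+1) (b%:R : R) `^ (- 1 - 1 / 2).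
have -> : Az * Num.sqrt h%:R = varW R z * \sum_(f : {ffun 'I_z -> 'I_3}) uf f * (Num.sqrt h%:R / (pi * (df f)%:R) * Zb).
  have -> : \sum_(f : {ffun 'I_z -> 'I_3}) uf f * (Num.sqrt h%:R / (pi * (df f)%:R) * Zb) =
      (\sum_(f : {ffun 'I_z -> 'I_3}) uf f / (df f)%:R) * (Num.sqrt h%:R / pi * Zb).
    rewrite mulr_suml; apply: eq_bigr => f _; rewrite invfM.
    by move: (Num.sqrt _) (pi^-1) (_%:R^-1) => a b c; ring.
  rewrite sum_uf_inv mulrA /varW -big_split/=.
  rewrite [X in _ = X * _](_ : _ = \prod_(p in pr z) (1 - 3 / p%:R ^+ 2 + 2 / p%:R ^+ 3)).
    by rewrite /Az -/Zb; move: (Num.sqrt _) (pi^-1) (\prod_(_ in _) _) => a b c; ring.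
  apply: eq_bigr => p pp; have p4 := sqr_prime_ge4 R pp.
  have p0 : (p%:R : R) != 0 by rewrite pnatr_eq0 -lt0n prime_gt0// (pr_prime (subxx _) pp).
  have x2 : (p%:R : R) ^+ 2 - 2 != 0 by rewrite gt_eqF// subr_gt0 (lt_le_trans _ p4)// ltr_nat.
  by move: (p%:R : R) p0 x2 => x xn x2; field; rewrite xn x2.
rewrite -mulrBr -sumrB normrM; have /andP[W0 W1] := varW_ge0_le1 (subxx _).
rewrite [`|varW R z|]ger0_norm//; apply: le_trans (ler_wpM2r (normr_ge0 _) W1) _; rewrite [leLHS]mul1r.
apply: le_trans (ler_norm_sum _ _ _) _.
apply: le_trans (_ : \sum_(f : {ffun 'I_z -> 'I_3}) (562 * h%:R `^ (1 / 3)) * (`|uf f| * ((df f)%:R : R) `^ (- (2 / 3))) <= _).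
  apply: ler_sum => f _; rewrite -mulrBr normrM.
  rewrite [leRHS]mulrCA ler_wpM2l// -[leRHS]mulrA; exact: (sum_frp_multiples h0 hz (df_gt0 f)).
rewrite -mulr_sumr [leRHS]mulrAC; apply: ler_wpM2l; last exact: sum_norm_uf.
exact: mulr_ge0 (ler0n R 562) (powR_ge0 _ _).
Qed.

End convolution.

End variance_asymptotics.

(** * Limits of the constants *)

Section limits.
Local Open Scope classical_set_scope.
Variable R : realType.

Lemma cvg_zeta (s : R) : 1 < s -> cvgn [series (n.+1%:R : R) `^ (- s)]_n.
Proof.
move=> s1; apply: nondecreasing_is_cvgn.
  by apply/nondecreasing_seqP => n; rewrite /series /= big_nat_recr//= lerDl powR_ge0.
have e0 : 0 < s - 1 by rewrite subr_gt0.
exists (1 + (s - 1)^-1) => _ [n _ <-].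
have := zeta_partial_bound n.+1 e0.
rewrite big_add1/= /series/=; congr (_ <= _); apply: eq_bigr => i _; congr (_ `^ _); ring.
Qed.

Lemma zeta_partial_le (s : R) n : 1 < s -> \sum_(0 <= k < n) (k.+1%:R : R) `^ (- s) <= zeta s.
Proof.
move=> s1; apply: (nondecreasing_cvgn_le _ (cvg_zeta s1) n).
by apply/nondecreasing_seqP => m; rewrite /series /= big_nat_recr//= lerDl powR_ge0.
Qed.

Lemma zeta_ge1 (s : R) : 1 < s -> 1 <= zeta s.
Proof. by move=> /(zeta_partial_le 1); rewrite big_nat1 powR1. Qed.

Let prodA (N : nat) : R := \prod_(0 <= p < N | prime p) (1 - 3 / p%:R ^+ 2 + 2 / p%:R ^+ 3).

Let factorA (p : nat) : prime p -> 0 <= (1 - 3 / p%:R ^+ 2 + 2 / p%:R ^+ 3 : R) <= 1.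
Proof.
move=> pp; have p0 : 0 < (p%:R : R) by rewrite ltr0n prime_gt0.
have p1 : 1 <= (p%:R : R) by rewrite ler1n prime_gt0.
have -> : 1 - 3 / p%:R ^+ 2 + 2 / p%:R ^+ 3 = (p%:R - 1) ^+ 2 * (p%:R + 2) / p%:R ^+ 3 :> R.
  by field; rewrite gt_eqF.
apply/andP; split; first by apply: divr_ge0; rewrite ?exprn_ge0// mulr_ge0 ?sqr_ge0 ?addr_ge0.
rewrite ler_pdivrMr ?exprn_gt0// mul1r.
rewrite -subr_ge0 (_ : _ - _ = 3 * (p%:R - 1) + 1); last by ring.
by move: p1; move: (p%:R : R) => x; lra.
Qed.

Let prodA_ge0 N : 0 <= prodA N.
Proof. by apply: prodr_ge0 => p /factorA /andP[]. Qed.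

Lemma cvg_prodA : cvgn prodA.
Proof.
apply: nonincreasing_is_cvgn.
  apply/nonincreasing_seqP => n; rewrite /prodA big_mkcond big_nat_recr//= -big_mkcond/=.
  by case: ifP => [/factorA/andP[_ h]|_]; rewrite ?mulr1// ler_piMr// prodA_ge0.
by exists 0 => _ [n _ <-]; exact: prodA_ge0.
Qed.

Lemma A_ge0 : 0 <= A R.
Proof.
rewrite /A mulr_ge0//; last by apply: limr_ge; [exact: cvg_prodA|near=> n; exact: prodA_ge0].
by rewrite divr_ge0 ?pi_ge0// (le_trans ler01)// zeta_ge1// ltr_pdivlMr// mul1r ltr_nat.
Unshelve. all: by end_near.
Qed.

Lemma cvg_Az : Az R z @[z --> \oo] --> A R.
Proof.
have s1 : 1 < (3 / 2 : R) by rewrite ltr_pdivlMr// mul1r ltr_nat.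
rewrite /A; apply: cvgM; last first.
  rewrite (_ : (fun z => _) = prodA); first exact: cvg_prodA.
  apply: funext => z; rewrite /prodA.
  under eq_bigl do rewrite prP.
  by rewrite -(big_mkord (fun p => prime p) (fun p => 1 - 3 / (p%:R : R) ^+ 2 + 2 / p%:R ^+ 3)).
rewrite [zeta _ / _]mulrC; apply: cvgM; first exact: cvg_cst.
rewrite (_ : (fun z => _) = [series (n.+1%:R : R) `^ (- (3 / 2))]_n); first exact: cvg_zeta s1.
apply: funext => z; rewrite big_add1/= /series/=; apply: eq_bigr => b _; by congr (_ `^ _); field.
Qed.

Definition primorial z : nat := (\prod_(0 <= p < z | prime p) p)%N.
Let sv z M : R := \sum_(1 <= n < M.+1 | coprime n (primorial z)) (n%:R ^+ 2)^-1.

Lemma primorialS z : primorial z.+1 = (primorial z * (if prime z then z else 1))%N.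
Proof. by rewrite /primorial big_mkcond big_nat_recr//= -big_mkcond. Qed.

Lemma dvdn_primorial z p : prime p -> (p %| primorial z)%N = (p < z)%N.
Proof.
move=> pp; elim: z => [|z IH]; first by rewrite /primorial big_geq// dvdn1; case: p pp => [|[]].
rewrite primorialS Euclid_dvdM// IH ltnS [RHS]leq_eqVlt [RHS]orbC; congr (_ || _).
case: ifP => [pz|nz]; first by rewrite dvdn_prime2.
by rewrite dvdn1 gtn_eqF ?prime_gt1//; apply/esym/negP => /eqP E; rewrite E nz in pp.
Qed.

(** Multiplying by [1 - z^-2] removes the multiples of the prime [z], except that what is subtracted
    also includes [z^-2] times the terms with [M / z < n <= M]; these are the error. *)
Lemma sieve_step z M : (0 < M)%N -> prime z ->
  `|(1 - (z%:R ^+ 2)^-1) * sv z M - sv z.+1 M| <= 2 / M%:R.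
Proof.
move=> M0 pz; have z0 := prime_gt0 pz.
have zr : 0 < (z%:R : R) by rewrite ltr0n.
have Mr : 0 < (M%:R : R) by rewrite ltr0n.
have cz : coprime z (primorial z) by rewrite prime_coprime// dvdn_primorial// ltnn.
pose t B C : R := \sum_(B.+1 <= n < C.+1 | coprime n (primorial z)) (n%:R ^+ 2)^-1.
have E1 : sv z M = sv z.+1 M + (z%:R ^+ 2)^-1 * t 0%N (M %/ z)%N.
  rewrite /sv (bigID (fun n => (z %| n)%N))/= addrC; congr (_ + _).
    apply: eq_bigl => n; rewrite primorialS pz coprimeMr; congr (_ && _).
    by rewrite coprime_sym prime_coprime.
  rewrite /t mulr_sumr big_mkcond/= [RHS]big_mkcond/=.
  have := @sum_multiples_nat R z M (fun n => if coprime n (primorial z) then (n%:R ^+ 2)^-1 else 0) z0.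
  rewrite (eq_bigr (fun n => if coprime n (primorial z) && (z %| n)%N then ((n%:R : R) ^+ 2)^-1 else 0)).
    move=> ->; apply: eq_bigr => m _; rewrite coprimeMl cz/=; case: ifP => // _.
    by rewrite natrM exprMn invfM.
  by move=> n _; case: (z %| n)%N; rewrite ?mul1r ?mul0r ?andbT ?andbF.
have E2 : sv z M = t 0%N (M %/ z)%N + t (M %/ z)%N M.
  by rewrite /sv /t (big_cat_nat (n := (M %/ z).+1))//= ltnS leq_div.
rewrite [X in X - _](_ : _ = sv z M - (z%:R ^+ 2)^-1 * sv z M); last by rewrite mulrBl mul1r.
rewrite {1}E1 E2 mulrDr opprD addrA addrK addrAC subrr add0r normrN.
set B := (M %/ z)%N.
have t0 : 0 <= t B M by apply: sumr_ge0 => n _; rewrite invr_ge0 exprn_ge0.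
rewrite ger0_norm ?mulr_ge0 ?invr_ge0 ?exprn_ge0//.
have tle : t B M <= \sum_(B.+1 <= n < M.+1) ((n%:R : R) ^+ 2)^-1.
  by rewrite /t big_mkcond; apply: ler_sum => n _; case: ifP => // _; rewrite invr_ge0 exprn_ge0.
have Mz : (M < B.+1 * z)%N by exact: ltn_ceil.
have [B0|B0] := posnP B.
  apply: le_trans (_ : (z%:R ^+ 2)^-1 * 2 <= _).
    rewrite ler_wpM2l ?invr_ge0 ?exprn_ge0//; apply: le_trans tle _; rewrite B0; exact: sum_inv_sqr.
  rewrite mulrC ler_wpM2l// lef_pV2 ?posrE ?exprn_gt0// -natrX ler_nat.
  by move: Mz z0; rewrite B0 mul1n -mulnn; clear; nia.
apply: le_trans (_ : (z%:R ^+ 2)^-1 * B%:R^-1 <= _).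
  by rewrite ler_wpM2l ?invr_ge0 ?exprn_ge0//; apply: le_trans tle _; exact: sum_inv_sqr_gt.
rewrite -invfM -[2]invrK -invfM lef_pV2 ?posrE ?mulr_gt0 ?exprn_gt0 ?invr_gt0 ?ltr0n//.
rewrite ler_pdivrMl// -natrX -!natrM ler_nat.
by move: Mz z0 B0; clear; rewrite -mulnn; nia.
Qed.

Lemma sieve_bound z M : (0 < M)%N ->
  `|\prod_(0 <= p < z | prime p) (1 - ((p%:R : R) ^+ 2)^-1) * \sum_(1 <= n < M.+1) ((n%:R : R) ^+ 2)^-1
    - sv z M| <= 2 * z%:R / M%:R.
Proof.
move=> M0; elim: z => [|z IH].
  rewrite big_geq// mul1r /sv [X in _ - X](eq_bigl xpredT) ?subrr ?normr0 ?mulr0 ?mul0r// => n.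
  by rewrite /primorial big_geq// coprimen1.
set S := \sum_(1 <= n < M.+1) _ in IH *.
rewrite big_mkcond big_nat_recr//= -big_mkcond/=; case: ifP => pz; last first.
  rewrite mulr1 (_ : sv z.+1 M = sv z M); last first.
    by apply: eq_bigl => n; rewrite primorialS pz muln1.
  by apply: le_trans IH _; rewrite ler_wpM2r ?invr_ge0// ler_wpM2l// ler_nat.
set P := \prod_(0 <= p < z | _) _ in IH *; set c := 1 - _.
have c01 : 0 <= c <= 1.
  have z1 : 1 <= (z%:R : R) by rewrite ler1n prime_gt0.
  by rewrite /c subr_ge0 gerBl invr_ge0 exprn_ge0// andbT invf_le1 ?exprn_gt0 ?(lt_le_trans ltr01)// exprn_ege1.
rewrite (_ : P * c * S - _ = c * (P * S - sv z M) + (c * sv z M - sv z.+1 M)); last by ring.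
apply: le_trans (ler_normD _ _) _.
rewrite (_ : 2 * z.+1%:R / M%:R = 2 * z%:R / M%:R + 2 / M%:R); last by rewrite -natr1; ring.
apply: lerD; last exact: sieve_step.
have /andP[c0 c1] := c01; rewrite normrM (ger0_norm c0); apply: le_trans IH.
by rewrite ler_piMl.
Qed.

Lemma sv_bound z M : (0 < M)%N -> (1 < z)%N -> `|sv z M - 1| <= (z.-1%:R)^-1.
Proof.
move=> M0 z1; rewrite /sv big_ltn_cond// coprime1n expr1n invr1 addrAC subrr add0r.
rewrite ger0_norm; last by apply: sumr_ge0 => n _; rewrite invr_ge0 exprn_ge0.
have z0 : (0 < z.-1)%N by rewrite -ltnS prednK// ltnW.
apply: le_trans (@sum_inv_sqr_gt R z.-1 M z0); rewrite prednK ?(ltnW z1)//.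
have cop n : (1 < n)%N -> (n < z)%N -> ~~ coprime n (primorial z).
  move=> n1 nz; apply/negP => /eqP c.
  have : (pdiv n %| gcdn n (primorial z))%N.
    by rewrite dvdn_gcd pdiv_dvd dvdn_primorial ?pdiv_prime// (leq_ltn_trans _ nz)// pdiv_leq// ltnW.
  by rewrite c dvdn1 => /eqP E; have := pdiv_prime n1; rewrite E.
have [le|lt] := leqP z M.+1; last first.
  rewrite [leRHS]big_geq ?(ltnW lt)// big_nat_cond big1// => n /andP[/andP[n2 nM] c].
  by move: c; rewrite (negbTE (cop n n2 (ltn_trans nM lt))).
rewrite (big_cat_nat (n := z))//= [X in X + _]big_nat_cond big1 ?add0r; last first.
  by move=> n /andP[/andP[n2 nz] c]; move: c; rewrite (negbTE (cop n n2 nz)).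
by rewrite [leLHS]big_mkcond; apply: ler_sum => n _; case: ifP => // _; rewrite invr_ge0 exprn_ge0.
Qed.

(** Sieving the partial sum of [zeta 2] by all primes below [z] leaves the term 1 and integers at
    least [z], of total [O(1 / z)]; then [M] goes to infinity. A rate is convenient because the
    density is later multiplied by [h]. *)
Lemma dens_zeta z : (1 < z)%N -> `|dens R z * zeta 2 - 1| <= (z.-1%:R)^-1.
Proof.
move=> z1; have s2 : 1 < (2 : R) by rewrite ltr1n.
have PE : dens R z = \prod_(0 <= p < z | prime p) (1 - ((p%:R : R) ^+ 2)^-1).
  rewrite dens_prod; under eq_bigl do rewrite prP.
  by rewrite -(big_mkord (fun p => prime p) (fun p => 1 - ((p%:R : R) ^+ 2)^-1)).
have P0 : 0 <= dens R z by apply: pavg_ge0 => n.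
have P1 : dens R z <= 1.
  by rewrite -(pavg_cst z (1 : R)); apply: pavg_le => n; case: (sqz z n).
apply/ler_addgt0Pr => e e0; rewrite [leRHS]addrC.
have e2 : 0 < e / 2 by rewrite divr_gt0.
have /cvgrPdist_le/(_ _ e2)[M0 _ HM] := cvg_zeta s2.
pose M := maxn (maxn M0 1) (Num.truncn (4 * z%:R / e)).+1.
have Mp : (0 < M)%N by rewrite leq_max leq_max orbT.
have HMM := HM M; rewrite /= in HMM.
have {HMM} H1 : `|zeta 2 - \sum_(1 <= n < M.+1) ((n%:R : R) ^+ 2)^-1| <= e / 2.
  have -> : \sum_(1 <= n < M.+1) ((n%:R : R) ^+ 2)^-1 = [series (n.+1%:R : R) `^ (- 2)]_n M.
    by rewrite big_add1/= /series/=; apply: eq_bigr => n _; rewrite powRN powR_mulrn.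
  by apply: HMM; rewrite leq_max leq_max leqnn.
have H2 := sieve_bound z Mp; rewrite -PE in H2.
have H3 : 2 * z%:R / M%:R <= e / 2.
  have Mr : 0 < (M%:R : R) by rewrite ltr0n.
  rewrite ler_pdivrMr// mulrAC ler_pdivlMr//.
  have : 4 * z%:R / e < M%:R.
    apply: lt_le_trans (truncnS_gt _) _; rewrite ler_nat leq_max leqnn orbT//.
  by rewrite ltr_pdivrMr//; move: (e) (M%:R : R) (z%:R : R); clear=> a b c; move/ltW; lra.
have H4 := sv_bound Mp z1.
set S := \sum_(_ <= _ < _) _ in H1 H2.
rewrite (_ : _ - 1 = dens R z * (zeta 2 - S) + ((dens R z * S - sv z M) + (sv z M - 1))); last by ring.
apply: le_trans (ler_normD _ _) _; rewrite [leRHS](_ : _ = e / 2 + (e / 2 + z.-1%:R^-1)); last by rewrite addrA -splitr.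
apply: lerD.
  rewrite normrM (ger0_norm P0); apply: le_trans H1; by rewrite ler_piMl.
apply: le_trans (ler_normD _ _) _; apply: lerD => //; exact: le_trans H3.
Qed.

End limits.

(** * The moments of squarefree numbers in short intervals *)

Section gaussian_moments.
Variable R : realType.

Lemma mu_rec k : mu k.+2 = (k.+1 * mu k)%N.
Proof.
rewrite /mu /= negbK; case: ifP => ok; first by rewrite muln0.
rewrite big_nat_recr//= mulnC; congr (_.+1 * _)%N.
by rewrite -[RHS]odd_double_half ok.
Qed.

Definition gaussm (x : R) k : R := (mu k)%:R * (A R `^ (1 / 2) * x `^ (1 / 4)) ^+ k.

Lemma gaussm_rec x k : 0 <= x -> gaussm x k.+2 = k.+1%:R * (A R * Num.sqrt x) * gaussm x k.
Proof.
move=> x0; rewrite /gaussm mu_rec natrM (exprD _ 2 k : _ ^+ k.+2 = _).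
have -> : (A R `^ (1 / 2) * x `^ (1 / 4)) ^+ 2 = A R * Num.sqrt x.
  rewrite exprMn -!powR_mulrn ?powR_ge0// -!powRrM -powR12_sqrt//; congr (_ * _ `^ _); last by field.
  by rewrite divfK// powRr1// A_ge0.
by move: (_ ^+ k) => y; ring.
Qed.

Lemma gaussm_le k : exists2 C : R, 0 <= C & forall x, 0 <= x -> `|gaussm x k| <= C * x `^ (k%:R / 4).
Proof.
exists ((mu k)%:R * (A R `^ (1 / 2)) ^+ k) => [|x x0]; first by rewrite mulr_ge0// exprn_ge0// powR_ge0.
rewrite /gaussm ger0_norm ?mulr_ge0 ?exprn_ge0 ?mulr_ge0 ?powR_ge0// exprMn mulrA.
rewrite -[X in _ * X <= _]powR_mulrn ?powR_ge0// -powRrM (_ : 1 / 4 * k%:R = k%:R / 4)//.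
by rewrite mulrAC mul1r.
Qed.

(** The conditions under which [z] is large enough for [h]; the last one replaces [Az] by its limit
    [A] in the variance at cost [O(1)]. *)
Definition good z h := [/\ (0 < h)%N, (h ^ 2 <= z)%N, (1 < z)%N & `|Az R z - A R| * Num.sqrt h%:R <= 1].

Lemma mom2_gauss : exists2 C : R, 0 < C & forall z h, good z h ->
  `|mom R z h 2 - A R * Num.sqrt h%:R| <= C * h%:R `^ (1 / 3).
Proof.
exists (2 + 562 * expR 24 + 1) => [|z h [h0 hz z1 Ah]].
  by move: (expR_gt0 (24 : R)); move: (expR 24) => u; lra.
have hr : 1 <= (h%:R : R) by rewrite ler1n.
have h3 : 1 <= (h%:R : R) `^ (1 / 3) by rewrite -[leLHS](powRr0 (h%:R : R)) powR_le_max// divr_ge0.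
have H := mom2_asymp R hz z1 h0.
rewrite (_ : _ - _ = (mom R z h 2 - Az R z * Num.sqrt h%:R) + (Az R z - A R) * Num.sqrt h%:R); last by ring.
apply: le_trans (ler_normD _ _) _; rewrite [leRHS]mulrDl; apply: lerD => //.
by rewrite normrM [`|Num.sqrt _|]ger0_norm ?sqrtr_ge0// mul1r (le_trans Ah).
Qed.

(** The recurrence reproduces the Gaussian one. The error [h^(1/3)] in the variance saves 1/6 over
    [sqrt h], more than the 1/64 needed at worst, and the saving [1 / (64 k)] required decreases
    with [k], so the one inherited from two steps earlier suffices. *)
Lemma mom_gauss_step k (C1 : R) : 0 < C1 ->
  (forall z h, good z h -> `|mom R z h k.+1 - gaussm h%:R k.+1| <= C1 * h%:R `^ (k.+1%:R / 4 - k.+1%:R^-1 / 64)) ->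
  exists2 C : R, 0 < C & forall z h, good z h ->
  `|mom R z h k.+3 - gaussm h%:R k.+3| <= C * h%:R `^ (k.+3%:R / 4 - k.+3%:R^-1 / 64).
Proof.
move=> C10 H1; have [C2 C20 H2] := mom2_gauss; have [C3 C30 H3] := @mom_recurrence R k.+1.
have [C4 C40 H4] := gaussm_le k.+1; have A0 := A_ge0 R.
have GR := fun x => @gaussm_rec x k.+1; move: (A R) A0 H2 GR => a A0 H2 GR.
exists (C3 + k.+2%:R * (C2 * (C1 + C4) + a * C1)) => [|z h gzh].
  rewrite addr_gt0// mulr_gt0// ltr_pwDl//; last by rewrite mulr_ge0// ltW.
  by rewrite mulr_gt0// ltr_pwDl.
have [h0 _ _ _] := gzh.
have hr : 1 <= (h%:R : R) by rewrite ler1n.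
have hp : 0 < (h%:R : R) by rewrite ltr0n.
set x : R := h%:R in hr hp *.
have k3 : (k.+3%:R : R) = k.+1%:R + 2 by rewrite -addn2 natrD.
have k1 : 1 <= (k.+1%:R : R) by rewrite ler1n.
have i1 : (k.+1%:R : R)^-1 <= 1 by rewrite invf_le1// (lt_le_trans ltr01).
have i0 : 0 <= (k.+1%:R : R)^-1 by rewrite invr_ge0.
have i3 : (k.+3%:R : R)^-1 <= k.+1%:R^-1 by rewrite lef_pV2 ?posrE// ler_nat !ltnS (leqW (leqnSn k)).
set e := _ - _ / 64.
have X1 : 1 / 3 + k.+1%:R / 4 <= e.
  rewrite /e k3; move: (le_trans i3 i1); rewrite k3; set u := (_ + 2)^-1.
  by move: u (k.+1%:R : R); clear => u v; lra.
have X2 : 2^-1 + (k.+1%:R / 4 - k.+1%:R^-1 / 64) <= e.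
  rewrite /e k3; move: i3; rewrite k3; set u := (_ + 2)^-1.
  by move: (k.+1%:R^-1 : R) u (k.+1%:R : R); clear => t u v; lra.
have E1 : `|mom R z h k.+1 - gaussm x k.+1| <= C1 * x `^ (k.+1%:R / 4 - k.+1%:R^-1 / 64) by exact: H1.
have E2 : `|mom R z h k.+1| <= (C1 + C4) * x `^ (k.+1%:R / 4).
  rewrite -[X in `|X|](subrK (gaussm x k.+1)); apply: le_trans (ler_normD _ _) _.
  rewrite [leRHS]mulrDl; apply: lerD; last exact/H4/ltW.
  by apply: le_trans E1 _; rewrite ler_wpM2l ?(ltW C10)// powR_le_max// gerBl divr_ge0.
have E3 : `|mom R z h 2 * mom R z h k.+1 - a * Num.sqrt x * gaussm x k.+1| <=
    (C2 * (C1 + C4) + a * C1) * x `^ e.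
  rewrite (_ : _ - _ = (mom R z h 2 - a * Num.sqrt x) * mom R z h k.+1 +
     a * Num.sqrt x * (mom R z h k.+1 - gaussm x k.+1)); last by ring.
  apply: le_trans (ler_normD _ _) _; rewrite [`|_ * mom _ _ _ _|]normrM [`|a * _ * _|]normrM [`|a * _|]normrM [leRHS]mulrDl; apply: lerD.
    apply: le_trans (ler_pM _ _ (H2 z h gzh) E2) _ => //.
    rewrite mulrACA ler_wpM2l ?mulr_ge0 ?addr_ge0 ?(ltW C10) ?(ltW C20)//.
    by rewrite -powRD ?(gt_eqF hp) ?implybT// powR_le_max.
  rewrite (ger0_norm A0) -!mulrA ler_wpM2l// [`|Num.sqrt _|]ger0_norm ?sqrtr_ge0//.
  apply: le_trans (ler_wpM2l (sqrtr_ge0 _) E1) _.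
  rewrite mulrCA ler_wpM2l ?(ltW C10)// -powR12_sqrt ?(ltW hp)// -powRD ?(gt_eqF hp) ?implybT//.
  exact: powR_le_max.
rewrite GR ?(ltW hp)//.
rewrite (_ : _ - _ = (mom R z h k.+3 - k.+2%:R * mom R z h 2 * mom R z h k.+1) +
  k.+2%:R * (mom R z h 2 * mom R z h k.+1 - a * Num.sqrt x * gaussm x k.+1)); last by ring.
apply: le_trans (ler_normD _ _) _; rewrite [leRHS]mulrDl; apply: lerD; first exact: H3.
by rewrite normrM ger0_norm// -[leRHS]mulrA ler_wpM2l.
Qed.

Lemma mom_gauss k : exists2 C : R, 0 < C & forall z h, good z h ->
  `|mom R z h k.+1 - gaussm h%:R k.+1| <= C * h%:R `^ (k.+1%:R / 4 - k.+1%:R^-1 / 64).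
Proof.
suff [] : (exists2 C : R, 0 < C & forall z h, good z h ->
    `|mom R z h k.+1 - gaussm h%:R k.+1| <= C * h%:R `^ (k.+1%:R / 4 - k.+1%:R^-1 / 64)) /\
  (exists2 C : R, 0 < C & forall z h, good z h ->
    `|mom R z h k.+2 - gaussm h%:R k.+2| <= C * h%:R `^ (k.+2%:R / 4 - k.+2%:R^-1 / 64)) by [].
elim: k => [|k [IH1 IH2]]; last by split=> //; have [C C0 H] := IH1; exact: mom_gauss_step H.
split.
  exists 1 => // z h [h0 _ _ _]; rewrite mom1 /gaussm mul0r subrr normr0 mul1r powR_ge0//.
have [C C0 H] := mom2_gauss; exists C => // z h gzh; have [h0 _ _ _] := gzh.
rewrite gaussm_rec// (_ : gaussm _ 0 = 1); last by rewrite /gaussm /mu/= big_geq// expr0 mulr1.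
rewrite mul1r mulr1; apply: le_trans (H z h gzh) _; rewrite ler_wpM2l ?(ltW C0)// powR_le_max ?ler1n//.
by rewrite [leRHS](_ : _ = 63 / 128 :> R); [lra|field].
Qed.

End gaussian_moments.

(** * From averages over a period to moments over an interval *)

Section transfer_moments.
Variable R : realType.

Definition avg L (F : nat -> R) : R := (\sum_(1 <= n < L.+1) F n) / L%:R.

Definition sqcount z h n : R := \sum_(1 <= m < h.+1) (sqz z (n + m))%:R.

Lemma prod_sqz z i (hs : 'I_i -> nat) n : \prod_l (sqz z (n + hs l))%:R = free R z hs n.
Proof.
rewrite /free; case: eqP => [B0|/eqP/set0Pn[p]].
  rewrite big1// => l _; suff -> : sqz z (n + hs l) by [].
  apply/'forall_implyP => p pp; apply/negP => pn.
  by have := in_set0 p; rewrite -B0 in_set pp/= => /existsP[]; exists l.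
rewrite in_set => /andP[pp /existsP[l pl]]; rewrite (bigD1 l)//= (_ : sqz z (n + hs l) = false) ?mul0r//.
by apply/negP => /'forall_implyP/(_ p pp); rewrite pl.
Qed.

Lemma sqcount_exp z h i n :
  sqcount z h n ^+ i = \sum_(f : {ffun 'I_i -> 'I_h}) free R z (fun l => (f l).+1) n.
Proof.
have -> : sqcount z h n = \sum_(m < h) (sqz z (n + m.+1))%:R by rewrite /sqcount big_add1/= big_mkord.
rewrite -[in LHS](card_ord i) -prodr_const (bigA_distr_bigA (fun _ (m : 'I_h) => (sqz z (n + m.+1))%:R)).
by apply: eq_bigr => f _; rewrite -prod_sqz.
Qed.

Lemma avg_sum L (I : finType) (F : I -> nat -> R) :
  avg L (fun n => \sum_i F i n) = \sum_i avg L (F i).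
Proof. by rewrite /avg exchange_big/= mulr_suml. Qed.

Lemma avgZ L c F : avg L (fun n => c * F n) = c * avg L F.
Proof. by rewrite /avg -mulr_sumr mulrA. Qed.

Lemma transfer_sqcount i (eps : R) : 0 < eps ->
  exists2 C : R, 0 < C & forall z h L, (0 < L)%N -> (h <= L)%N ->
  `|avg L (fun n => sqcount z h n ^+ i) - pavg z (fun n => sqcount z h n ^+ i)| <=
  C * h%:R ^+ i * L%:R `^ (- (1 / 3) + eps).
Proof.
move=> e0; have [C C0 H] := transfer_free i e0; exists C => // z h L L0 hL.
have E : (fun n => sqcount z h n ^+ i) =
    fun n => \sum_(f : {ffun 'I_i -> 'I_h}) free R z (fun l => (f l).+1) n.
  by apply: funext => n; exact: sqcount_exp.
rewrite E avg_sum pavg_sum -sumrB; apply: le_trans (ler_norm_sum _ _ _) _.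
apply: le_trans (_ : \sum_(f : {ffun 'I_i -> 'I_h}) C * L%:R `^ (- (1 / 3) + eps) <= _).
  by apply: ler_sum => f _; apply: H => // l; apply: leq_trans hL.
rewrite sumr_const card_ffun !card_ord -[_ *+ _]mulr_natr natrX.
by rewrite mulrAC.
Qed.

Lemma dev_expE z h j n : dev R z h n ^+ j =
  \sum_(i < j.+1) ((- (h%:R * dens R z)) ^+ (j - i) *+ 'C(j, i)) * sqcount z h n ^+ i.
Proof.
rewrite /dev -/(sqcount z h n) addrC exprDn; apply: eq_bigr => i _.
by rewrite [RHS]mulrnAl.
Qed.

Lemma dens_le1 z : 0 <= dens R z <= 1.
Proof.
apply/andP; split; first by apply: pavg_ge0 => n.
by rewrite -(pavg_cst z (1 : R)); apply: pavg_le => n; case: (sqz z n).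
Qed.

(** A raw moment is a sum over [h ^ i] tuples of shifts, each transferred with the same error;
    expanding the deviation by the binomial theorem then loses the full factor [h ^ j], as no
    cancellation is used. *)
Lemma transfer_dev j (eps : R) : 0 < eps ->
  exists2 C : R, 0 < C & forall z h L, (0 < L)%N -> (h <= L)%N ->
  `|avg L (fun n => dev R z h n ^+ j) - mom R z h j| <= C * h%:R ^+ j * L%:R `^ (- (1 / 3) + eps).
Proof.
move=> e0; have /choice[C HC] : forall i, exists C : R, 0 < C /\ forall z h L, (0 < L)%N -> (h <= L)%N ->
    `|avg L (fun n => sqcount z h n ^+ i) - pavg z (fun n => sqcount z h n ^+ i)| <=
    C * h%:R ^+ i * L%:R `^ (- (1 / 3) + eps).
  by move=> i; have [C C0 H] := transfer_sqcount i e0; exists C.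
exists (1 + \sum_(i < j.+1) 'C(j, i)%:R * C i) => [|z h L L0 hL].
  by rewrite ltr_pwDl// sumr_ge0// => i _; rewrite mulr_ge0// ltW//; have [] := HC i.
have E : (fun n => dev R z h n ^+ j) =
    fun n => \sum_(i < j.+1) ((- (h%:R * dens R z)) ^+ (j - i) *+ 'C(j, i)) * sqcount z h n ^+ i.
  by apply: funext => n; exact: dev_expE.
rewrite /mom E avg_sum pavg_sum -sumrB; apply: le_trans (ler_norm_sum _ _ _) _.
set y := L%:R `^ _; have y0 : 0 <= y by exact: powR_ge0.
apply: le_trans (_ : \sum_(i < j.+1) 'C(j, i)%:R * C i * (h%:R ^+ j * y) <= _); last first.
  by rewrite -mulr_suml -[leRHS]mulrA ler_wpM2r ?mulr_ge0 ?exprn_ge0// lerDr.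
apply: ler_sum => i _; have [Ci0 Hi] := HC i.
rewrite avgZ pavgZ -mulrBr normrM -[_ *+ 'C(_, _)]mulr_natl normrM normr_nat normrX normrN.
have /andP[d0 d1] := dens_le1 z.
have hd0 : 0 <= h%:R * dens R z := mulr_ge0 (ler0n _ _) d0.
rewrite (ger0_norm hd0).
have ij : (i <= j)%N by rewrite -ltnS.
rewrite -!mulrA ler_wpM2l//; apply: le_trans (ler_pM _ _ (_ : _ <= h%:R ^+ (j - i)) (Hi z h L L0 hL)) _ => //.
- by rewrite exprn_ge0.
- by apply: lerXn2r; rewrite ?nnegrE; [exact: hd0|exact: ler0n|exact: ler_piMr].
have -> : (h%:R : R) ^+ j = h%:R ^+ (j - i) * h%:R ^+ i by rewrite -exprD subnK.
by rewrite -/y le_eqVlt; apply/orP; left; apply/eqP; move: (_ ^+ (j - i)) (_ ^+ i) => u v; ring.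
Qed.

Lemma sqz_squarefree z m : (0 < m)%N -> (m < z ^ 2)%N -> sqz z m = squarefree m.
Proof.
move=> m0 mz; apply/'forall_implyP/squarefreeP => [H|[_ H] p pp]; last first.
  by apply: H; exact: (pr_prime (subxx _) pp).
split=> // p pp; apply/negP => pm.
have pz : (p < z)%N by rewrite -(ltn_exp2r _ _ (isT : (0 < 2)%N)) (leq_ltn_trans _ mz)// dvdn_leq.
have pzp : Ordinal pz \in pr z by rewrite prP.
by have /negP := H _ pzp; apply.
Qed.

Lemma NSint_sum n (H : R) : 0 <= H ->
  NSint n H = \sum_(1 <= m < (Num.truncn H).+1) (squarefree (n + m))%:R.
Proof.
move=> H0; rewrite /NSint /NS.
have -> : Num.truncn (n%:R + H) = (n + Num.truncn H)%N by rewrite truncnD ?natrK// nat_num.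
rewrite natrK (big_cat_nat (n := n.+1))//=; last by rewrite ltnS leq_addr.
rewrite natrD addrAC subrr add0r -[n.+1]add1n big_addn subSn ?leq_addr// addKn.
rewrite big_mkcond/= natr_sum; apply: eq_bigr => m _.
by rewrite addnC; case: ifP.
Qed.

End transfer_moments.

Section moment_bound.
Variable R : realType.

(** Passing from [H] to an integer within 1 below it changes [H^(1/4)] by at most 1, hence the main
    term by one factor [H^(1/4)] less than its size. *)
Lemma gaussm_shift k : exists2 C : R, 0 <= C & forall (h : nat) (H : R), (0 < h)%N -> h%:R <= H <= h%:R + 1 ->
  `|gaussm H k.+1 - gaussm h%:R k.+1| <= C * H `^ (k%:R / 4).
Proof.
exists ((mu k.+1)%:R * (A R `^ (1 / 2)) ^+ k.+1 * k.+1%:R) => [|h H h0 /andP[hH Hh]].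
  by rewrite mulr_ge0// mulr_ge0// exprn_ge0// powR_ge0.
have hp : 0 < (h%:R : R) by rewrite ltr0n.
have Hp : 0 < H by apply: lt_le_trans hH.
have H1 : 1 <= H by rewrite (le_trans _ hH)// ler1n.
pose u : R := h%:R `^ (1 / 4); pose v := H `^ (1 / 4).
have u1 : 1 <= u by rewrite -[leLHS](powRr0 (h%:R : R)) powR_le_max ?ler1n// divr_ge0.
have uv : u <= v by rewrite ge0_ler_powR ?nnegrE ?divr_ge0// ltW.
have vu : v <= u + 1.
  have -> : u + 1 = ((u + 1) ^+ 4) `^ (1 / 4).
    rewrite -powR_mulrn ?addr_ge0 ?powR_ge0// -powRrM (_ : 4%:R * (1 / 4) = 1 :> R); last by field.
    by rewrite powRr1 ?addr_ge0 ?powR_ge0.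
  rewrite ge0_ler_powR ?nnegrE ?divr_ge0 ?exprn_ge0 ?addr_ge0 ?powR_ge0 ?(ltW Hp)//.
  apply: le_trans Hh _; have -> : (h%:R : R) = u ^+ 4.
    rewrite -powR_mulrn ?powR_ge0// -powRrM (_ : 1 / 4 * 4%:R = 1 :> R); last by field.
    by rewrite powRr1// ltW.
  have u0 : 0 <= u by exact: powR_ge0.
  rewrite -subr_ge0 (_ : _ - _ = 4 * u ^+ 3 + 6 * u ^+ 2 + 4 * u); last by ring.
  by rewrite !addr_ge0 ?mulr_ge0 ?exprn_ge0.
have v0 : 0 <= v by exact: powR_ge0.
have E : H `^ (k%:R / 4) = v ^+ k.
  by rewrite -powR_mulrn// -powRrM mulrAC mul1r.
rewrite /gaussm !exprMn -/u -/v E.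
set c := A R `^ (1 / 2); have c0 : 0 <= c by exact: powR_ge0.
rewrite (_ : _ - _ = (mu k.+1)%:R * c ^+ k.+1 * (v ^+ k.+1 - u ^+ k.+1)); last first.
  by move: (c ^+ k.+1) => y; ring.
rewrite normrM ger0_norm ?mulr_ge0 ?exprn_ge0// -[leRHS]mulrA ler_wpM2l ?mulr_ge0 ?exprn_ge0//.
rewrite subrXX normrM -[leRHS]mul1r; apply: ler_pM => //.
  by rewrite ger0_norm ?subr_ge0// lerBlDl.
apply: le_trans (ler_norm_sum _ _ _) _.
apply: le_trans (_ : \sum_(i < k.+1) v ^+ k <= _); last by rewrite sumr_const card_ord mulr_natl.
apply: ler_sum => i _; have u0 : 0 <= u by exact: powR_ge0.
rewrite ger0_norm ?mulr_ge0 ?exprn_ge0// -[k.+1.-1]/k.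
have ik : (i <= k)%N by rewrite -ltnS.
have -> : v ^+ k = v ^+ (k - i) * v ^+ i by rewrite -exprD subnK.
by rewrite ler_wpM2l ?exprn_ge0// lerXn2r ?nnegrE.
Qed.

Lemma mom_le j : exists2 C : R, 0 <= C & forall z h, good R z h -> `|mom R z h j| <= C * h%:R `^ (j%:R / 4).
Proof.
case: j => [|j]; first by exists 1 => // z h _; rewrite mom0 normr1 mul0r powRr0 mulr1.
have [C C0 H] := @mom_gauss R j; have [C' C'0 H'] := @gaussm_le R j.+1.
exists (C + C') => [|z h gzh]; first by rewrite addr_ge0// ltW.
have [h0 _ _ _] := gzh.
rewrite -[X in `|X|](subrK (gaussm h%:R j.+1)); apply: le_trans (ler_normD _ _) _.
rewrite [leRHS]mulrDl; apply: lerD; last exact: H'.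
apply: le_trans (H z h gzh) _; rewrite ler_wpM2l ?(ltW C0)// powR_le_max ?ler1n// gerBl.
by rewrite divr_ge0// invr_ge0.
Qed.

(** [2 * L < z ^ 2] makes [sqz] exact on all [n + m] with [n], [m] at most [L]; the last clause
    keeps the two centrings, by [zeta 2] and by [dens], at bounded distance. *)
Lemma exists_cutoff (h L : nat) : (0 < h)%N -> exists z, [/\ good R z h, (2 * L < z ^ 2)%N &
  h%:R * `|dens R z * zeta 2 - 1| <= 1].
Proof.
move=> h0; have hr : 0 < (h%:R : R) by rewrite ltr0n.
have sp : 0 < Num.sqrt (h%:R : R) by rewrite sqrtr_gt0.
have /cvgrPdist_le/(_ (Num.sqrt h%:R)^-1) := @cvg_Az R.
rewrite invr_gt0 => /(_ sp)[z0 _ Hz].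
pose z := maxn z0 (maxn (h ^ 2) (2 * L + h + 2)).
have z1 : (1 < z)%N by rewrite !leq_max; apply/orP; right; apply/orP; right; lia.
have zh : (h <= z.-1)%N by rewrite -ltnS prednK ?(ltnW z1)// !leq_max; apply/orP; right; apply/orP; right; lia.
exists z; split.
- split=> //; first by rewrite !leq_max leqnn orbT.
  by rewrite distrC -ler_pdivlMr// mul1r; apply: Hz => /=; rewrite leq_max leqnn.
- have zL : (2 * L < z)%N by rewrite !leq_max; apply/orP; right; apply/orP; right; lia.
  by apply: leq_trans zL _; rewrite -mulnn leq_pmull// ltnW.
apply: le_trans (ler_wpM2l (ltW hr) (@dens_zeta R z z1)) _.
have zr : 0 < (z.-1%:R : R) by rewrite ltr0n (leq_trans h0).
by rewrite ler_pdivrMr// mul1r ler_nat.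
Qed.

Lemma M_avg k (X H : R) z : 1 <= H -> H <= X -> (2 * Num.truncn X < z ^ 2)%N ->
  M k X H = (Num.truncn X)%:R / X *
    \sum_(j < k.+1) ((- (H / zeta 2 - (Num.truncn H)%:R * dens R z)) ^+ (k - j) *+ 'C(k, j)) *
      avg (Num.truncn X) (fun n => dev R z (Num.truncn H) n ^+ j).
Proof.
move=> H1 HX zX; set L := Num.truncn X; set h := Num.truncn H; set t := _ - _ * _.
have X1 : 1 <= X by apply: le_trans HX.
have L0 : (0 < L)%N by rewrite truncn_gt0.
have hL : (h <= L)%N by apply: le_truncn.
have Lr : (L%:R : R) != 0 by rewrite pnatr_eq0 -lt0n.
have Xn : X != 0 by rewrite gt_eqF// (lt_le_trans ltr01).
transitivity (L%:R / X * avg L (fun n => (- t + dev R z h n) ^+ k)).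
  rewrite /M /avg -/L (_ : L%:R / X * _ = X^-1 * \sum_(1 <= n < L.+1) (- t + dev R z h n) ^+ k); last first.
    by move: (\sum_(_ <= _ < _) _) => s; field; rewrite Xn Lr.
  congr (_ * _); rewrite !big_nat; apply: eq_bigr => n /andP[n0 nL]; congr (_ ^+ _).
  rewrite NSint_sum ?(le_trans ler01)// -/h /dev /t.
  rewrite (_ : \sum_(1 <= m < h.+1) (squarefree (n + m))%:R = \sum_(1 <= m < h.+1) (sqz z (n + m))%:R :> R).
    by move: (\sum_(_ <= _ < _) _) => s; ring.
  rewrite !big_nat; apply: eq_bigr => m /andP[m0 mh]; rewrite sqz_squarefree ?addn_gt0 ?n0//.
  by apply: leq_ltn_trans zX; rewrite mul2n -addnn leq_add// (leq_trans _ hL).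
congr (_ * _).
have -> : (fun n => (- t + dev R z h n) ^+ k) =
    fun n => \sum_(j < k.+1) ((- t) ^+ (k - j) *+ 'C(k, j)) * dev R z h n ^+ j.
  by apply: funext => n; rewrite exprDn; apply: eq_bigr => j _; rewrite [RHS]mulrnAl.
by rewrite avg_sum; apply: eq_bigr => j _; rewrite avgZ.
Qed.

(** The order of quantifiers matters: [C0] does not depend on [eps], and only the coefficient [C1]
    of the transfer error does. This allows the theorem to hide [C1] in the [o(1)]. *)
Lemma moment_bound k : exists2 C0 : R, 0 <= C0 & forall eps, 0 < eps -> eps <= 1 / 3 ->
  exists2 C1 : R, 0 < C1 & forall X H, 1 <= H -> H <= X ->
  `|M k.+1 X H - gaussm H k.+1| <= C0 * H `^ (k.+1%:R / 4 - k.+1%:R^-1 / 64) +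
     C1 * (H ^+ k.+1 * X `^ (- (1 / 3) + eps)).
Proof.
have [Cg Cg0 HCg] := @mom_gauss R k; have [Cs Cs0 HCs] := gaussm_shift k.
have [C4 C40 HC4] := @gaussm_le R k.+1.
have /choice[Cm HCm] : forall j, exists C : R, 0 <= C /\
    forall z h, good R z h -> `|mom R z h j| <= C * h%:R `^ (j%:R / 4).
  by move=> j; have [C ? ?] := mom_le j; exists C.
pose P := \sum_(j < k.+1) 2 ^+ k.+1 * 'C(k.+1, j)%:R * Cm j.
have P0 : 0 <= P by apply: sumr_ge0 => j _; rewrite !mulr_ge0// ?exprn_ge0//; have [] := HCm j.
exists (P + Cg + Cs) => [|eps e0 e1]; first by rewrite !addr_ge0// ltW.
have /choice[Ct HCt] : forall j, exists C : R, 0 < C /\ forall z h L, (0 < L)%N -> (h <= L)%N ->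
    `|avg L (fun n => dev R z h n ^+ j) - mom R z h j| <= C * h%:R ^+ j * L%:R `^ (- (1 / 3) + eps).
  by move=> j; have [C ? ?] := @transfer_dev R j eps e0; exists C.
pose T := \sum_(j < k.+2) 2 ^+ k.+1 * 'C(k.+1, j)%:R * Ct j.
have T0 : 0 <= T by apply: sumr_ge0 => j _; rewrite !mulr_ge0// ?exprn_ge0//; have [/ltW] := HCt j.
exists (1 + (T * 2 + C4)) => [|X H H1 HX]; first by rewrite ltr_pwDl// addr_ge0// mulr_ge0.
have X1 : 1 <= X by apply: le_trans HX.
have Xp : 0 < X by apply: lt_le_trans X1.
have Hp : 0 < H by apply: lt_le_trans H1.
set L := Num.truncn X; set h := Num.truncn H.
have L0 : (0 < L)%N by rewrite truncn_gt0.
have h0 : (0 < h)%N by rewrite truncn_gt0.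
have hL : (h <= L)%N by apply: le_truncn.
have hr : 1 <= (h%:R : R) by rewrite ler1n.
have hp : 0 < (h%:R : R) by rewrite ltr0n.
have Lp : 0 < (L%:R : R) by rewrite ltr0n.
have /andP[hH Hh] : (h%:R : R) <= H < h.+1%:R by apply: truncn_itv; exact: ltW.
have /andP[LX XL] : (L%:R : R) <= X < L.+1%:R by apply: truncn_itv; exact: ltW.
have [z [gzh zX dz]] := exists_cutoff L h0.
rewrite (M_avg k.+1 H1 HX zX) -/L -/h; set t := H / zeta 2 - h%:R * dens R z.
have s2 : 1 < (2 : R) by rewrite ltr1n.
have z1 := zeta_ge1 s2; have zp : 0 < zeta (2 : R) by apply: lt_le_trans z1.
have zV : (zeta (2 : R))^-1 <= 1 by rewrite invf_le1.
(* One unit comes from the fractional part of [H], the other from [dens] against the inverse of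
   [zeta 2]. *)
have t2 : `|t| <= 2.
  have -> : t = (H - h%:R) * (zeta 2)^-1 - h%:R * (dens R z * zeta 2 - 1) * (zeta 2)^-1.
    by rewrite /t; move: (dens R z) (zeta 2) zp => d w /lt0r_neq0 wn; field.
  apply: le_trans (ler_normB _ _) _; rewrite (_ : 2 = 1 + 1); last by ring.
  have zV0 : 0 <= (zeta (2 : R))^-1 by rewrite invr_ge0 ltW.
  apply: lerD; rewrite normrM (ger0_norm zV0) -[leRHS]mul1r; apply: ler_pM => //.
    by rewrite ger0_norm ?subr_ge0// lerBlDl natr1 ltW.
  by rewrite normrM ger0_norm.
set e := _ - _ / 64.
have Kr : 1 <= (k.+1%:R : R) by rewrite ler1n.
have ke : k%:R / 4 <= e.
  have : (k.+1%:R : R)^-1 <= 1 by rewrite invf_le1// (lt_le_trans ltr01).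
  rewrite /e; have -> : (k.+1%:R : R) = k%:R + 1 by rewrite natr1.
  by set v := (_ + 1)^-1; move: v (k%:R : R); clear => v w; lra.
have e_ge0 : 0 <= e by apply: le_trans ke; rewrite divr_ge0.
have hHe : (h%:R : R) `^ e <= H `^ e by rewrite ge0_ler_powR ?nnegrE ?(ltW hp) ?(ltW Hp).
pose c (j : nat) : R := (- t) ^+ (k.+1 - j) *+ 'C(k.+1, j).
have c_le j : `|c j| <= 2 ^+ k.+1 * 'C(k.+1, j)%:R.
  rewrite /c -mulr_natr normrM normr_nat ler_wpM2r// normrX normrN.
  apply: le_trans (_ : 2 ^+ (k.+1 - j) <= _); first by rewrite lerXn2r ?nnegrE.
  by rewrite ler_weXn2l ?leq_subr// ler1n.
set r := L%:R / X; have r0 : 0 <= r by rewrite divr_ge0 ?(ltW Xp).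
have r1 : r <= 1 by rewrite ler_pdivrMr// mul1r.
set D := X `^ _; have D0 : 0 <= D by exact: powR_ge0.
pose a j := avg L (fun n => dev R z h n ^+ j).
pose m j := mom R z h j.
have E1 : `|\sum_(j < k.+2) c j * (a j - m j)| <= T * (H ^+ k.+1 * (2 * D)).
  apply: le_trans (ler_norm_sum _ _ _) _; rewrite /T mulr_suml; apply: ler_sum => j _.
  have [Ct0 HC] := HCt j; rewrite [`|c j * _|]normrM.
  apply: le_trans (ler_pM _ _ (c_le j) (HC z h L L0 hL)) _ => //.
  rewrite -[leRHS]mulrA -[Ct j * _ * _]mulrA ler_wpM2l ?mulr_ge0 ?exprn_ge0// ler_wpM2l ?(ltW Ct0)//.
  apply: ler_pM; rewrite ?exprn_ge0 ?powR_ge0//.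
    apply: le_trans (_ : H ^+ j <= _); first by rewrite lerXn2r ?nnegrE ?(ltW Hp).
    by rewrite ler_weXn2l// -ltnS.
  have -> : - (1 / 3) + eps = - (1 / 3 - eps) by rewrite opprB addrC.
  (* With a nonpositive exponent and [X <= 2 * L], replacing [L] by [X] costs at most a factor 2. *)
  have ee : 0 <= 1 / 3 - eps by rewrite subr_ge0.
  rewrite /D (_ : - (1 / 3) + eps = - (1 / 3 - eps)); last by rewrite opprB addrC.
  rewrite !powRN ler_pdivlMr ?powR_gt0// mulrC ler_pdivrMr ?powR_gt0//.
  apply: le_trans (_ : (2 * L%:R) `^ (1 / 3 - eps) <= _).
    rewrite ge0_ler_powR ?nnegrE ?(ltW Xp) ?mulr_ge0//; apply: le_trans (ltW XL) _.
    by rewrite -natr1 mulr_natl mulr2n lerD2l ler1n.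
  rewrite powRM// ler_wpM2r ?powR_ge0//; apply: le_trans (_ : 2 `^ 1 <= _); last by rewrite powRr1.
  by rewrite powR_le_max ?ler1n//; move: e0; clear; lra.
(* The top term has coefficient 1 and is the Gaussian one. Since [t] is bounded, the lower terms are
   at most a constant times [H ^ (k / 4)], within the allowed error. *)
have E2 : `|\sum_(j < k.+2) c j * m j - gaussm h%:R k.+1| <= (P + Cg) * H `^ e.
  rewrite big_ord_recr/= {2}/c subnn expr0 binn mulr1n mul1r -addrA.
  apply: le_trans (ler_normD _ _) _; rewrite [leRHS]mulrDl; apply: lerD; last first.
    by apply: le_trans (HCg z h gzh) _; rewrite ler_wpM2l ?(ltW Cg0).
  apply: le_trans (ler_norm_sum _ _ _) _; rewrite /P mulr_suml; apply: ler_sum => j _.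
  have [Cm0 HC] := HCm j; rewrite [`|c j * _|]normrM -[leRHS]mulrA; apply: ler_pM => //.
  apply: le_trans (HC z h gzh) _; rewrite ler_wpM2l//; apply: le_trans hHe.
  rewrite powR_le_max//; apply: le_trans ke; rewrite ler_wpM2r// ler_nat; by rewrite -ltnS.
have E3 : `|gaussm h%:R k.+1 - gaussm H k.+1| <= Cs * H `^ e.
  rewrite distrC; apply: le_trans (HCs h H h0 _) _; first by rewrite hH/= natr1 ltW.
  by rewrite ler_wpM2l// powR_le_max.
(* [M] divides by [X] but sums over [L] integers; the ratio differs from 1 by at most [1 / X]. *)
have E4 : `|(r - 1) * gaussm H k.+1| <= C4 * (H ^+ k.+1 * D).
  rewrite [`|(r - 1) * _|]normrM [`|r - 1|]distrC [`|1 - r|]ger0_norm ?subr_ge0//.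
  have rX : 1 - r <= D.
    apply: le_trans (_ : X^-1 <= _).
      have XL1 : X - L%:R <= 1 by rewrite lerBlDl natr1; exact: ltW.
      have -> : 1 - r = (X - L%:R) * X^-1 by rewrite /r mulrBl divff ?gt_eqF.
      by rewrite ler_piMl// invr_ge0 ltW.
    rewrite -(powR_inv1 (ltW Xp)) powR_le_max//.
    by apply: le_trans (_ : - (1 / 3) <= _); [lra|rewrite lerDl ltW].
  rewrite [leRHS](_ : _ = D * (C4 * H ^+ k.+1)); last by move: (H ^+ k.+1) => w; ring.
  apply: ler_pM; rewrite ?subr_ge0//.
  apply: le_trans (HC4 H (ltW Hp)) _; rewrite ler_wpM2l// -powR_mulrn ?(ltW Hp)// powR_le_max//.
  by rewrite ler_pdivrMr// ler_peMr// ler1n.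
have -> : \sum_(j < k.+2) (- t) ^+ (k.+1 - j) *+ 'C(k.+1, j) * avg L (fun n => dev R z h n ^+ j) =
    \sum_(j < k.+2) c j * (a j - m j) + \sum_(j < k.+2) c j * m j.
  by rewrite -big_split/=; apply: eq_bigr => j _; rewrite -mulrDr subrK.
move: (\sum_(j < k.+2) c j * (a j - m j)) (\sum_(j < k.+2) c j * m j) E1 E2 => S1 S2 E1 E2.
rewrite (_ : _ - _ = (r * S1 + (r - 1) * gaussm H k.+1) +
  r * ((S2 - gaussm h%:R k.+1) + (gaussm h%:R k.+1 - gaussm H k.+1))); last by ring.
rewrite addrC; apply: le_trans (ler_normD _ _) _; apply: lerD.
  rewrite normrM (ger0_norm r0); apply: le_trans (ler_piMl _ r1) _ => //.
  by apply: le_trans (ler_normD _ _) _; rewrite [leRHS]mulrDl; apply: lerD.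
apply: le_trans (ler_normD _ _) _; rewrite [leRHS]mulrDl -[leLHS]add0r; apply: lerD.
  by rewrite mul1r mulr_ge0 ?exprn_ge0// ltW.
rewrite [leRHS]mulrDl; apply: lerD => //; rewrite normrM (ger0_norm r0).
apply: le_trans (ler_piMl _ r1) _ => //; apply: le_trans E1 _.
by rewrite -mulrA ler_wpM2l// mulrCA.
Qed.

End moment_bound.

(** * The asymptotic formula with its [o(1)] exponent *)

Local Open Scope classical_set_scope.

Theorem theorem1p1 (R : realType) :
  exists2 c : R, 0 < c &
  forall k : nat, (0 < k)%N ->
  exists (C : R) (e : R -> R),
    e X @[X --> +oo%R] --> (0 : R) /\
    \forall X \near +oo%R, forall H : R, 1 <= H <= X ->
      `| M k X H - (mu k)%:R * (A R `^ (1 / 2) * H `^ (1 / 4)) ^+ k |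
      <= C * (H `^ (k%:R / 4 - c / k%:R) + H ^+ k * X `^ (- (1 / 3) + e X)).
Proof.
exists (1 / 64) => [|[//|k] _]; first by rewrite divr_gt0.
have [C0 C00 HC0] := @moment_bound R k.
pose gap (X H : R) : R := `|M k.+1 X H - (mu k.+1)%:R * (A R `^ (1 / 2) * H `^ (1 / 4)) ^+ k.+1|.
pose bnd (s X H : R) : R := H `^ (k.+1%:R / 4 - 1 / 64 / k.+1%:R) + H ^+ k.+1 * X `^ (- (1 / 3) + s).
(* [G X] is the set of exponents [s] that work at [X] with one fixed constant. The [+ 1] in it gives
   the transfer term a coefficient at least 1 even when [C0] is 0. *)
pose G (X : R) : set R := fun s => 0 < s /\ forall H, 1 <= H <= X -> gap X H <= (C0 + 1) * bnd s X H.
have C1 : 0 <= C0 + 1 by rewrite addr_ge0.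
have GP s : 0 < s -> \forall X \near +oo, G X s.
  (* Half of [s] is the transfer loss; the other half absorbs the constant, as [D <= X ^ (s / 2)]
     for large [X]. *)
  move=> s0; pose eps := Num.min (s / 2) (1 / 3).
  have e0 : 0 < eps by rewrite lt_min !divr_gt0.
  have e3 : eps <= 1 / 3 by rewrite ge_min lexx orbT.
  have es : eps <= s / 2 by rewrite ge_min lexx.
  have [D D0 HD] := HC0 eps e0 e3.
  near=> X; split=> // H /andP[H1 HX]; apply: le_trans (HD X H H1 HX) _.
  have X1 : 1 <= X by apply: le_trans HX.
  have Xp : 0 < X by apply: lt_le_trans X1.
  rewrite /bnd mulrDr; apply: lerD.
    rewrite (_ : k.+1%:R^-1 / 64 = 1 / 64 / k.+1%:R); last by rewrite mul1r mulrC.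
    by rewrite ler_wpM2r ?powR_ge0// lerDl.
  have H0 : 0 <= H ^+ k.+1 by rewrite exprn_ge0// (le_trans ler01).
  apply: le_trans (_ : 1 * (H ^+ k.+1 * X `^ (- (1 / 3) + s)) <= _); last first.
    by rewrite ler_wpM2r ?mulr_ge0 ?powR_ge0// lerDr.
  rewrite [leRHS]mul1r [leLHS]mulrCA ler_wpM2l//.
  apply: le_trans (_ : X `^ (s / 2) * X `^ (- (1 / 3) + eps) <= _).
    rewrite ler_wpM2r ?powR_ge0//.
    have -> : D = (D `^ (2 / s)) `^ (s / 2).
      rewrite -powRrM (_ : 2 / s * (s / 2) = 1) ?powRr1 ?(ltW D0)//.
      by move: s0 => /lt0r_neq0 sn; field.
    rewrite ge0_ler_powR ?nnegrE ?powR_ge0 ?(ltW Xp) ?divr_ge0 ?(ltW s0)//.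
  rewrite -powRD ?(gt_eqF Xp) ?implybT// powR_le_max//.
  by move: es; clear; move: eps => u; lra.
(* Each fixed [s] eventually lies in [G X], so the infimum tends to 0. It need not be attained:
   adding [X^-1] moves above some element, and [G X] is upward closed for [X >= 1]. *)
exists (C0 + 1), (fun X => inf (G X) + X^-1).
have lbG X : lbound (G X) 0 by move=> s [/ltW].
have keyG : \forall X \near +oo, G X (inf (G X) + X^-1).
  near=> X; have X0 : 0 < X by near: X; apply: nbhs_pinfty_gt; rewrite num_real.
  have X1 : 1 <= X by near: X; apply: nbhs_pinfty_ge; rewrite num_real.
  have G1 : G X 1 by near: X; exact: GP.
  have hG : has_inf (G X) by split; [exists 1|exists 0; exact: lbG].
  have XV0 : 0 < X^-1 by rewrite invr_gt0.
  have [s [s0 Gs] sX] := inf_adherent XV0 hG; split; first exact: lt_trans sX.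
  move=> H HX; apply: le_trans (Gs H HX) _; rewrite ler_wpM2l// /bnd lerD2l ler_wpM2l//.
    by have /andP[H1 _] := HX; rewrite exprn_ge0// (le_trans ler01).
  by rewrite powR_le_max// lerD2l ltW.
split; last first.
  by near=> X; have [_] : G X (inf (G X) + X^-1) by near: X.
apply/cvgrPdist_le => d d0; have d2 : 0 < d / 2 by rewrite divr_gt0.
near=> X.
have X0 : 0 < X by near: X; apply: nbhs_pinfty_gt; rewrite num_real.
have Gd : G X (d / 2) by near: X; exact: GP.
have infle : inf (G X) <= d / 2 by apply: ge_inf => //; exists 0; exact: lbG.
have inf0 : 0 <= inf (G X) by apply: lb_le_inf; [exists (d / 2)|exact: lbG].
rewrite sub0r normrN ger0_norm ?addr_ge0 ?invr_ge0 ?(ltW X0)//.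
rewrite [d]splitr lerD// -[leRHS]invrK lef_pV2 ?posrE ?invr_gt0//.
Unshelve. all: by end_near.
Qed.
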